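(* Let $\epsilon>0$ and $\gamma>8\epsilon$. Let $\mathcal{U}=(G,M,k)$ be a $(1-\epsilon)$-satisfiable instance of Unique Games on a $d$-regular graph $G$ on $n$ vertices with alphabet size $k$, where $M$ is the adjacency matrix of the label-extended graph of $\mathcal{U}$. Let $W$ be the space spanned by the eigenvectors of $M$ that have eigenvalue greater than $(1-\gamma)d$. Then there is an algorithm that runs in time $2^{O(\frac{\gamma}{\epsilon}\dim(W))}+\mathrm{poly}(n\cdot k)$ and finds an assignment that satisfies at least a $1-O\!\left(\frac{\epsilon}{\gamma-8\epsilon}+\epsilon\right)$ fraction of the constraints.
   Context: A Unique Games instance consists of a graph $G=(V,E)$ with $|V|=n$ and edge weights $w_{uv}\in[0,1]$, an alphabet $[k]$, and for each edge $(u,v)$ a permutation $\pi_{uv}:[k]\to[k]$ with $\pi_{vu}=\pi_{uv}^{-1}$. An assignment (labeling) $L:V\to[k]$ satisfies the constraint on $(u,v)$ if $\pi_{uv}(L(u))=L(v)$; the fraction of satisfied constraints is measured by total edge weight. The instance is $(1-\epsilon)$-satisfiable if some assignment satisfies at least a $(1-\epsilon)$ fraction of the constraints. $G$ is $d$-regular if $\sum_v w_{uv}=d$ for every $u$. The label-extended graph has the $nk\times nk$ symmetric adjacency matrix $M$ whose $k\times k$ block $M_{uv}$ equals $w_{uv}\Pi_{uv}$, where $\Pi_{uv}(i,j)=1$ if $\pi_{uv}(i)=j$ and $0$ otherwise (and $M_{uv}=0$ if $(u,v)\notin E$). *)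

(* Defs.v *)
From HB Require Import structures.
From mathcomp Require Import all_boot all_order all_algebra all_fingroup.
From mathcomp Require Import boolp reals exp.

Set Implicit Arguments.
Unset Strict Implicit.
Unset Printing Implicit Defensive.

Import Order.TTheory GRing.Theory Num.Theory.
Local Open Scope ring_scope.

(** * Unique Games *)

(* The values of [ug_weight] and [ug_perm] outside the edge relation are junk:
   every definition below only looks at them on edges. *)
Record unique_game (R : realType) (n k : nat) := UniqueGame {
  ug_edge : rel 'I_n;
  ug_weight : 'I_n -> 'I_n -> R;
  ug_perm : 'I_n -> 'I_n -> {perm 'I_k};
  ug_edge_irr : irreflexive ug_edge;
  ug_edge_sym : symmetric ug_edge;
  ug_weight_sym : forall u v, ug_edge u v -> ug_weight u v = ug_weight v u;
  ug_weight_01 : forall u v, ug_edge u v -> 0 <= ug_weight u v <= 1;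
  ug_perm_inv : forall u v, ug_edge u v -> ug_perm v u = (ug_perm u v)^-1%g
}.

Section UniqueGames.
Variables (R : realType) (n k : nat) (U : unique_game R n k).

Definition satisfies (L : 'I_n -> 'I_k) (u v : 'I_n) : bool :=
  ug_perm U u v (L u) == L v.

(* [u < v] counts every undirected edge once; [satisfies L] is symmetric on
   edges by [ug_perm_inv]. *)
Definition total_weight : R :=
  \sum_(u < n) \sum_(v < n | (u < v)%N && ug_edge U u v) ug_weight U u v.

Definition satisfied_weight (L : 'I_n -> 'I_k) : R :=
  \sum_(u < n) \sum_(v < n | [&& (u < v)%N, ug_edge U u v & satisfies L u v])
    ug_weight U u v.

(* Multiplied out, so that an instance of total weight 0 is not excluded. *)
Definition satisfies_fraction (L : 'I_n -> 'I_k) (r : R) : Prop :=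
  r * total_weight <= satisfied_weight L.

Definition satisfiable (r : R) : Prop :=
  exists L : 'I_n -> 'I_k, satisfies_fraction L r.

Definition regular (d : R) : Prop :=
  forall u : 'I_n, \sum_(v < n | ug_edge U u v) ug_weight U u v = d.

(* The size of this matrix, [\sum_(u < n) k], is the form taken by n * k in
   the library's block matrices; [perm_mx s i j = (s i == j)%:R]. *)
Definition label_extended : 'M[R]_(\sum_(u < n) k) :=
  \mxblock_(u < n, v < n)
    (if ug_edge U u v then ug_weight U u v *: perm_mx (ug_perm U u v)
     else 0 : 'M[R]_k).

End UniqueGames.

(** * The span of the eigenvectors with a large eigenvalue *)

Section Span.
Variables (R : realType) (N : nat).
Implicit Types (M : 'M[R]_N) (W : {vspace 'rV[R]_N}).

Definition is_span (P : 'rV[R]_N -> Prop) W : Prop :=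
  forall W' : {vspace 'rV[R]_N},
    (W <= W')%VS <-> (forall v, P v -> v \in W').

(* [eigenspace] consists of row vectors v with v *m M = a *: v; for a symmetric
   M, such as [label_extended], they are the transposes of the usual ones. *)
Definition eigenvector_above M (theta : R) (v : 'rV[R]_N) : Prop :=
  v != 0 /\ exists2 a : R, theta < a & (v <= eigenspace M a)%MS.

Lemma is_span_exists (P : 'rV[R]_N -> Prop) : exists W, is_span P W.
Proof.
pose Q (d : nat) := `[< exists2 W : {vspace 'rV[R]_N}, \dim W = d
                & forall v, P v -> v \in W >].
have exQ : exists d, Q d.
  exists (\dim {: 'rV[R]_N}); apply/asboolP; exists fullv => // v _.
  by rewrite memvf.
have [d /asboolP[W dW PW] min_d] := ex_minnP exQ.
exists W => W'; split=> [sWW' v Pv | PW'].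
  exact: subvP sWW' v (PW v Pv).
have QI : Q (\dim (W :&: W')).
  by apply/asboolP; exists (W :&: W')%VS => // v Pv; rewrite memv_cap PW ?PW'.
have /eqP <- : (W :&: W' == W)%VS by rewrite eqEdim capvSl dW min_d.
exact: capvSr.
Qed.

Lemma is_span_unique (P : 'rV[R]_N -> Prop) W1 W2 :
  is_span P W1 -> is_span P W2 -> W1 = W2.
Proof.
move=> s1 s2; apply/eqP; rewrite eqEsubv; apply/andP; split.
  by apply/s1 => v; move: v; apply/s2.
by apply/s2 => v; move: v; apply/s1.
Qed.

End Span.

(** * Real RAM programs

   The time of an algorithm is the number of unit-cost operations of a
   while-program over arrays of natural numbers and arrays of reals.  Reals are
   only subject to field operations and comparisons, the only real constants
   are 0 and 1, and reals cannot be converted to integers (no rounding).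
   Integers (used for control and addressing) have addition and truncated
   subtraction but no multiplication, so that their bit length stays linear in
   the running time. *)

(* The [a]-th array is named by the constant [a] of the program text; scalars
   are arrays used at index 0. *)
Inductive iexp :=
| INum of nat
| IGet of nat & iexp
| IAdd of iexp & iexp
| ISub of iexp & iexp.

Inductive rexp :=
| RZero
| ROne
| RGet of nat & iexp
| RAdd of rexp & rexp
| RSub of rexp & rexp
| RMul of rexp & rexp
| RDiv of rexp & rexp.

Inductive bexp :=
| BILt of iexp & iexp
| BRLt of rexp & rexp
| BNot of bexp
| BAnd of bexp & bexp.

Inductive prog :=
| Skip
| ISet of nat & iexp & iexp
| RSet of nat & iexp & rexp
| Seq of prog & prog
| If of bexp & prog & prog
| While of bexp & prog.

(* One unit per node of an expression: array accesses, operations, constants. *)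
Fixpoint icost (e : iexp) : nat :=
  match e with
  | INum _ => 1
  | IGet _ i => (icost i).+1
  | IAdd e1 e2 | ISub e1 e2 => (icost e1 + icost e2).+1
  end.

Fixpoint rcost (e : rexp) : nat :=
  match e with
  | RZero | ROne => 1
  | RGet _ i => (icost i).+1
  | RAdd e1 e2 | RSub e1 e2 | RMul e1 e2 | RDiv e1 e2 =>
      (rcost e1 + rcost e2).+1
  end.

Fixpoint bcost (b : bexp) : nat :=
  match b with
  | BILt e1 e2 => (icost e1 + icost e2).+1
  | BRLt e1 e2 => (rcost e1 + rcost e2).+1
  | BNot b1 => (bcost b1).+1
  | BAnd b1 b2 => (bcost b1 + bcost b2).+1
  end.

Section Semantics.
Variable R : realType.

Record memory := Memory {
  ints : nat -> nat -> nat;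
  reals : nat -> nat -> R
}.

Implicit Types s : memory.

Definition update (T : Type) (m : nat -> nat -> T) (a i : nat) (x : T) :
    nat -> nat -> T :=
  fun b j => if (b == a) && (j == i) then x else m b j.

Definition set_int s a i x := Memory (update (ints s) a i x) (reals s).
Definition set_real s a i x := Memory (ints s) (update (reals s) a i x).

Fixpoint ieval s (e : iexp) : nat :=
  match e with
  | INum c => c
  | IGet a i => ints s a (ieval s i)
  | IAdd e1 e2 => (ieval s e1 + ieval s e2)%N
  | ISub e1 e2 => (ieval s e1 - ieval s e2)%N
  end.

(* Division by 0 returns 0, as in the library. *)
Fixpoint reval s (e : rexp) : R :=
  match e with
  | RZero => 0
  | ROne => 1
  | RGet a i => reals s a (ieval s i)
  | RAdd e1 e2 => reval s e1 + reval s e2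
  | RSub e1 e2 => reval s e1 - reval s e2
  | RMul e1 e2 => reval s e1 * reval s e2
  | RDiv e1 e2 => reval s e1 / reval s e2
  end.

Fixpoint beval s (b : bexp) : bool :=
  match b with
  | BILt e1 e2 => (ieval s e1 < ieval s e2)%N
  | BRLt e1 e2 => reval s e1 < reval s e2
  | BNot b1 => ~~ beval s b1
  | BAnd b1 b2 => beval s b1 && beval s b2
  end.

(* [exec p s s' t]: started in [s], [p] halts in [s'] after [t] time units. *)
Inductive exec : prog -> memory -> memory -> nat -> Prop :=
| ExecSkip s : exec Skip s s 1
| ExecISet s a i e :
    exec (ISet a i e) s (set_int s a (ieval s i) (ieval s e))
      (icost i + icost e).+1
| ExecRSet s a i e :
    exec (RSet a i e) s (set_real s a (ieval s i) (reval s e))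
      (icost i + rcost e).+1
| ExecSeq p1 p2 s s1 s2 t1 t2 :
    exec p1 s s1 t1 -> exec p2 s1 s2 t2 ->
    exec (Seq p1 p2) s s2 (t1 + t2)
| ExecIf b p1 p2 s s1 t :
    exec (if beval s b then p1 else p2) s s1 t ->
    exec (If b p1 p2) s s1 (bcost b + t).+1
| ExecWhileFalse b p s :
    beval s b = false ->
    exec (While b p) s s (bcost b).+1
| ExecWhileTrue b p s s1 s2 t1 t2 :
    beval s b ->
    exec p s s1 t1 -> exec (While b p) s1 s2 t2 ->
    exec (While b p) s s2 (bcost b + t1 + t2).+1.

Lemma exec_deterministic p s s1 s2 t1 t2 :
  exec p s s1 t1 -> exec p s s2 t2 -> s1 = s2 /\ t1 = t2.
Proof.
move=> e1; elim: e1 s2 t2 => {p s s1 t1}.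
- by move=> s s2 t2 e; inversion e.
- by move=> s a i e s2 t2 e'; inversion e'.
- by move=> s a i e s2 t2 e'; inversion e'.
- move=> p1 p2 s s1 s2 t1 t2 _ IH1 _ IH2 s3 t3 e.
  inversion e as [| | | ? ? ? s1' ? t1' t2' e1 e2 | | |]; subst.
  have [? ?] := IH1 _ _ e1; subst.
  by have [? ?] := IH2 _ _ e2; subst.
- move=> b p1 p2 s s1 t _ IH s2 t2 e.
  inversion e as [| | | | ? ? ? ? ? t' e' | |]; subst.
  by have [? ?] := IH _ _ e'; subst.
- move=> b p s bF s2 t2 e; inversion e as [| | | | | | ? ? ? ? ? ? ? bT]; subst.
    by [].
  by rewrite bF in bT.
- move=> b p s s1 s2 t1 t2 bT _ IH1 _ IH2 s3 t3 e.
  inversion e as [| | | | | ? ? ? bF | ? ? ? s1' ? t1' t2' _ e1 e2]; subst.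
    by rewrite bF in bT.
  have [? ?] := IH1 _ _ e1; subst.
  by have [? ?] := IH2 _ _ e2; subst.
Qed.

End Semantics.

(** * Input and output of an algorithm for Unique Games *)

Section InputOutput.
Variables (R : realType) (n k : nat).

(* Row-major layout: (u, v) is at index u * n + v of [vertex_pairs n]. *)
Definition vertex_pairs : seq ('I_n * 'I_n) :=
  [seq (u, v) | u <- enum 'I_n, v <- enum 'I_n].

(* Integer arrays: 0 holds n and k, 1 the adjacency matrix of the graph, and 2
   the value of the permutation of the edge (u, v) at i, at index
   (u * n + v) * k + i (0 for non-edges).  Real arrays: 0 holds epsilon and
   gamma, 1 the matrix of the weights (0 for non-edges).  All other cells are
   initially 0. *)
Definition input_ints (U : unique_game R n k) (a : nat) : seq nat :=
  match a with
  | 0 => [:: n; k]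
  | 1 => [seq nat_of_bool (ug_edge U e.1 e.2) | e <- vertex_pairs]
  | 2 => [seq (if ug_edge U e.1 e.2 then nat_of_ord (ug_perm U e.1 e.2 i)
               else 0%N) | e <- vertex_pairs, i <- enum 'I_k]
  | _ => [::]
  end.

Definition input_reals (U : unique_game R n k) (epsilon gamma : R) (a : nat) :
    seq R :=
  match a with
  | 0 => [:: epsilon; gamma]
  | 1 => [seq (if ug_edge U e.1 e.2 then ug_weight U e.1 e.2 else 0)
           | e <- vertex_pairs]
  | _ => [::]
  end.

Definition input_memory (U : unique_game R n k) (epsilon gamma : R) :
    memory R :=
  Memory (fun a i => nth 0%N (input_ints U a) i)
         (fun a i => nth 0 (input_reals U epsilon gamma a) i).

(* The assignment is returned in the integer array 3. *)
Definition outputs (s : memory R) (L : 'I_n -> 'I_k) : Prop :=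
  forall u : 'I_n, ints s 3 u = L u.

End InputOutput.

(* Main.v *)
(** The assignment [x] that satisfies almost all constraints has energy
   [x (I - M / d) x^T <= epsilon |x|^2], so its part [x'] with eigenvalues of
   [I - M / d] below [gamma / 4] is at distance [O (epsilon / gamma) n] from
   it.  Eigenvectors are not computable with field operations, and neither
   [1 / gamma] nor the ratios of the weights are bounded, so the algorithm works
   with the steep matrix [A = B ^ m], [B = (2 / gamma) (I - M / d)] and
   [m = 2 N + ceil (gamma / epsilon)]: [A] is smaller than [2 ^ - m] on [x'] and
   larger than [2 ^ m] on the orthogonal complement of [W].  Gram-Schmidt with
   pivoting on the rows of [A], stopped when all residual rows are shorter
   than 1, leaves an orthogonal projection [E].  The residual rows being short,
   [\tr E <= \dim W]; the pivoting keeps the coefficients below 1, so [x'] is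
   almost orthogonal to the removed vectors, that is, close to [x' E].  A second
   run on the rows of [E] gives an orthogonal basis of its range, normalized up
   to a factor 2 by doublings.  A vector close to a multiple of [x' E] is a sum
   of [O (gamma / epsilon * \dim W)] signed basis vectors taken in order, so
   there are [2 ^ O (gamma / epsilon * \dim W)] candidates to enumerate, and
   taking the largest coordinate in the block of each vertex turns a close
   candidate into the good assignment, except at [O (epsilon / gamma) n]
   vertices. *)

Require Import Defs.
From HB Require Import structures.
From mathcomp Require Import all_boot all_order all_algebra all_fingroup.
From mathcomp Require Import boolp reals exp.
From mathcomp Require Import complex spectral.
From mathcomp Require Import zify ring lra.

Import Order.TTheory GRing.Theory Num.Theory.
Local Open Scope ring_scope.

Set Implicit Arguments.
Unset Strict Implicit.
Unset Printing Implicit Defensive.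

(** * Weakest preconditions and running time *)

(* [D] bounds the number of iterations of each loop, so that the running time
   is at most [time_bound D p], a polynomial in [D], and need not be tracked in
   the correctness proofs. *)
Section WeakestPrecondition.
Variables (R : realType) (D : nat).
Implicit Types (s : memory R) (Q : memory R -> Prop).

(** Only the analysis uses eigenvectors. The eigenvalues of [I - M / d] between [gamma / 4] and
    [gamma] may fall on either side: the power of [B] only has to be small below the lower threshold
    and large above the upper one. The dimension bound is nevertheless exact, because the trace of
    the projection kept by the first run is the number of pivots of the second: a natural number
    that exceeds the number of low eigenvalues by less than 1 does not exceed it at all. The program
    knows neither [\dim W] nor the scale of the good candidate. The pivots of the second run stand
    in for the former. Taking the largest coordinate is invariant under positive scaling, so integer
    combinations of the basis suffice and the step, a square root, occurs only in the analysis. The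
    exponent of the running time must be a multiple of [gamma / epsilon * \dim W] without an
    additive term. Hence the separate argument that low eigenvalues exist: otherwise the good
    assignment would have too much energy. *)

Fixpoint wp (p : prog) (Q : memory R -> Prop) (s : memory R) : Prop :=
  match p with
  | Skip => Q s
  | ISet a i e => Q (set_int s a (ieval s i) (ieval s e))
  | RSet a i e => Q (set_real s a (ieval s i) (reval s e))
  | Seq p1 p2 => wp p1 (wp p2 Q) s
  | If b p1 p2 => if beval s b then wp p1 Q s else wp p2 Q s
  | While b p1 => exists2 j, (j <= D)%N &
      iter j (fun P s => beval s b /\ wp p1 P s)
             (fun s => ~~ beval s b /\ Q s) s
  end.

Fixpoint time_bound (p : prog) : nat :=
  match p with
  | Skip => 1
  | ISet a i e => (icost i + icost e).+1
  | RSet a i e => (icost i + rcost e).+1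
  | Seq p1 p2 => time_bound p1 + time_bound p2
  | If b p1 p2 => (bcost b + (time_bound p1 + time_bound p2)).+1
  | While b p1 => D * (bcost b + time_bound p1).+1 + (bcost b).+1
  end.

Fixpoint writes_int (p : prog) (a : nat) : bool :=
  match p with
  | Skip | RSet _ _ _ => false
  | ISet b _ _ => b == a
  | Seq p1 p2 | If _ p1 p2 => writes_int p1 a || writes_int p2 a
  | While _ p1 => writes_int p1 a
  end.

Fixpoint writes_real (p : prog) (a : nat) : bool :=
  match p with
  | Skip | ISet _ _ _ => false
  | RSet b _ _ => b == a
  | Seq p1 p2 | If _ p1 p2 => writes_real p1 a || writes_real p2 a
  | While _ p1 => writes_real p1 a
  end.

Definition frame (p : prog) s s' : Prop :=
  (forall a, ~~ writes_int p a -> ints s' a = ints s a) /\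
  (forall a, ~~ writes_real p a -> reals s' a = reals s a).

(** The loop clause of [wp] supplies an actual number of iterations, at most [D]; this gives
    termination and the time bound at once. *)
Lemma wp_sound p Q s : wp p Q s ->
  exists s' t, [/\ exec p s s' t, (t <= time_bound p)%N & Q s'].
Proof.
elim: p Q s => [|a i e|a i e|p1 IH1 p2 IH2|b p1 IH1 p2 IH2|b p IH] Q s /=.
- by move=> Qs; exists s, 1%N; split=> //; constructor.
- by eexists; eexists; split; [constructor | |].
- by eexists; eexists; split; [constructor | |].
- case/IH1=> s1 [t1 [e1 b1 /IH2 [s2 [t2 [e2 b2 Q2]]]]].
  exists s2, (t1 + t2)%N; split=> //; first exact: ExecSeq e1 e2.
  exact: leq_add.
- case: ifP => bs.
    case/IH1=> s1 [t1 [e1 b1 Q1]]; exists s1, (bcost b + t1).+1.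
    by split=> //; [constructor; rewrite bs | lia].
  case/IH2=> s1 [t1 [e1 b1 Q1]]; exists s1, (bcost b + t1).+1.
  by split=> //; [constructor; rewrite bs | lia].
- case=> j jD wj.
  suff [s' [t [e tj Qs']]] : exists s' t, [/\ exec (While b p) s s' t,
      (t <= j * (bcost b + time_bound p).+1 + (bcost b).+1)%N & Q s'].
    exists s', t; split=> //; apply: leq_trans tj _.
    by rewrite leq_add2r leq_mul2r jD orbT.
  elim: j s {jD} wj => [|j IHj] s /= [].
    by move=> /negbTE bs Qs; exists s, (bcost b).+1; split=> //; constructor.
  move=> bs /IH [s1 [t1 [e1 b1 /IHj [s2 [t2 [e2 b2 Q2]]]]]].
  exists s2, (bcost b + t1 + t2).+1; split=> //.
    exact: ExecWhileTrue bs e1 e2.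
  by rewrite mulSn; lia.
Qed.

Lemma wp_mono p Q Q' s : (forall s', Q s' -> Q' s') -> wp p Q s -> wp p Q' s.
Proof.
elim: p Q Q' s => [|a i e|a i e|p1 IH1 p2 IH2|b p1 IH1 p2 IH2|b p IH] Q Q' s QQ' /=.
- exact: QQ'.
- exact: QQ'.
- exact: QQ'.
- by apply: IH1 => s'; apply: IH2.
- by case: ifP => _; [apply: IH1 | apply: IH2].
- case=> j jD wj; exists j => //; elim: j s {jD} wj => [|j IHj] s /= [bs].
    by move=> /QQ'.
  by move=> w; split=> //; apply: IH w.
Qed.

Lemma frame_refl p s : frame p s s. Proof. by []. Qed.

Lemma frame_trans p s1 s2 s3 : frame p s1 s2 -> frame p s2 s3 -> frame p s1 s3.
Proof.
by move=> [i12 r12] [i23 r23]; split=> a na; rewrite ?i23 ?i12 ?r23 ?r12.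
Qed.

Lemma frame_sub p q s1 s2 :
  (forall a, writes_int p a -> writes_int q a) ->
  (forall a, writes_real p a -> writes_real q a) ->
  frame p s1 s2 -> frame q s1 s2.
Proof.
by move=> iq rq [i12 r12]; split=> a na; [apply: i12 | apply: r12];
  apply: contraNN na; [apply: iq | apply: rq].
Qed.

(** Invariants and specifications need to mention only the arrays that a program writes; for all
    others the side conditions [writes_int] and [writes_real] are decided by computation. *)
Lemma wp_frame p Q s : wp p Q s -> wp p (fun s' => frame p s s' /\ Q s') s.
Proof.
elim: p Q s => [|a i e|a i e|p1 IH1 p2 IH2|b p1 IH1 p2 IH2|b p IH] Q s /=.
- by move=> Qs; split.
- move=> Qs; split=> //; split=> //= c ca; apply: funext => j.
  by rewrite /update eq_sym (negbTE ca).
- move=> Qs; split=> //; split=> //= c ca; apply: funext => j.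
  by rewrite /update eq_sym (negbTE ca).
- move/IH1; apply: wp_mono => s1 [f1 /IH2].
  apply: wp_mono => s2 [f2 Q2]; split=> //; apply: (@frame_trans _ _ s1).
    by apply: frame_sub f1 => a /= ->.
  by apply: frame_sub f2 => a /= ->; rewrite orbT.
- case: ifP => _; [move/IH1|move/IH2]; apply: wp_mono => s1 [f1 Q1]; split=> //.
    by apply: frame_sub f1 => a /= ->.
  by apply: frame_sub f1 => a /= ->; rewrite orbT.
- case=> j jD wj; exists j => //.
  (* The starting state is generalized because the frame relates later states to the start of the
     loop, not to the current iteration. *)
  suff gen s0 : frame (While b p) s0 s ->
      iter j (fun P s1 => beval s1 b /\ wp p P s1)
     (fun s1 => ~~ beval s1 b /\ frame (While b p) s0 s1 /\ Q s1) s.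
    exact: gen (frame_refl _ _).
  elim: j s {jD} wj => [|j IHj] s /= [bs]; first by [].
  move=> /IH w f0; split=> //; apply: wp_mono w => s1 [f1 w1].
  by apply: IHj w1 _; apply: frame_trans f0 f1.
Qed.

Lemma wp_use (P : memory R -> Prop) p Q s :
  wp p P s -> (forall s', frame p s s' -> P s' -> Q s') -> wp p Q s.
Proof. by move/wp_frame => w PQ; apply: wp_mono w => s' [/PQ]. Qed.

End WeakestPrecondition.

(** A [While] raises the degree by one. For [Seq] and [If] the degrees are added instead of
    maximized, since any degree that depends on the text of the program alone will do. *)
Lemma time_bound_poly p : exists C e, forall D, (time_bound D p <= C * D.+1 ^ e)%N.
Proof.
elim: p => [|a i e|a i e|p1 [C1 [e1 IH1]] p2 [C2 [e2 IH2]]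
           |b p1 [C1 [e1 IH1]] p2 [C2 [e2 IH2]]|b p [C [e IH]]].
- by exists 1%N, 0%N => D; rewrite expn0.
- by exists (icost i + icost e).+1, 0%N => D; rewrite expn0 muln1.
- by exists (icost i + rcost e).+1, 0%N => D; rewrite expn0 muln1.
- exists (C1 + C2)%N, (e1 + e2)%N => D /=; rewrite mulnDl.
  apply: leq_add; [apply: leq_trans (IH1 D) _ | apply: leq_trans (IH2 D) _];
    by rewrite leq_mul2l leq_pexp2l ?orbT ?leq_addr ?leq_addl.
- exists (C1 + C2 + (bcost b).+1)%N, (e1 + e2)%N => D /=.
  rewrite 2!mulnDl -addSn addnC; apply: leq_add; last by rewrite leq_pmulr // expn_gt0.
  apply: leq_add; [apply: leq_trans (IH1 D) _ | apply: leq_trans (IH2 D) _];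
    by rewrite leq_mul2l leq_pexp2l ?orbT ?leq_addr ?leq_addl.
- exists (C + (bcost b).+1)%N, e.+1 => D /=.
  have De : (0 < D.+1 ^ e)%N by rewrite expn_gt0.
  have := IH D; rewrite expnS.
  set X := time_bound D p; set Y := (D.+1 ^ e)%N in De *; set c := bcost b => XC.
  have c1 : (c.+1 <= c.+1 * Y)%N by rewrite leq_pmulr.
  apply: (@leq_trans (D.+1 * (c.+1 * Y + C * Y))); last by apply: eq_leq; ring.
  rewrite mulSn addnC; apply: leq_add; first by apply: leq_trans c1 (leq_addr _ _).
  by rewrite leq_mul2l -addSn leq_add ?orbT.
Qed.

(** * Counting loops and their proof rules *)

Definition For (x a : nat) (body : prog) : prog :=
  Seq (ISet x (INum 0) (INum 0))
   (While (BILt (IGet x (INum 0)) (IGet a (INum 0)))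
      (Seq body (ISet x (INum 0) (IAdd (IGet x (INum 0)) (INum 1))))).

Lemma wp_For (R : realType) D x a body n (Inv : nat -> memory R -> Prop) Q s0 :
  (n <= D)%N -> ints s0 a 0 = n -> x != a ->
  ~~ writes_int body x -> ~~ writes_int body a ->
  Inv 0%N (set_int s0 x 0 0) ->
  (forall j s, (j < n)%N -> frame (For x a body) s0 s -> ints s x 0 = j ->
     Inv j s -> wp D body (fun s' => Inv j.+1 (set_int s' x 0 j.+1)) s) ->
  (forall s, frame (For x a body) s0 s -> Inv n s -> Q s) ->
  wp D (For x a body) Q s0.
Proof.
move=> nD an xa nx na I0 IS IQ.
have nFa : ~~ writes_int (For x a body) a.
  by rewrite /= (negbTE na) (negbTE xa).
have gen i j s : (i + j = n)%N -> frame (For x a body) s0 s ->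
    ints s x 0 = i -> Inv i s ->
    iter j (fun P s => (ints s x 0 < ints s a 0)%N /\
        wp D body (fun s' => P (set_int s' x 0 (ints s' x 0 + 1))) s)
       (fun s => ~~ (ints s x 0 < ints s a 0)%N /\ Q s) s.
  elim: j i s => [|j IH] i s ijn fs xi Ii /=; have sa := fs.1 a nFa.
    rewrite sa an xi -ijn addn0 ltnn; split=> //; apply: IQ => //.
    by rewrite -ijn addn0.
  have lin : (i < n)%N by lia.
  rewrite sa an xi; split=> //.
  apply: wp_use (IS _ _ lin fs xi Ii) _ => s' f' I'.
  have x' : ints s' x 0 = i by rewrite f'.1.
  rewrite x' addn1; apply: (IH i.+1) => //; [by rewrite addSnnS| |]. 
    apply: frame_trans fs _; split=> b /= nb.
      apply: funext => l; rewrite /update f'.1; last by move: nb; rewrite !negb_or => /and3P[].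
      case: eqP => // be; by move: nb; rewrite be eqxx.
    by rewrite f'.2 //; move: nb; rewrite orbF.
  by rewrite /= /update !eqxx.
exists n => //; apply: (gen 0%N n) => //.
  split=> //= b nb; apply: funext => l; rewrite /update.
  by case: eqP => // be; move: nb; rewrite be eqxx.
by rewrite /= /update !eqxx.
Qed.

Definition scalar a := IGet a (INum 0).
Definition rscalar a := RGet a (INum 0).

Definition fill (x lim : nat) (pre : prog) (a : nat) (off : iexp) (e : rexp) :=
  For x lim (Seq pre (RSet a (IAdd off (scalar x)) e)).

Definition sum (x lim acc : nat) (e : rexp) :=
  For x lim (RSet acc (INum 0) (RAdd (rscalar acc) e)).

Section Loops.
Variables (R : realType) (D : nat).
Implicit Types (s : memory R) (Q : memory R -> Prop).

(** The body may assume that the cells not yet reached are unchanged, so [e] can read the array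
    being overwritten, as the doubling in [rescale] does. *)
Lemma wp_fill x lim pre a off e n o (F : nat -> R) Q s0 :
  (n <= D)%N -> ints s0 lim 0 = n -> x != lim ->
  ~~ writes_int pre x -> ~~ writes_int pre lim -> ~~ writes_real pre a ->
  (forall j s, (j < n)%N -> frame (fill x lim pre a off e) s0 s ->
     ints s x 0 = j ->
     (forall i, (i < o)%N || (o + j <= i)%N -> reals s a i = reals s0 a i) ->
     wp D pre (fun s' => ieval s' off = o /\ reval s' e = F j) s) ->
  (forall s, frame (fill x lim pre a off e) s0 s ->
     (forall j, (j < n)%N -> reals s a (o + j) = F j) ->
     (forall i, (i < o)%N || (o + n <= i)%N -> reals s a i = reals s0 a i) ->
     Q s) ->
  wp D (fill x lim pre a off e) Q s0.
Proof.
move=> nD ln xl px pl pa body post.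
apply: (@wp_For _ _ _ _ _ n (fun j s =>
  (forall j', (j' < j)%N -> reals s a (o + j') = F j') /\
  (forall i, (i < o)%N || (o + j <= i)%N -> reals s a i = reals s0 a i))) => //.
- by rewrite /= orbF.
- by rewrite /= orbF.
- move=> j s jn fs xj [done todo] /=.
  apply: wp_use (body j s jn fs xj todo) _ => s' f' [-> ->] /=.
  rewrite f'.1 // xj; split=> [j' jj|i hi]; rewrite /update eqxx /=.
    rewrite eqn_add2l; case: eqP => [->//|/eqP ne].
    by rewrite f'.2 // done //; lia.
  have -> : (i == o + j)%N = false by lia.
  by rewrite f'.2 // todo //; lia.
- by move=> s fs [done todo]; apply: post.
Qed.

Lemma wp_sum x lim acc e n (F : nat -> R) Q s0 :
  (n <= D)%N -> ints s0 lim 0 = n -> x != lim ->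
  (forall j s, (j < n)%N -> frame (sum x lim acc e) s0 s ->
     ints s x 0 = j -> reval s e = F j) ->
  (forall s, frame (sum x lim acc e) s0 s ->
     reals s acc 0 = reals s0 acc 0 + \sum_(j < n) F j -> Q s) ->
  wp D (sum x lim acc e) Q s0.
Proof.
move=> nD ln xl body post.
apply: (@wp_For _ _ _ _ _ n (fun j s =>
   reals s acc 0 = reals s0 acc 0 + \sum_(j' < j) F j')) => //.
- by rewrite /= big_ord0 addr0.
- move=> j s jn fs xj acj /=.
  by rewrite /update !eqxx /= (body j) // acj big_ord_recr /= addrA.
Qed.

End Loops.

Section WpEquations.
Variables (R : realType) (D : nat) (Q : memory R -> Prop) (s : memory R).

Lemma wpSkip : wp D Skip Q s = Q s. Proof. by []. Qed.

Lemma wpI a i e : wp D (ISet a i e) Q s = Q (set_int s a (ieval s i) (ieval s e)).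
Proof. by []. Qed.

Lemma wpR a i e : wp D (RSet a i e) Q s = Q (set_real s a (ieval s i) (reval s e)).
Proof. by []. Qed.

Lemma wpSeq p1 p2 : wp D (Seq p1 p2) Q s = wp D p1 (wp D p2 Q) s.
Proof. by []. Qed.

Lemma wpIf b p1 p2 :
  wp D (If b p1 p2) Q s = if beval s b then wp D p1 Q s else wp D p2 Q s.
Proof. by []. Qed.

End WpEquations.

Lemma wp_framed (R : realType) D p Q (s : memory R) :
  wp D p (fun s' => frame p s s' -> Q s') s -> wp D p Q s.
Proof. by move/wp_frame; apply: wp_mono => s' [f] /(_ f). Qed.

Lemma frame_set_int (R : realType) p (s : memory R) a i x :
  writes_int p a -> frame p s (set_int s a i x).
Proof.
move=> pa; split=> // b nb; apply: funext => j; rewrite /= /update.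
by case: eqP nb => // ->; rewrite pa.
Qed.

Lemma frame_set_real (R : realType) p (s : memory R) a i x :
  writes_real p a -> frame p s (set_real s a i x).
Proof.
move=> pa; split=> // b nb; apply: funext => j; rewrite /= /update.
by case: eqP nb => // ->; rewrite pa.
Qed.

Lemma frame_set_intr (R : realType) p (s s' : memory R) a i x :
  writes_int p a -> frame p s s' -> frame p s (set_int s' a i x).
Proof. by move=> pa f; apply: frame_trans f _; apply: frame_set_int. Qed.

(** * Orthogonal projections and pivots *)

Section InnerProduct.
Variables (R : realType) (N : nat).
Implicit Types (u v w : 'rV[R]_N) (E G : 'M[R]_N).

Definition dot u v : R := \sum_i u 0 i * v 0 i.
Definition norm2 u := dot u u.

Lemma dotE u v : dot u v = (u *m v^T) 0 0.
Proof. by rewrite mxE; apply: eq_bigr => i _; rewrite mxE. Qed.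

Lemma dotC u v : dot u v = dot v u.
Proof. by apply: eq_bigr => i _; rewrite mulrC. Qed.

Lemma dotDl u v w : dot (u + v) w = dot u w + dot v w.
Proof. by rewrite !dotE mulmxDl mxE. Qed.

Lemma dotZl a u v : dot (a *: u) v = a * dot u v.
Proof. by rewrite !dotE -scalemxAl mxE. Qed.

Lemma dotNl u v : dot (- u) v = - dot u v.
Proof. by rewrite -scaleN1r dotZl mulN1r. Qed.

Lemma dotBl u v w : dot (u - v) w = dot u w - dot v w.
Proof. by rewrite dotDl dotNl. Qed.

Lemma dotDr u v w : dot w (u + v) = dot w u + dot w v.
Proof. by rewrite !(dotC w) dotDl. Qed.

Lemma dotZr a u v : dot v (a *: u) = a * dot v u.
Proof. by rewrite !(dotC v) dotZl. Qed.

Lemma dotBr u v w : dot w (u - v) = dot w u - dot w v.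
Proof. by rewrite !(dotC w) dotBl. Qed.

Lemma dot0l u : dot 0 u = 0.
Proof. by rewrite dotE mul0mx mxE. Qed.

Lemma dot_suml (I : Type) (r : seq I) (P : pred I) (f : I -> 'rV[R]_N) u :
  dot (\sum_(i <- r | P i) f i) u = \sum_(i <- r | P i) dot (f i) u.
Proof.
apply: (big_morph (fun v => dot v u)) => [v w|]; [exact: dotDl|exact: dot0l].
Qed.

Lemma dot_sumr (I : Type) (r : seq I) (P : pred I) (f : I -> 'rV[R]_N) u :
  dot u (\sum_(i <- r | P i) f i) = \sum_(i <- r | P i) dot u (f i).
Proof. by rewrite dotC dot_suml; apply: eq_bigr => i _; rewrite dotC. Qed.

Lemma dot_mulmx u v E : dot (u *m E) v = dot u (v *m E^T).
Proof. by rewrite !dotE trmx_mul trmxK mulmxA. Qed.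

Lemma norm2_ge0 u : 0 <= norm2 u.
Proof. by apply: sumr_ge0 => i _; rewrite -expr2 sqr_ge0. Qed.

Lemma norm2_eq0 u : (norm2 u == 0) = (u == 0).
Proof.
apply/idP/eqP => [|->]; last by rewrite /norm2 dot0l.
rewrite psumr_eq0 => [/allP u0|i _]; last by rewrite -expr2 sqr_ge0.
apply/rowP => i; rewrite mxE.
by have /implyP/(_ isT) := u0 i (mem_index_enum i); rewrite mulf_eq0 orbb => /eqP.
Qed.

Lemma norm2_gt0 u : (0 < norm2 u) = (u != 0).
Proof. by rewrite lt_def norm2_ge0 andbT norm2_eq0. Qed.

Lemma norm2Z a u : norm2 (a *: u) = a ^+ 2 * norm2 u.
Proof. by rewrite /norm2 dotZl dotZr mulrA expr2. Qed.

Lemma cauchy_schwarz u v : dot u v ^+ 2 <= norm2 u * norm2 v.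
Proof.
have [->|v0] := eqVneq v 0.
  by rewrite dotC dot0l expr0n mulr_ge0 ?norm2_ge0.
have vp : 0 < norm2 v by rewrite norm2_gt0.
have := norm2_ge0 (norm2 v *: u - dot u v *: v).
have -> : norm2 (norm2 v *: u - dot u v *: v) =
    norm2 v * (norm2 u * norm2 v - dot u v ^+ 2).
  rewrite /norm2 dotBl !dotBr !dotZl !dotZr (dotC v u); ring.
by rewrite pmulr_rge0 // subr_ge0.
Qed.

Lemma row_mulE E u i : dot u (row i E) = (u *m E^T) 0 i.
Proof. by rewrite !mxE; apply: eq_bigr => j _; rewrite !mxE. Qed.

(* [E |-> E - b^T b / |b|^2] removes the line of [b] from the range of the
   orthogonal projection [E]. *)
Definition deflate E u := E - (norm2 u)^-1 *: (u^T *m u).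

Lemma deflateE E u i j : deflate E u i j = E i j - u 0 i * u 0 j / norm2 u.
Proof. by rewrite !mxE big_ord1 !mxE mulrC. Qed.

Definition projection E := E^T = E /\ E *m E = E.

(* One run of Gram-Schmidt on the rows of [G *m E0]: the longest residual row,
   if its squared norm exceeds [th], is doubled at most [N] times until its
   norm reaches 1, and removed from the projection. *)
Inductive pivots (G : 'M[R]_N) (th : R) (E0 : 'M[R]_N) :
    seq 'rV[R]_N -> 'M[R]_N -> Prop :=
| Pivots0 : pivots G th E0 [::] E0
| PivotsS bs E p q b :
    pivots G th E0 bs E ->
    th < norm2 (row p (G *m E)) ->
    (forall r, norm2 (row r (G *m E)) <= norm2 (row p (G *m E))) ->
    b = 2 ^+ q *: row p (G *m E) ->
    q = 0%N \/ norm2 b < 4 ->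
    1 <= norm2 b \/ q = N ->
    pivots G th E0 (rcons bs b) (deflate E b).

End InnerProduct.

(** * Matrix programs *)

Definition mx_of (R : realType) (N : nat) (f : nat -> R) : 'M[R]_N :=
  \matrix_(i, j) f (i * N + j)%N.

Definition row_of (R : realType) (N : nat) (f : nat -> R) (o : nat) : 'rV[R]_N :=
  \row_j f (o + j)%N.

(* Memory map.
   Integers: 4, 5, 6 hold n, k and N = n * k; 7, 8, 9 are the tables of the
   multiples of k, n and N; 10, 11 map an index below N to its vertex and
   label; 12 is scratch; 13 to 20 are loop counters; 21 is
   ceil (gamma / epsilon), 22 the exponent, 23 the number of pivots, 24 the
   pivot row (N if there is none), 25 the number of enumeration rounds, 26, 27
   the number of candidates and its value at the start of the round, 28, 29 the
   offset and pointer of each candidate, 30 the next free offset, 31 the rounded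
   labels, 32 the current best label.
   Reals: 4 is d, 5 the ratio counter, 6 an accumulator; 7, 8, 9 are N x N
   matrices with 9 := 7 * 8, where 8 holds the projection; 10 is the pivot
   threshold, 11 the squared norm of the pivot, 12 the basis, 13 the candidates,
   14 the best weight (counted twice). *)
Definition rowidx := IAdd (IGet 9 (scalar 16)) (scalar 17).

Definition fill_mx (pre : prog) (a : nat) (e : rexp) :=
  For 16 6 (fill 17 6 pre a (IGet 9 (scalar 16)) e).

Definition matmul :=
  fill_mx (Seq (RSet 6 (INum 0) RZero)
    (sum 18 6 6 (RMul (RGet 7 (IAdd (IGet 9 (scalar 16)) (scalar 18)))
                      (RGet 8 (IAdd (IGet 9 (scalar 18)) (scalar 17))))))
    9 (rscalar 6).

(** The running maximum starts at the threshold, so a single comparison both finds the longest row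
    and tests it. *)
Definition find_pivot :=
  Seq (RSet 11 (INum 0) (rscalar 10))
  (Seq (ISet 24 (INum 0) (scalar 6))
  (For 16 6
    (Seq (RSet 6 (INum 0) RZero)
    (Seq (sum 17 6 6 (RMul (RGet 9 rowidx) (RGet 9 rowidx)))
    (If (BRLt (rscalar 11) (rscalar 6))
        (Seq (RSet 11 (INum 0) (rscalar 6)) (ISet 24 (INum 0) (scalar 16)))
        Skip))))).

Definition bvidx := IAdd (IGet 9 (scalar 23)) (scalar 17).
Definition two := RAdd ROne ROne.

(** Doublings replace the division by the norm, which would need a square root. The stored squared
    norm is multiplied by 4 along with them. *)
Definition rescale :=
  For 20 6
    (If (BRLt (rscalar 11) ROne)
      (Seq (RSet 11 (INum 0) (RMul (RMul two two) (rscalar 11)))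
           (fill 17 6 Skip 12 (IGet 9 (scalar 23)) (RMul two (RGet 12 bvidx))))
      Skip).

Definition pivot_step :=
  Seq matmul
  (Seq find_pivot
  (If (BILt (scalar 24) (scalar 6))
    (Seq (fill 17 6 Skip 12 (IGet 9 (scalar 23))
            (RGet 9 (IAdd (IGet 9 (scalar 24)) (scalar 17))))
    (Seq rescale
    (Seq (fill_mx Skip 8
            (RSub (RGet 8 rowidx)
                  (RDiv (RMul (RGet 12 (IAdd (IGet 9 (scalar 23)) (scalar 16)))
                              (RGet 12 bvidx)) (rscalar 11))))
         (ISet 23 (INum 0) (IAdd (scalar 23) (INum 1))))))
    Skip)).

Definition phase := Seq (ISet 23 (INum 0) (INum 0)) (For 19 6 pivot_step).

Section LinearAlgebraPrograms.
Variables (R : realType) (D N : nat).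
Hypothesis ND : (N <= D)%N.
Implicit Types (s : memory R) (Q : memory R -> Prop).

Definition tables s :=
  ints s 6 0 = N /\ forall i, (i < N)%N -> ints s 9 i = (i * N)%N.

Lemma tables_frame p s s' :
  ~~ writes_int p 6 -> ~~ writes_int p 9 -> frame p s s' -> tables s ->
  tables s'.
Proof. by move=> p6 p9 f [t6 t9]; split=> [|i iN]; rewrite f.1 ?t6 ?t9. Qed.

(** The entry about to be written still has its old value; the in-place deflation of the projection
    relies on this. *)
Lemma wp_fill_mx pre a e (F : 'M[R]_N) Q s0 :
  tables s0 ->
  ~~ writes_int pre 16 -> ~~ writes_int pre 17 -> ~~ writes_int pre 6 ->
  ~~ writes_int pre 9 -> ~~ writes_real pre a ->
  (forall (i j : 'I_N) s, frame (fill_mx pre a e) s0 s -> tables s ->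
     ints s 16 0 = i -> ints s 17 0 = j ->
     reals s a (i * N + j) = reals s0 a (i * N + j) ->
     wp D pre (fun s' => reval s' e = F i j) s) ->
  (forall s, frame (fill_mx pre a e) s0 s -> mx_of N (reals s a) = F -> Q s) ->
  wp D (fill_mx pre a e) Q s0.
Proof.
move=> tb p16 p17 p6 p9 pa body post.
have w9 : ~~ writes_int (fill_mx pre a e) 9 by rewrite /= !orbF.
have w6 : ~~ writes_int (fill_mx pre a e) 6 by rewrite /= !orbF.
apply: (@wp_For _ _ _ _ _ N (fun r s =>
  (forall i j : 'I_N, (i < r)%N -> reals s a (i * N + j) = F i j) /\
  (forall l, (r * N <= l)%N -> reals s a l = reals s0 a l))) => //.
- exact: tb.1.
- by rewrite /= !orbF.
- by rewrite /= !orbF.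
- move=> r s rN fs sr [done todo].
  have ts := tables_frame w6 w9 fs tb.
  apply: (@wp_fill _ _ _ _ _ _ _ _ N (r * N)
     (fun j => if insub j is Some j' then F (Ordinal rN) j' else 0)) => //.
  + exact: ts.1.
  + move=> j s1 jN f1 s1j keep.
    have ts1 : tables s1 by apply: tables_frame f1 ts; rewrite /= !orbF.
    have f01 : frame (fill_mx pre a e) s0 s1.
      apply: frame_trans fs _; by apply: frame_sub f1 => b /= ->; rewrite ?orbT.
    have s1r : ints s1 16 0 = r by rewrite f1.1 //= !orbF.
    have := body (Ordinal rN) (Ordinal jN) s1 f01 ts1 s1r s1j.
    rewrite /= keep ?leqnn ?orbT // todo ?leq_addr // => /(_ erefl).
    move/wp_use; apply=> s' f'; rewrite insubT /= => ->; split=> //.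
    have -> : ints s' 16 0 = r by rewrite f'.1.
    by rewrite f'.1 //; apply: ts1.2.
  + move=> s1 f1 new old; rewrite /=; split=> [i j|l lr].
      rewrite ltnS leq_eqVlt => /orP[/eqP ir|ir].
        by rewrite ir new // valK; congr (F _ _); apply: val_inj.
      rewrite old ?done //; apply/orP; left.
      by apply: leq_trans (_ : i.+1 * N <= _)%N; rewrite ?leq_mul2r ?ir ?orbT //
        mulSn addnC ltn_add2r.
    have le : (r * N + N <= l)%N by rewrite addnC -mulSn.
    by rewrite old ?le ?orbT // todo // (leq_trans _ le) ?leq_addr.
- move=> s fs [done _]; apply: post => //; apply/matrixP => i j.
  by rewrite mxE done.
Qed.

Lemma wp_matmul Q s0 : tables s0 ->
  (forall s, frame matmul s0 s ->
     mx_of N (reals s 9) = mx_of N (reals s0 7) *m mx_of N (reals s0 8) ->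
     Q s) ->
  wp D matmul Q s0.
Proof.
move=> tb post; apply: wp_fill_mx post => // i j s fs ts si sj _.
rewrite wpSeq wpR; apply: (@wp_sum _ _ _ _ _ _ N (fun l => if insub l is Some l' then
   mx_of N (reals s0 7) i l' * mx_of N (reals s0 8) l' j else 0)) => //.
- exact: ts.1.
- move=> l s1 lN f1 s1l; rewrite insubT /= !mxE s1l.
  rewrite !f1.1 //= si sj !ts.2 //.
  by rewrite !f1.2 //= /update /= !fs.2.
- move=> s1 f1 h; rewrite /= h /= /update /= add0r mxE.
  by apply: eq_bigr => l _; rewrite valK.
Qed.


Lemma row_norm2 (f : nat -> R) (r : 'I_N) :
  norm2 (row r (mx_of N f)) = \sum_(j < N) f (r * N + j)%N * f (r * N + j)%N.
Proof. by apply: eq_bigr => j _; rewrite !mxE. Qed.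

Lemma wp_find_pivot Q s0 (v : 'I_N -> R) : tables s0 ->
  (forall r, v r = norm2 (row r (mx_of N (reals s0 9)))) ->
  (forall s, frame find_pivot s0 s ->
     (ints s 24 0 = N /\ forall r, v r <= reals s0 10 0) \/
     (exists p : 'I_N, [/\ ints s 24 0 = p, reals s 11 0 = v p,
        reals s0 10 0 < v p & forall r, v r <= v p]) -> Q s) ->
  wp D find_pivot Q s0.
Proof.
move=> tb vE post; apply: wp_framed; rewrite wpSeq wpR wpSeq wpI.
set s0' := set_int _ _ _ _.
have f0 : frame find_pivot s0 s0'.
  have f1 : frame find_pivot s0 (set_real s0 11 0 (reals s0 10 0)).
    exact: frame_set_real.
  apply: frame_trans f1 _; exact: frame_set_int.
set th := reals s0 10 0 in post *.
apply: (@wp_For _ _ _ _ _ N (fun j s =>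
  [/\ ints s 24 0 = N, reals s 11 0 = th & forall r : 'I_N, (r < j)%N -> v r <= th] \/
  (exists p : 'I_N, [/\ ints s 24 0 = p, reals s 11 0 = v p,
        th < v p & forall r : 'I_N, (r < j)%N -> v r <= v p]))) => //.
- exact: tb.1.
- by left; split=> //=; rewrite /update /=; apply: tb.1.
- move=> j s jN fs sj inv.
  have ts : tables s.
    by apply: tables_frame fs _ => //; apply: tables_frame f0 _.
  have s9 : reals s 9 = reals s0 9 by rewrite fs.2.
  rewrite wpSeq wpR wpSeq.
  apply: (@wp_sum _ _ _ _ _ _ N (fun c => reals s0 9 (j * N + c) ^+ 2)) => //.
  + exact: ts.1.
  + move=> c s1 cN f1 s1c; rewrite /= s1c !f1.1 //= sj ts.2 //.
    by rewrite !f1.2 //= /update /= s9 expr2.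
  + move=> s1 f1 h.
    have {h} s1x : reals s1 6 0 = v (Ordinal jN).
      rewrite h /= /update /= add0r vE row_norm2.
      by apply: eq_bigr => c _; rewrite expr2.
    have s1b : reals s1 11 0 = reals s 11 0 by rewrite f1.2.
    have s1i : ints s1 24 0 = ints s 24 0 by rewrite f1.1.
    have s1j : ints s1 16 0 = j by rewrite f1.1.
    have ltS (r : 'I_N) : (r < j.+1)%N -> r = Ordinal jN \/ (r < j)%N.
      rewrite ltnS leq_eqVlt => /orP[/eqP e|]; last by right.
      by left; apply: val_inj.
    rewrite wpIf wpSeq wpR wpI wpSkip /= s1x s1b.
    case: ltP => cmp.
      right; exists (Ordinal jN); rewrite /= /update /= s1j; split=> //.
        by case: inv cmp => [[_ -> _]//|[p [_ -> thp _]]]; apply: lt_trans.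
      move=> r /ltS[->//|rj].
      case: inv cmp => [[_ -> le]|[p [_ -> thp le]]] /ltW; apply: le_trans;
        exact: le.
    rewrite /= /update /= s1i.
    case: inv cmp => [[-> -> le]|[p [-> -> thp le]]] cmp; [left|right].
      by split=> // r /ltS[->//|]; apply: le.
    by exists p; split=> // r /ltS[->//|]; apply: le.
- move=> s fs inv f; apply: post => //.
  case: inv => [[-> _ le]|[p [e1 e2 e3 le]]]; [left|right].
    by split=> // r; apply: le.
  by exists p; split=> // r; apply: le.
Qed.

(* [q] counts the doublings; they stop as soon as the norm reaches 1. *)
Lemma wp_rescale Q s0 (u : 'rV[R]_N) cnt : tables s0 -> (cnt < N)%N ->
  ints s0 23 0 = cnt -> row_of N (reals s0 12) (cnt * N) = u ->
  reals s0 11 0 = norm2 u ->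
  (forall s q, frame rescale s0 s ->
     row_of N (reals s 12) (cnt * N) = 2 ^+ q *: u ->
     reals s 11 0 = norm2 (2 ^+ q *: u) ->
     q = 0%N \/ norm2 (2 ^+ q *: u) < 4 ->
     1 <= norm2 (2 ^+ q *: u) \/ q = N ->
     (forall i, (i < cnt * N)%N -> reals s 12 i = reals s0 12 i) -> Q s) ->
  wp D rescale Q s0.
Proof.
move=> tb cN s0c s0u s0n post.
apply: (@wp_For _ _ _ _ _ N (fun j s => exists q,
  [/\ row_of N (reals s 12) (cnt * N) = 2 ^+ q *: u,
     reals s 11 0 = norm2 (2 ^+ q *: u),
     q = 0%N \/ norm2 (2 ^+ q *: u) < 4,
     1 <= norm2 (2 ^+ q *: u) \/ q = j &
     forall i, (i < cnt * N)%N -> reals s 12 i = reals s0 12 i])) => //.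
- exact: tb.1.
- by exists 0%N; rewrite expr0 scale1r; split=> //; [left|right].
- move=> j s jN fs sj [q [e1 e2 e3 e4 e5]].
  have ts : tables s by apply: tables_frame fs _.
  rewrite wpIf wpSeq wpR wpSkip [beval _ _]/= e2; case: ltP => cmp; last first.
    by exists q; split=> //; left.
  have sc : ints s 23 0 = cnt by rewrite fs.1.
  set s' := set_real _ _ _ _.
  apply: (@wp_fill _ _ _ _ _ _ _ _ N (cnt * N)
    (fun c => 2 * reals s 12 (cnt * N + c))) => //.
  + exact: ts.1.
  + move=> c s1 cN' f1 s1c keep; rewrite /= /update /=.
    rewrite s1c !f1.1 //= sc ts.2 // keep ?leqnn ?orbT //=.
  + move=> s1 f1 new old; exists q.+1; rewrite /=.
    have -> : 2 ^+ q.+1 *: u = 2 *: (2 ^+ q *: u) by rewrite scalerA exprS.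
    split.
    * by rewrite -e1; apply/rowP => c; rewrite !mxE new.
    * by rewrite f1.2 //= /update /= e2 (norm2Z 2); ring.
    * by right; rewrite (norm2Z 2); nra.
    * by right; case: e4 => [|->//]; rewrite leNgt cmp.
    * by move=> i ic; rewrite old ?ic //= /update /= e5.
- by move=> s fs [q [e1 e2 e3 e4 e5]]; apply: (post s q).
Qed.

(** The loop has the fixed length [N]. After [t] rounds either every round has found a pivot, or the
    residual rows are already short and all further rounds find none. *)
Definition pivots_stored G th E0 t s := exists bs E,
  [/\ pivots G th E0 bs E, mx_of N (reals s 8) = E & ints s 23 0 = size bs] /\
  [/\ (forall i, (i < size bs)%N -> row_of N (reals s 12) (i * N) = bs`_i),
     (size bs <= t)%N &
     size bs = t \/ forall r, norm2 (row r (G *m E)) <= th].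

Lemma wp_pivot_step Q s0 G th E0 t : (t < N)%N -> tables s0 ->
  mx_of N (reals s0 7) = G -> reals s0 10 0 = th ->
  pivots_stored G th E0 t s0 ->
  (forall s, pivots_stored G th E0 t.+1 s -> Q s) ->
  wp D pivot_step Q s0.
Proof.
move=> tN tb s0G s0th [bs [E [[pv s0E s0c] [s0b sz st]]]] post.
rewrite wpSeq; apply: wp_matmul => // s1 f1; rewrite s0G s0E => s1Y.
rewrite wpSeq; apply: (wp_find_pivot (v := fun r => norm2 (row r (G *m E)))).
- exact: tables_frame f1 tb.
- by move=> r; rewrite s1Y.
move=> s2 f2; rewrite f1.2 // s0th wpIf wpSkip [beval _ _]/=.
have t2 : tables s2 by apply: tables_frame f2 _ => //; apply: tables_frame f1 tb.
rewrite t2.1; case=> [[-> le]|[p [s2p s2b thp pmax]]].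
  rewrite ltnn; apply: post; exists bs, E.
  rewrite f2.2 // f1.2 // f2.1 // f1.1 // f2.2 // f1.2 //; split=> //.
  by split=> //; [apply: leqW | right].
have {sz}szt : size bs = t by case: st => // le; move: thp; rewrite ltNge le.
have s2c : ints s2 23 0 = t by rewrite f2.1 // f1.1 // s0c.
rewrite s2p ltn_ord wpSeq.
apply: (@wp_fill _ _ _ _ _ _ _ _ N (t * N) (fun j => reals s2 9 (p * N + j))) => //.
- exact: t2.1.
- move=> j s jN f sj _; rewrite /= sj (f.1 9 isT) (f.1 23 isT) (f.1 24 isT) s2c s2p !t2.2 //; split=> //.
  by rewrite f.2.
move=> s3 f3 new3 old3.
have t3 : tables s3 by apply: tables_frame f3 t2.
have s3c : ints s3 23 0 = t by rewrite f3.1.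
have s3r : row_of N (reals s3 12) (t * N) = row p (G *m E).
  by apply/rowP => j; rewrite mxE new3 // -s1Y -f2.2 // !mxE.
rewrite wpSeq; apply: (wp_rescale t3 tN s3c s3r) => [|s4 q f4].
  by rewrite f3.2.
set b := 2 ^+ q *: _ => s4r s4n bq bN old4.
have t4 : tables s4 by apply: tables_frame f4 t3.
have s4c : ints s4 23 0 = t by rewrite f4.1.
rewrite wpSeq; apply: (wp_fill_mx (F := deflate E b) t4) => //.
  move=> i j s f ts si sj si8; rewrite wpSkip /= si sj (f.1 23 isT) s4c.
  rewrite !ts.2 // si8 deflateE.
  have rE (l : 'I_N) : reals s 12 (t * N + l) = b 0 l.
    by rewrite f.2 // -s4r mxE.
  rewrite !rE (f.2 11 isT) s4n f4.2 // f3.2 // f2.2 // f1.2 //.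
  by congr (_ - _); rewrite -s0E mxE.
move=> s5 f5 s5E; rewrite wpI; apply: post.
exists (rcons bs b), (deflate E b); split.
  split=> //.
    exact: PivotsS pv thp pmax _ bq bN.
  by rewrite /= /update /= f5.1 // s4c size_rcons szt addn1.
rewrite size_rcons szt; split=> //; last by left.
move=> i; rewrite ltnS leq_eqVlt => /orP[/eqP->|it].
  by rewrite nth_rcons szt ltnn eqxx f5.2.
rewrite nth_rcons szt it -s0b ?szt //; apply/rowP => j; rewrite !mxE.
have lt : (i * N + j < t * N)%N.
  by apply: (@leq_trans (i.+1 * N)); rewrite ?leq_mul2r ?it ?orbT // mulSn addnC ltn_add2r.
by rewrite f5.2 // old4 // old3 ?lt // f2.2 // f1.2.
Qed.

Lemma wp_phase Q s0 G th E0 : tables s0 ->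
  mx_of N (reals s0 7) = G -> mx_of N (reals s0 8) = E0 -> reals s0 10 0 = th ->
  (forall s, frame phase s0 s -> pivots_stored G th E0 N s -> Q s) ->
  wp D phase Q s0.
Proof.
move=> tb s0G s0E s0th post; apply: wp_framed; rewrite wpSeq wpI.
set s0' := set_int _ _ _ _.
apply: (@wp_For _ _ _ _ _ N (pivots_stored G th E0)) => //.
- exact: tb.1.
- exists [::], E0; split; first by split=> //; constructor.
  by split=> //; left.
- move=> t s tN fs st ps; apply: wp_pivot_step ps _ => //.
  + by apply: tables_frame fs _.
  + by rewrite fs.2.
  + by rewrite fs.2.
- by move=> s _ ps f; apply: post.
Qed.

End LinearAlgebraPrograms.

(** * Set-up *)

(** Integers cannot be multiplied, so the products used as addresses are read from tables built by
    repeated addition. The final value of the accumulator is itself a product; [N] is obtained in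
    this way. *)
Definition mk_table (x lim tab acc step : nat) :=
  Seq (ISet acc (INum 0) (INum 0))
  (For x lim (Seq (ISet tab (scalar x) (scalar acc))
                  (ISet acc (INum 0) (IAdd (scalar acc) (scalar step))))).

Definition mk_labels :=
  For 13 4 (For 15 5
    (Seq (ISet 10 (IAdd (IGet 7 (scalar 13)) (scalar 15)) (scalar 13))
         (ISet 11 (IAdd (IGet 7 (scalar 13)) (scalar 15)) (scalar 15)))).

Definition mk_degree :=
  Seq (RSet 4 (INum 0) RZero) (sum 14 4 4 (RGet 1 (scalar 14))).

Definition epsilon_cell := RGet 0 (INum 0).
Definition gamma_cell := RGet 0 (INum 1).

(** Reals cannot be converted to integers, so the counter is kept twice, once as a natural number
    and once as a real. *)
Definition mk_ratio :=
  Seq (ISet 21 (INum 0) (INum 0))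
  (Seq (RSet 5 (INum 0) RZero)
  (While (BRLt (RMul (rscalar 5) epsilon_cell) gamma_cell)
     (Seq (ISet 21 (INum 0) (IAdd (scalar 21) (INum 1)))
          (RSet 5 (INum 0) (RAdd (rscalar 5) ROne))))).

Definition ieq e1 e2 := BAnd (BNot (BILt e1 e2)) (BNot (BILt e2 e1)).

Definition perm_cell u v i := IGet 2 (IAdd (IAdd (IGet 9 u) (IGet 7 v)) i).
Definition weight_cell u v := RGet 1 (IAdd (IGet 8 u) v).

Definition mk_laplacian :=
  let vert (a : nat) := IGet 10 (scalar a) in
  let lab (a : nat) := IGet 11 (scalar a) in
  fill_mx
   (Seq (If (ieq (scalar 16) (scalar 17))
           (RSet 6 (INum 0) (RDiv two gamma_cell)) (RSet 6 (INum 0) RZero))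
        (If (ieq (perm_cell (vert 16%N) (vert 17%N) (lab 16%N)) (lab 17%N))
           (RSet 6 (INum 0) (RSub (rscalar 6)
              (RMul (RDiv two gamma_cell)
                    (RDiv (weight_cell (vert 16%N) (vert 17%N)) (rscalar 4)))))
           Skip))
   8 (rscalar 6).

Definition set_identity a :=
  fill_mx (If (ieq (scalar 16) (scalar 17))
             (RSet 6 (INum 0) ROne) (RSet 6 (INum 0) RZero)) a (rscalar 6).

Definition power :=
  Seq (set_identity 7)
      (For 19 22 (Seq matmul (fill_mx Skip 7 (RGet 9 rowidx)))).

Section Setup.
Variables (R : realType) (D : nat).
Implicit Types (s : memory R) (Q : memory R -> Prop).

Lemma beval_ieq s e1 e2 : beval s (ieq e1 e2) = (ieval s e1 == ieval s e2).
Proof. by rewrite /= -!leqNgt eqn_leq andbC. Qed.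

Lemma wp_mk_table x lim tab acc step n b Q s0 :
  (n <= D)%N -> ints s0 lim 0 = n -> ints s0 step 0 = b ->
  x \notin [:: lim; tab; acc; step] -> tab \notin [:: lim; acc; step] ->
  acc \notin [:: lim; step] ->
  (forall s, frame (mk_table x lim tab acc step) s0 s ->
     (forall i, (i < n)%N -> ints s tab i = (i * b)%N) ->
     ints s acc 0 = (n * b)%N -> Q s) ->
  wp D (mk_table x lim tab acc step) Q s0.
Proof.
move=> nD s0l s0b; rewrite !inE !negb_or.
move=> /and4P[xl xt xa xs] /and3P[tl ta ts] /andP[al as_] post.
apply: wp_framed; rewrite wpSeq wpI.
apply: (@wp_For _ _ _ _ _ n (fun j s =>
  (forall i, (i < j)%N -> ints s tab i = (i * b)%N) /\ ints s acc 0 = (j * b)%N)) => //.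
- by rewrite /= /update eq_sym (negbTE al).
- by rewrite /= negb_or eq_sym xt eq_sym xa.
- by rewrite /= negb_or tl al.
- by split=> //=; rewrite /update !eqxx eq_sym (negbTE xa).
- move=> j s jn fs sj [done sa].
  have ss : ints s step 0 = b.
    rewrite fs.1 /=; first by rewrite /update eq_sym (negbTE as_).
    by rewrite !negb_or ts as_ xs.
  rewrite wpSeq !wpI /= /update !eqxx /= ?andbF ?andbT.
  rewrite (eq_sym tab x) (negbTE xt) (eq_sym acc x) (negbTE xa) (negbTE ta).
  rewrite (eq_sym acc tab) (negbTE ta) (eq_sym step tab) (negbTE ts) /=.
  rewrite sj sa ss; split; last by rewrite mulSn addnC.
  move=> i; rewrite ltnS leq_eqVlt; case: eqP => [->//|_ /= ij].
  by rewrite done.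
- by move=> s fs [done sa] f; apply: post.
Qed.

Lemma wp_mk_labels n k Q s0 : (n <= D)%N -> ((0 < n)%N -> (k <= D)%N) ->
  ints s0 4 0 = n -> ints s0 5 0 = k ->
  (forall u, (u < n)%N -> ints s0 7 u = (u * k)%N) ->
  (forall s, frame mk_labels s0 s ->
     (forall u i, (u < n)%N -> (i < k)%N ->
        ints s 10 (u * k + i) = u /\ ints s 11 (u * k + i) = i) -> Q s) ->
  wp D mk_labels Q s0.
Proof.
move=> nD kD s0n s0k s0t post.
apply: (@wp_For _ _ _ _ _ n (fun j s => forall u i, (u < j)%N -> (i < k)%N ->
        ints s 10 (u * k + i) = u /\ ints s 11 (u * k + i) = i)) => //.
- move=> u s un fs su done.
  apply: (@wp_For _ _ _ _ _ k (fun l s => forall u' i, (u' < u)%N && (i < k)%N ||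
        (u' == u) && (i < l)%N ->
        ints s 10 (u' * k + i) = u' /\ ints s 11 (u' * k + i) = i)) => //.
  + exact: kD (leq_ltn_trans (leq0n _) un).
  + by rewrite fs.1.
  + move=> u' i; rewrite ltn0 andbF orbF => /andP[h1 h2]; exact: done.
  + move=> l s1 lk f1 s1l inv.
    rewrite wpSeq !wpI /= /update /=.
    rewrite s1l (f1.1 13 isT) su (f1.1 7 isT) (fs.1 7 isT) /= s0t //.
    move=> u' i h.
    case: (eqVneq (u' * k + i)%N (u * k + l)%N) => [e|ne]; last first.
      by apply: inv; move: h; rewrite ltnS (leq_eqVlt i);
         case: (eqVneq i l) ne => // -> ; case: (eqVneq u' u) => [->|//]; rewrite eqxx.
    have ik : (i < k)%N by move: h; lia.
    (* Equal addresses come from equal vertices and labels, by uniqueness of division by [k]. *)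
    have := congr1 (fun x => x %/ k)%N e; have := congr1 (fun x => x %% k)%N e.
    by rewrite !modnMDl !divnMDl ?modn_small ?divn_small ?addn0; lia.
  + move=> s1 f1 inv u' i; rewrite ltnS leq_eqVlt => h ik; apply: inv.
    by rewrite ik !andbT orbC.
Qed.

Lemma wp_mk_degree n Q s0 : (n <= D)%N -> ints s0 4 0 = n ->
  (forall s, frame mk_degree s0 s ->
     reals s 4 0 = \sum_(v < n) reals s0 1 v -> Q s) ->
  wp D mk_degree Q s0.
Proof.
move=> nD s0n post; apply: wp_framed; rewrite wpSeq wpR.
apply: (@wp_sum _ _ _ _ _ _ n (fun v => reals s0 1 v)) => //.
- by move=> j s jn fs sj; rewrite /= sj fs.2.
- by move=> s fs; rewrite /= /update /= add0r => h f; apply: post.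
Qed.

Lemma wp_mk_ratio g (epsilon gamma : R) Q s0 : (g <= D)%N ->
  reals s0 0 0 = epsilon -> reals s0 0 1 = gamma ->
  (forall i, (i < g)%N -> i%:R * epsilon < gamma) -> gamma <= g%:R * epsilon ->
  (forall s, frame mk_ratio s0 s -> ints s 21 0 = g -> Q s) ->
  wp D mk_ratio Q s0.
Proof.
move=> gD s0e s0g lt_g ge_g post; apply: wp_framed.
rewrite wpSeq wpI wpSeq wpR.
set s1 := set_real _ _ _ _.
exists g => //.
have gen i j s : (i + j = g)%N -> reals s 0 = reals s0 0 -> ints s 21 0 = i ->
    reals s 5 0 = i%:R ->
  iter j (fun P s => beval s (BRLt (RMul (rscalar 5) epsilon_cell) gamma_cell) /\
     wp D (Seq (ISet 21 (INum 0) (IAdd (scalar 21) (INum 1)))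
          (RSet 5 (INum 0) (RAdd (rscalar 5) ROne))) P s)
    (fun s => ~~ beval s (BRLt (RMul (rscalar 5) epsilon_cell) gamma_cell) /\
     (frame mk_ratio s0 s -> Q s)) s.
  elim: j i s => [|j IH] i s ijg s0' si sr /=; rewrite s0' sr s0e s0g.
    rewrite -leNgt; rewrite addn0 in ijg; rewrite ijg in si *.
    by split=> // f; apply: post.
  rewrite lt_g; last by lia.
  split=> //; apply: (IH i.+1) => //=; first by rewrite addSnnS.
    by rewrite /update /= si addn1.
  by rewrite /update /= -natr1.
by apply: (gen 0%N g).
Qed.

Lemma wp_set_identity N a Q s0 : (N <= D)%N -> tables N s0 -> a != 6 ->
  (forall s, frame (set_identity a) s0 s -> mx_of N (reals s a) = 1%:M -> Q s) ->
  wp D (set_identity a) Q s0.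
Proof.
move=> ND tb a6 post; apply: wp_fill_mx post => //.
  by rewrite /= eq_sym (negbTE a6).
move=> i j s fs ts si sj _; rewrite wpIf beval_ieq /= si sj val_eqE mxE.
by case: eqP => _; rewrite /= /update.
Qed.

Lemma wp_power N m (B : 'M[R]_N) Q s0 : (N <= D)%N -> (m <= D)%N ->
  tables N s0 -> ints s0 22 0 = m -> mx_of N (reals s0 8) = B ->
  (forall s, frame power s0 s -> mx_of N (reals s 7) = B ^+ m -> Q s) ->
  wp D power Q s0.
Proof.
move=> ND mD tb s0m s0B post; apply: wp_framed; rewrite wpSeq.
apply: (wp_set_identity ND tb) => // s1 f1 s1A.
apply: (@wp_For _ _ _ _ _ m (fun t s => mx_of N (reals s 7) = B ^+ t)) => //.
- by rewrite f1.1.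
- move=> t s tm fs st sA.
  have ts : tables N s by apply: tables_frame fs _ => //; apply: tables_frame f1 tb.
  rewrite wpSeq; apply: (wp_matmul ND ts) => s2 f2.
  rewrite sA fs.2 // f1.2 // s0B => s2C.
  apply: (wp_fill_mx ND (F := B ^+ t *m B)) => //.
    by apply: tables_frame f2 ts.
    move=> i j s3 f3 t3 s3i s3j _.
    by rewrite wpSkip /= s3i s3j t3.2 // f3.2 // -s2C mxE.
  by move=> s3 f3 s3A; rewrite exprSr -mulmxE.
- by move=> s fs sA f; apply: post.
Qed.

End Setup.

(** * Layout of the input and of the tables *)

Lemma nth_flatten_const (T : Type) (x0 : T) (ss : seq (seq T)) m a b :
  all (fun s => size s == m) ss -> (a < size ss)%N -> (b < m)%N ->
  nth x0 (flatten ss) (a * m + b) = nth x0 (nth [::] ss a) b.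
Proof.
elim: ss a => //= s ss IH [|a] /andP[/eqP sm ssm] alt bm.
  by rewrite mul0n add0n nth_cat sm bm.
rewrite nth_cat sm mulSn -addnA ltnNge leq_addr /= addKn; exact: IH.
Qed.

Section Environment.
Variables (R : realType) (D n k : nat) (U : unique_game R n k).
Variables (epsilon gamma : R).
Implicit Types (s : memory R) (Q : memory R -> Prop).

Definition weight0 (u v : 'I_n) : R :=
  if ug_edge U u v then ug_weight U u v else 0.
(** The value 0 at a non-edge may coincide with a label; the weight 0 makes this harmless. *)
Definition perm0 (u v : 'I_n) (i : 'I_k) : nat :=
  if ug_edge U u v then nat_of_ord (ug_perm U u v i) else 0%N.

Local Notation N := (\sum_(u < n) k)%N.

Lemma sum_constE : N = (n * k)%N.
Proof. by rewrite sum_nat_const card_ord. Qed.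

Lemma size_vertex_pairs : size (vertex_pairs n) = (n * n)%N.
Proof. by rewrite /vertex_pairs size_allpairs size_enum_ord. Qed.

Lemma nth_vertex_pairs (T : Type) (x0 : T) (f : 'I_n * 'I_n -> T) (u v : 'I_n) :
  nth x0 [seq f e | e <- vertex_pairs n] (u * n + v) = f (u, v).
Proof.
rewrite (nth_map (u, v)).
  rewrite /vertex_pairs nth_flatten_const ?size_map -?enumT ?size_enum_ord //.
    by rewrite (nth_map u) ?size_enum_ord // (nth_map v) ?size_enum_ord // !nth_ord_enum.
  by apply/allP => s /mapP[x _ ->]; rewrite size_map size_enum_ord.
rewrite size_vertex_pairs; apply: (@leq_trans (u.+1 * n)).
  by rewrite mulSn addnC ltn_add2r.
by rewrite leq_mul2r ltn_ord orbT.
Qed.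

Lemma input_weight (u v : 'I_n) :
  reals (input_memory U epsilon gamma) 1 (u * n + v) = weight0 u v.
Proof. by rewrite /= nth_vertex_pairs. Qed.

Lemma input_perm (u v : 'I_n) (i : 'I_k) :
  ints (input_memory U epsilon gamma) 2 ((u * n + v) * k + i) = perm0 u v i.
Proof.
rewrite /= nth_flatten_const ?size_map ?size_vertex_pairs //.
- by rewrite nth_vertex_pairs (nth_map i) ?size_enum_ord // nth_ord_enum.
- by apply/allP => s /mapP[x _ ->]; rewrite size_map size_enum_ord.
- apply: (@leq_trans (u.+1 * n)); last by rewrite leq_mul2r ltn_ord orbT.
  by rewrite mulSn addnC ltn_add2r.
Qed.

(** Since [n * k = N], the cell [(u * n + v) * k + i] of a permutation is addressed as
    [u * N + v * k + i], a sum of table entries. *)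
Record env s : Prop := Env {
  env_n : ints s 4 0 = n;
  env_k : ints s 5 0 = k;
  env_tables : tables N s;
  env_k_table : forall u, (u < n)%N -> ints s 7 u = (u * k)%N;
  env_n_table : forall u, (u < n)%N -> ints s 8 u = (u * n)%N;
  env_perm : forall (u v : 'I_n) (i : 'I_k),
    ints s 2 (u * N + v * k + i) = perm0 u v i;
  env_weight : forall u v : 'I_n, reals s 1 (u * n + v) = weight0 u v;
  env_epsilon : reals s 0 0 = epsilon;
  env_gamma : reals s 0 1 = gamma }.

Lemma env_frame p s s' :
  ~~ has (writes_int p) [:: 2; 4; 5; 6; 7; 8; 9] ->
  ~~ has (writes_real p) [:: 0; 1] -> frame p s s' -> env s -> env s'.
Proof.
rewrite /= !negb_or => /and5P[i2 i4 i5 i6 /and4P[i7 i8 i9 _]] /and3P[r0 r1 _].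
move=> f [h1 h2 h3 h4 h5 h6 h7 h8 h9].
split; rewrite ?f.1 ?f.2 //; exact: tables_frame f h3.
Qed.

Definition mk_env :=
  Seq (ISet 4 (INum 0) (IGet 0 (INum 0)))
  (Seq (ISet 5 (INum 0) (IGet 0 (INum 1)))
  (Seq (mk_table 13 4 7 6 5)
  (Seq (mk_table 13 4 8 12 4)
       (mk_table 16 6 9 12 6)))).

Lemma wp_mk_env Q : (n <= D)%N -> (N <= D)%N ->
  (forall s, frame mk_env (input_memory U epsilon gamma) s -> env s -> Q s) ->
  wp D mk_env Q (input_memory U epsilon gamma).
Proof.
move=> nD ND post; apply: wp_framed.
rewrite wpSeq wpI wpSeq wpI; set s0 := set_int _ _ _ _.
rewrite wpSeq; apply: (@wp_mk_table _ _ _ _ _ _ _ n k) => // s1 f1 t1 a1.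
rewrite -sum_constE in a1.
have n1 : ints s1 4 0 = n by rewrite f1.1.
rewrite wpSeq; apply: (@wp_mk_table _ _ _ _ _ _ _ n n) => // s2 f2 t2 _.
have a2 : ints s2 6 0 = N by rewrite f2.1.
apply: (@wp_mk_table _ _ _ _ _ _ _ N N) => // s3 f3 t3 _ f; apply: post => //.
split.
- by rewrite f3.1 // f2.1.
- by rewrite f3.1 // f2.1 // f1.1.
- by split=> //; rewrite f3.1.
- by move=> u un; rewrite f3.1 // f2.1 // t1.
- by move=> u un; rewrite f3.1 // t2.
- move=> u v i; rewrite f3.1 // f2.1 // f1.1 // sum_constE mulnA -mulnDl.
  exact: input_perm.
- by move=> u v; rewrite f3.2 // f2.2 // f1.2 //; exact: input_weight.
- by rewrite f3.2 // f2.2 // f1.2.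
- by rewrite f3.2 // f2.2 // f1.2.
Qed.

Lemma rank_flat (i : 'I_N) : i = (tagnat.sig1 i * k + tagnat.sig2 i)%N :> nat.
Proof.
rewrite [LHS]tagnat.rect; congr addn.
rewrite -(big_ord_widen _ (fun=> k)) ?sum_nat_const ?card_ord //.
by apply: ltnW.
Qed.

Lemma wp_mk_laplacian d Q s0 : (N <= D)%N -> env s0 -> reals s0 4 0 = d ->
  (forall u i, (u < n)%N -> (i < k)%N ->
        ints s0 10 (u * k + i) = u /\ ints s0 11 (u * k + i) = i) ->
  (forall s, frame mk_laplacian s0 s -> env s ->
     mx_of N (reals s 8) =
       (2 / gamma) *: (1%:M - d^-1 *: label_extended U) -> Q s) ->
  wp D mk_laplacian Q s0.
Proof.
move=> ND es0 s0d lab post; apply: wp_framed.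
apply: (wp_fill_mx ND (F := (2 / gamma) *: (1%:M - d^-1 *: label_extended U))) => //.
- exact: env_tables.
- move=> i j s f ts si sj _.
  have labi (l : 'I_N) : ints s 10 l = tagnat.sig1 l /\ ints s 11 l = tagnat.sig2 l.
    rewrite !f.1 // rank_flat; exact: lab.
  have es : env s by apply: env_frame f es0.
  have sd : reals s 4 0 = d by rewrite f.2.
  set u := tagnat.sig1 i; set v := tagnat.sig1 j.
  have cond s' : frame (RSet 6 (INum 0) RZero) s s' ->
    beval s' (ieq (perm_cell (IGet 10 (scalar 16)) (IGet 10 (scalar 17)) (IGet 11 (scalar 16)))
       (IGet 11 (scalar 17))) = (perm0 u v (tagnat.sig2 i) == tagnat.sig2 j).
    move=> f'; rewrite beval_ieq /= !f'.1 // si sj !(labi _).1 !(labi _).2.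
    rewrite (env_tables es).2; last first.
      by rewrite sum_constE; apply: (leq_trans (ltn_ord _)); rewrite leq_pmulr //;
        case: (k) (tagnat.sig2 i) => // -[].
    by rewrite (env_k_table es) // (env_perm es).
  have wE s' : frame (RSet 6 (INum 0) RZero) s s' ->
     reval s' (weight_cell (IGet 10 (scalar 16)) (IGet 10 (scalar 17))) = weight0 u v.
    move=> f'; rewrite /= !f'.1 // f'.2 // si sj !(labi _).1.
    by rewrite (env_n_table es) // (env_weight es).
  have FE : ((2 / gamma) *: (1%:M - d^-1 *: label_extended U)) i j =
     2 / gamma * (i == j)%:R -
     2 / gamma * (weight0 u v / d) * (perm0 u v (tagnat.sig2 i) == tagnat.sig2 j)%:R.
    rewrite !mxE -/u -/v /weight0 /perm0.
    case: ifP => _; rewrite !mxE ?val_eqE; last by rewrite !(mul0r, mulr0, subr0).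
    by rewrite mulrBr; congr (_ - _); ring.
  have two_gamma s' : frame (RSet 6 (INum 0) RZero) s s' ->
      reval s' (RDiv two gamma_cell) = 2 / gamma.
    by move=> f'; rewrite /= f'.2 // (env_gamma es).
  rewrite wpSeq wpIf !wpR beval_ieq [ieval _ _]/= si [ieval s (scalar 17)]/= sj val_eqE.
  rewrite FE.
  have final s' c : frame (RSet 6 (INum 0) RZero) s s' -> reals s' 6 0 = c ->
     c = 2 / gamma * (i == j)%:R ->
     wp D (If (ieq (perm_cell (IGet 10 (scalar 16)) (IGet 10 (scalar 17)) (IGet 11 (scalar 16)))
             (IGet 11 (scalar 17)))
        (RSet 6 (INum 0) (RSub (rscalar 6)
              (RMul (RDiv two gamma_cell)
                    (RDiv (weight_cell (IGet 10 (scalar 16)) (IGet 10 (scalar 17))) (rscalar 4)))))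
           Skip)
      (fun s' => reval s' (rscalar 6) = 2 / gamma * (i == j)%:R -
     2 / gamma * (weight0 u v / d) * (perm0 u v (tagnat.sig2 i) == tagnat.sig2 j)%:R) s'.
    move=> f' s'6 cE; rewrite wpIf cond // wpR wpSkip.
    case: eqP => _; last by rewrite mulr0 subr0 /= s'6.
    have := wE s' f'; have := two_gamma s' f'.
    rewrite /= /update /= s'6 => -> ->.
    by rewrite f'.2 // sd cE mulr1.
  move: final; case: eqP => _ final.
    apply: (final _ (2 / gamma)); rewrite ?mulr1 //.
      exact: frame_set_real.
    by rewrite /= /update /= (env_gamma es).
  apply: (final _ 0); rewrite ?mulr0 //.
  exact: frame_set_real.
- move=> s f sE f'; apply: post => //; exact: env_frame f es0.
Qed.

End Environment.

(** * Enumeration and selection of the candidates *)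

(** For [r] pivots this computes [(4 * g + 1) * (r + 1)], the count required by [good_candidate]: at
    most [4 * g * (r + 1)] signed additions and one advance for each basis vector. *)
Definition mk_rounds :=
  let g := scalar 21 in
  let g41 := IAdd (IAdd (IAdd (IAdd g g) g) g) (INum 1) in
  Seq (ISet 25 (INum 0) g41)
      (For 16 23 (ISet 25 (INum 0) (IAdd (scalar 25) g41))).

Definition append (op : rexp -> rexp -> rexp) :=
  Seq (fill 17 6 Skip 13 (scalar 30)
        (op (RGet 13 (IAdd (IGet 28 (scalar 20)) (scalar 17)))
            (RGet 12 (IAdd (IGet 9 (IGet 29 (scalar 20))) (scalar 17)))))
  (Seq (ISet 28 (scalar 26) (scalar 30))
  (Seq (ISet 29 (scalar 26) (IGet 29 (scalar 20)))
  (Seq (ISet 26 (INum 0) (IAdd (scalar 26) (INum 1)))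
       (ISet 30 (INum 0) (IAdd (scalar 30) (scalar 6)))))).

Definition extend :=
  Seq (append RAdd)
  (Seq (append RSub)
       (ISet 29 (scalar 20) (IAdd (IGet 29 (scalar 20)) (INum 1)))).

Definition enumerate :=
  Seq (ISet 26 (INum 0) (INum 1))
  (Seq (ISet 28 (INum 0) (INum 0))
  (Seq (ISet 29 (INum 0) (INum 0))
  (Seq (ISet 30 (INum 0) (scalar 6))
  (Seq (fill 17 6 Skip 13 (INum 0) RZero)
  (For 19 25 (Seq (ISet 27 (INum 0) (scalar 26)) (For 20 27 extend))))))).

Section Candidates.
Variables (R : realType) (N : nat) (b : nat -> 'rV[R]_N).
Implicit Types (x : 'rV[R]_N * nat) (L : seq ('rV[R]_N * nat)).

(* A candidate is a vector under construction together with the index of the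
   basis vector that may still be added to it or subtracted from it. *)
Definition cand_next x := (x.1, x.2.+1).
Definition cand_add x := (x.1 + b x.2, x.2).
Definition cand_sub x := (x.1 - b x.2, x.2).

Definition descendants L := flatten [seq [:: cand_add x; cand_sub x] | x <- L].
Definition next_round L := map cand_next L ++ descendants L.
Definition candidates t := iter t next_round [:: (0, 0%N)].

(** The invariant inside a round: advancing overwrites a candidate in place, while its two
    descendants are appended at the end of the list. *)
Definition half_round c L :=
  map cand_next (take c L) ++ drop c L ++ descendants (take c L).

Lemma half_roundS c L x0 : (c < size L)%N ->
  nth x0 (half_round c L) c = nth x0 L c /\
  half_round c.+1 L = set_nth x0
    (rcons (rcons (half_round c L) (cand_add (nth x0 L c)))
           (cand_sub (nth x0 L c))) c (cand_next (nth x0 L c)).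
Proof.
move=> cL; rewrite /half_round (drop_nth x0 cL) (take_nth x0 cL).
have sz : size (map cand_next (take c L)) = c by rewrite size_map size_take cL.
split; first by rewrite nth_cat sz ltnn subnn.
set x := nth x0 L c; rewrite -!cats1 -!catA /=.
rewrite set_nthE size_cat sz /= ifT; last by lia.
rewrite take_size_cat // map_cat /= -catA /=; congr (_ ++ _ :: _).
rewrite drop_cat sz ltnNge leqnSn /= subSnn /= drop0.
by rewrite /descendants map_cat flatten_cat /= ?catA ?cats1.
Qed.

Lemma size_descendants L : size (descendants L) = (2 * size L)%N.
Proof. by elim: L => //= x L IH; rewrite /descendants /= in IH *; lia. Qed.

Lemma size_half_round c L : (c <= size L)%N ->
  size (half_round c L) = (size L + 2 * c)%N.
Proof.
move=> cL; rewrite !size_cat size_descendants size_map size_drop size_take.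
by case: ltnP => h; lia.
Qed.

Lemma size_candidates t : size (candidates t) = (3 ^ t)%N.
Proof.
elim: t => // t IH; rewrite /= size_cat size_map size_descendants expnS -IH.
by rewrite /candidates /=; lia.
Qed.

End Candidates.

Section Enumeration.
Variables (R : realType) (D N : nat).
Hypothesis ND : (N <= D)%N.
Implicit Types (s : memory R) (Q : memory R -> Prop).

Lemma wp_mk_rounds g cnt Q s0 : (cnt <= D)%N -> ints s0 21 0 = g ->
  ints s0 23 0 = cnt ->
  (forall s, frame mk_rounds s0 s ->
     ints s 25 0 = ((4 * g + 1) * cnt.+1)%N -> Q s) ->
  wp D mk_rounds Q s0.
Proof.
move=> cD s0g s0c post; apply: wp_framed; rewrite wpSeq wpI.
apply: (@wp_For _ _ _ _ _ cnt (fun j s =>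
  ints s 25 0 = ((4 * g + 1) * j.+1)%N)) => //.
- by rewrite /= /update /= s0g; lia.
- move=> j s jc fs _ sT; rewrite wpI /= /update /= sT (fs.1 21 isT) /= /update /= s0g.
  lia.
- by move=> s fs sT f; apply: post.
Qed.

Definition stores s (L : seq ('rV[R]_N * nat)) : Prop :=
  [/\ ints s 26 0 = size L, ints s 30 0 = (size L * N)%N &
    forall c, (c < size L)%N ->
      [/\ ints s 28 c = (c * N)%N, ints s 29 c = (nth (0, 0%N) L c).2
        & row_of N (reals s 13) (c * N) = (nth (0, 0%N) L c).1]].

Lemma stores_frame p s s' L :
  ~~ has (writes_int p) [:: 26; 28; 29; 30] -> ~~ writes_real p 13 ->
  frame p s s' -> stores s L -> stores s' L.
Proof.
rewrite /= !negb_or => /and5P[w26 w28 w29 w30 _] w13 f [h1 h2 h3].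
by split=> [||c cL]; rewrite ?f.1 ?f.2 //; apply: h3.
Qed.

Definition bvec s (j : nat) := row_of N (reals s 12) (ints s 9 j).

Lemma wp_append op (fr : R -> R -> R) (fv : 'rV[R]_N -> 'rV[R]_N -> 'rV[R]_N)
    Q s0 L c :
  (forall s e1 e2, reval s (op e1 e2) = fr (reval s e1) (reval s e2)) ->
  (forall u v i, fv u v 0 i = fr (u 0 i) (v 0 i)) ->
  tables N s0 -> stores s0 L -> ints s0 20 0 = c -> (c < size L)%N ->
  (forall s, frame (append op) s0 s ->
     stores s (rcons L (let x := nth (0, 0%N) L c in (fv x.1 (bvec s0 x.2), x.2))) ->
     Q s) ->
  wp D (append op) Q s0.
Proof.
move=> opE fvE tb [s0C s0n st] s0c cL post; apply: wp_framed; rewrite wpSeq.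
have [s0o s0p s0r] := st _ cL; set x := nth _ L c in s0o s0p s0r post *.
apply: (@wp_fill _ _ _ _ _ _ _ _ N (size L * N) (fun i =>
  if insub i is Some i' then fv x.1 (bvec s0 x.2) 0 i' else 0)) => //.
- exact: tb.1.
- move=> j s jN f sj keep; rewrite wpSkip; split; first by rewrite /= (f.1 30 isT).
  rewrite opE /= sj (f.1 28 isT) (f.1 20 isT) (f.1 9 isT) (f.1 29 isT) s0c s0o s0p.
  rewrite (f.2 12 isT) keep; last first.
    apply/orP; left; apply: (@leq_trans (c.+1 * N)).
      by rewrite mulSn addnC ltn_add2r.
    by rewrite leq_mul2r cL orbT.
  by rewrite insubT fvE -s0r !mxE.
move=> s f new old; rewrite !wpSeq !wpI /= => fr'; apply: post => //.
have := fr'; rewrite /stores size_rcons => _.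
rewrite /= /update /= !(f.1 26 isT) !(f.1 30 isT) !(f.1 20 isT) !(f.1 6 isT).
rewrite s0C s0n s0c tb.1 addn1; split=> //; first by rewrite mulSn addnC.
move=> c'; rewrite ltnS leq_eqVlt nth_rcons => /orP[/eqP->|c'L].
  rewrite ltnn !eqxx /= (f.1 29 isT) s0p; split=> //.
  by apply/rowP => i; rewrite mxE new // valK.
have ne : (c' == size L) = false by lia.
rewrite c'L ne (f.1 28 isT) (f.1 29 isT).
have [e1 e2 e3] := st _ c'L; split=> //.
apply/rowP => i; rewrite -e3 !mxE old //.
apply/orP; left; apply: (@leq_trans (c'.+1 * N)).
  by rewrite mulSn addnC ltn_add2r.
by rewrite leq_mul2r c'L orbT.
Qed.

Lemma bvec_frame p s s' : ~~ writes_int p 9 -> ~~ writes_real p 12 ->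
  frame p s s' -> bvec s' =1 bvec s.
Proof. by move=> w9 w12 f j; rewrite /bvec f.1 // f.2. Qed.

Lemma wp_extend Q s0 L c : tables N s0 -> (c < size L)%N -> ints s0 20 0 = c ->
  stores s0 (half_round (bvec s0) c L) ->
  (forall s, frame extend s0 s -> stores s (half_round (bvec s0) c.+1 L) -> Q s) ->
  wp D extend Q s0.
Proof.
move=> tb cL s0c st post; apply: wp_framed.
have [xE hE] := half_roundS (bvec s0) (0, 0%N) cL.
have szh := size_half_round (bvec s0) (ltnW cL).
set b := bvec s0 in st post xE hE szh *; set x := nth _ L c in xE hE.
have sz1 : (c < size (half_round b c L))%N by rewrite szh; lia.
rewrite wpSeq; apply: (wp_append (fv := +%R) _ _ tb st s0c sz1) => //.
  by move=> u v i; rewrite mxE.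
move=> s1 f1 st1; rewrite /= xE -/b in st1.
have t1 : tables N s1 by apply: tables_frame f1 tb.
have b1 : bvec s1 =1 b by apply: bvec_frame f1.
have s1c : ints s1 20 0 = c by rewrite f1.1.
rewrite wpSeq; apply: (wp_append (fr := fun u v => u - v) (fv := fun u v => u - v)
   (c := c) _ _ t1 st1 s1c) => //.
- by move=> u v i; rewrite !mxE.
- by rewrite size_rcons; lia.
move=> s2 f2 st2; rewrite /= nth_rcons sz1 xE b1 in st2.
rewrite wpI => f; apply: post => //.
have s2c : ints s2 20 0 = c by rewrite f2.1.
rewrite hE; set L2 := rcons _ _ in st2 *.
have cL2 : (c < size L2)%N by rewrite /L2 !size_rcons; lia.
have szL2 : size (set_nth (0, 0%N) L2 c (cand_next x)) = size L2.
  by rewrite size_set_nth; apply/maxn_idPr.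
case: st2 => h1 h2 h3; rewrite /= s2c; split; rewrite ?szL2 //= => c' c'L.
have [e1 e2 e3] := h3 _ c'L; rewrite /update /= nth_set_nth /=.
have L2c : nth (0, 0%N) L2 c = x.
  by rewrite /L2 nth_rcons size_rcons ltnS (ltnW sz1) nth_rcons sz1 xE.
case: eqP e1 e2 e3 => // ->; rewrite L2c => e1 e2 e3.
by split=> //=; rewrite e2 addn1.
Qed.

Lemma wp_enumerate T Q s0 : (T <= D)%N -> (3 ^ T <= D)%N -> tables N s0 ->
  ints s0 25 0 = T ->
  (forall s, frame enumerate s0 s -> stores s (candidates (bvec s0) T) -> Q s) ->
  wp D enumerate Q s0.
Proof.
move=> TD T3D tb s0T post; apply: wp_framed.
rewrite wpSeq wpI wpSeq wpI wpSeq wpI wpSeq wpI wpSeq.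
set s1 := set_int _ _ _ _.
have f1 : frame enumerate s0 s1.
  by rewrite /s1; do 4! (apply: frame_set_intr => //).
have t1 : tables N s1 by apply: tables_frame f1 tb.
apply: (@wp_fill _ _ _ _ _ _ _ _ N 0%N (fun=> 0)) => //; first exact: t1.1.
move=> s2 f2 new2 _.
have b2 : bvec s2 =1 bvec s0.
  by move=> j; rewrite /bvec (f2.1 9 isT) (f2.2 12 isT).
have t2 : tables N s2 by apply: tables_frame f2 t1.
have st2 : stores s2 (candidates (bvec s0) 0).
  rewrite /stores /=; rewrite !f2.1 // /s1 /= /update /= tb.1 mul1n.
  split=> // -[|//] _; split=> //.
  apply/rowP => i; rewrite !mxE /= mul0n. by rewrite new2.
apply: (@wp_For _ _ _ _ _ T (fun t s => stores s (candidates (bvec s0) t))) => //.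
- by rewrite f2.1 // f1.1.
- move=> t s tT fs st inv; rewrite wpSeq wpI.
  have ts : tables N s by apply: tables_frame fs t2.
  have bs : bvec s =1 bvec s0.
    by move=> j; rewrite (bvec_frame _ _ fs) // b2.
  have szD : (size (candidates (bvec s0) t) <= D)%N.
    by rewrite size_candidates (leq_trans _ T3D) // leq_exp2l // ltnW.
  set L := candidates _ t in inv szD.
  apply: (@wp_For _ _ _ _ _ (size L)
    (fun c s => stores s (half_round (bvec s0) c L))) => //.
  + by rewrite /= /update /=; case: inv.
  + by rewrite /half_round take0 drop0 cats0; case: inv.
  + move=> c s3 cL f3 s3c st3.
    have b3 : bvec s3 = bvec s0.
      by apply: funext => j; rewrite (bvec_frame _ _ f3) //; apply: bs.
    apply: (@wp_extend _ _ L c) => //; rewrite ?b3 //.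
    by apply: tables_frame f3 _.
  + move=> s3 f3; rewrite /half_round take_size drop_size; case=> h1 h2 h3.
    by split.
- by move=> s fs st f; apply: post.
Qed.

End Enumeration.

(** * Rounding a candidate and scoring the labeling *)

Definition round_labels :=
  let cell i := RGet 13 (IAdd (IAdd (IGet 28 (scalar 20)) (IGet 7 (scalar 13))) i) in
  For 13 4
    (Seq (ISet 32 (INum 0) (INum 0))
    (Seq (For 15 5 (If (BRLt (cell (scalar 32)) (cell (scalar 15)))
                       (ISet 32 (INum 0) (scalar 15)) Skip))
         (ISet 31 (scalar 13) (scalar 32)))).

Definition evaluate :=
  Seq (RSet 6 (INum 0) RZero)
  (For 13 4 (For 14 4
    (If (ieq (perm_cell (scalar 13) (scalar 14) (IGet 31 (scalar 13)))
             (IGet 31 (scalar 14)))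
        (RSet 6 (INum 0) (RAdd (rscalar 6) (weight_cell (scalar 13) (scalar 14))))
        Skip))).

(** The best score starts at [-1], below every score, so the first candidate is always accepted and
    array 3 holds a labeling at the end. *)
Definition select_best :=
  Seq (RSet 14 (INum 0) (RSub RZero ROne))
  (For 20 26
    (Seq round_labels
    (Seq evaluate
    (If (BRLt (rscalar 14) (rscalar 6))
        (Seq (RSet 14 (INum 0) (rscalar 6))
             (For 13 4 (ISet 3 (scalar 13) (IGet 31 (scalar 13)))))
        Skip)))).

Section Selection.
Variables (R : realType) (D n k : nat) (U : unique_game R n k).
Variables (epsilon gamma : R).
Implicit Types (s : memory R) (Q : memory R -> Prop) (L : 'I_n -> 'I_k).

Local Notation N := (\sum_(u < n) k)%N.
Hypotheses (nD : (n <= D)%N) (kD : (k <= D)%N) (k_gt0 : (0 < k)%N).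

Definition score L : R :=
  \sum_(u < n) \sum_(v < n) if perm0 U u v (L u) == L v then weight0 U u v else 0.

(** A relation and not a function, so that the analysis does not depend on how ties are broken. *)
Definition rounding (w : 'rV[R]_N) L : Prop :=
  forall (u : 'I_n) (i : 'I_k), w 0 (tagnat.Rank u i) <= w 0 (tagnat.Rank u (L u)).

Lemma Rank_flat (u : 'I_n) (i : 'I_k) :
  @tagnat.Rank n (fun=> k) u i = (u * k + i)%N :> nat.
Proof.
rewrite tagnat.RankEsum; congr addn.
by rewrite -(big_ord_widen _ (fun=> k)) ?sum_nat_const ?card_ord // ltnW.
Qed.

Lemma wp_round_labels Q s0 c (w : 'rV[R]_N) :
  env U epsilon gamma s0 -> ints s0 20 0 = c -> ints s0 28 c = (c * N)%N ->
  row_of N (reals s0 13) (c * N) = w ->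
  (forall s L, frame round_labels s0 s -> rounding w L ->
     (forall u : 'I_n, ints s 31 u = L u) -> Q s) ->
  wp D round_labels Q s0.
Proof.
move=> es0 s0c s0o s0w post.
have wE s (u : 'I_n) (i : 'I_k) : reals s 13 = reals s0 13 ->
    reals s 13 (c * N + u * k + i)%N = w 0 (tagnat.Rank u i).
  by move=> ->; rewrite -s0w mxE Rank_flat addnA.
apply: (@wp_For _ _ _ _ _ n (fun u s => forall u' : 'I_n, (u' < u)%N ->
   exists2 l : 'I_k, ints s 31 u' = l &
     forall i : 'I_k, w 0 (tagnat.Rank u' i) <= w 0 (tagnat.Rank u' l))) => //.
- exact: env_n es0.
- move=> u s un fs su done; rewrite wpSeq wpI wpSeq.
  have es : env U epsilon gamma s by apply: env_frame fs es0.
  set s1 := set_int _ _ _ _.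
  pose u' := Ordinal un.
  apply: (@wp_For _ _ _ _ _ k (fun j s => exists2 l : 'I_k, ints s 32 0 = l &
     forall i : 'I_k, (i < j)%N -> w 0 (tagnat.Rank u' i) <= w 0 (tagnat.Rank u' l))) => //.
  + exact: env_k es.
  + by exists (Ordinal k_gt0).
  + move=> j s2 jk f2 s2j [l s2l le].
    have r2 : reals s2 13 = reals s0 13 by rewrite f2.2 // fs.2.
    have base : (ints s2 28 (ints s2 20 0) + ints s2 7 (ints s2 13 0))%N = (c * N + u * k)%N.
      by rewrite !f2.1 // /s1 /= /update /= su !(fs.1 20, fs.1 28) // s0c s0o
        (env_k_table es).
    rewrite wpIf wpI wpSkip [beval _ _]/= base s2j s2l.
    rewrite (wE s2 u' l r2) (wE s2 u' (Ordinal jk) r2).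
    have ltS (r : 'I_k) : (r < j.+1)%N -> r = Ordinal jk \/ (r < j)%N.
      rewrite ltnS leq_eqVlt => /orP[/eqP e|]; last by right.
      by left; apply: val_inj.
    case: ltP => cmp.
      exists (Ordinal jk); first by rewrite /= /update /= s2j.
      by move=> i /ltS[->//|/le]; move/le_trans; apply; apply: ltW.
    by exists l => // i /ltS[->//|/le].
  + move=> s2 f2 [l s2l le]; rewrite wpI => v; rewrite ltnS leq_eqVlt.
    rewrite /= /update /= (f2.1 13 isT) /s1 /= /update /= su.
    case/orP=> [/eqP vu|vu].
      rewrite vu eqxx; exists l => // i; have -> : v = u' by apply: val_inj.
      exact: le.
    have -> : (nat_of_ord v == u) = false by lia.
    rewrite (f2.1 31 isT) /s1 /= /update /=; exact: done.
- move=> s fs done.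
  have /choice [L LP] : forall u : 'I_n, exists l : 'I_k, ints s 31 u = l /\
     forall i : 'I_k, w 0 (tagnat.Rank u i) <= w 0 (tagnat.Rank u l).
    by move=> u; have [l h1 h2] := done u (ltn_ord u); exists l.
  apply: (post s L) => // [u i|u]; first exact: (LP u).2.
  exact: (LP u).1.
Qed.

Lemma wp_evaluate Q s0 L : env U epsilon gamma s0 ->
  (forall u : 'I_n, ints s0 31 u = L u) ->
  (forall s, frame evaluate s0 s -> reals s 6 0 = score L -> Q s) ->
  wp D evaluate Q s0.
Proof.
move=> es0 s0L post; apply: wp_framed; rewrite wpSeq wpR.
pose f (u v : 'I_n) := if perm0 U u v (L u) == L v then weight0 U u v else 0.
pose F (u v : nat) : R := if insub u is Some u' then
   if insub v is Some v' then f u' v' else 0 else 0.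
apply: (@wp_For _ _ _ _ _ n (fun u s =>
  reals s 6 0 = \sum_(u' < u) \sum_(v < n) F u' v)) => //.
- exact: env_n es0.
- by rewrite big_ord0.
- move=> u s un fs su acc.
  have es : env U epsilon gamma s.
    have f0 : frame evaluate s0 (set_real s0 6 (ieval s0 (INum 0)) (reval s0 RZero)).
      exact: frame_set_real.
    by apply: env_frame fs _ => //; apply: env_frame f0 es0.
  apply: (@wp_For _ _ _ _ _ n (fun v s => reals s 6 0 =
      \sum_(u' < u) \sum_(v < n) F u' v + \sum_(v' < v) F u v')) => //.
  + exact: env_n es.
  + by rewrite big_ord0 addr0.
  + move=> v s1 vn f1 s1v acc1.
    have es1 : env U epsilon gamma s1 by apply: env_frame f1 es.
    have s1u : ints s1 13 0 = Ordinal un by rewrite f1.1.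
    have s1v' : ints s1 14 0 = Ordinal vn by rewrite s1v.
    have s1L w : ints s1 31 w = ints s0 31 w by rewrite f1.1 // fs.1.
    have nN : (n <= N)%N by rewrite sum_constE leq_pmulr.
    rewrite wpIf beval_ieq wpR wpSkip [ieval _ _]/=.
    rewrite [ieval s1 (IGet 31 (scalar 14))]/= s1u s1v' !s1L !s0L.
    rewrite (env_tables es1).2 ?(leq_trans _ nN) // (env_k_table es1) //.
    have FE : F u v = f (Ordinal un) (Ordinal vn) by rewrite /F !insubT.
    rewrite (env_perm es1) big_ord_recr /= FE /f.
    case: eqP => _; last by rewrite addr0.
    rewrite /update /= s1u s1v' (env_n_table es1) //= acc1 addrA; congr (_ + _).
    exact: (env_weight es1 (Ordinal un) (Ordinal vn)).
  + by move=> s1 f1 h; rewrite big_ord_recr.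
- move=> s fs h f'; apply: post => //; rewrite h; apply: eq_bigr => u _.
  by apply: eq_bigr => v _; rewrite /F !valK.
Qed.

Lemma score_ge0 L : 0 <= score L.
Proof.
apply: sumr_ge0 => u _; apply: sumr_ge0 => v _; case: ifP => // _.
by rewrite /weight0; case: ifP => // /ug_weight_01 /andP[].
Qed.

Lemma wp_select_best Q s0 (l : seq ('rV[R]_N * nat)) :
  env U epsilon gamma s0 -> stores s0 l -> (0 < size l <= D)%N ->
  (forall s (Lb : 'I_n -> 'I_k), (forall u : 'I_n, ints s 3 u = Lb u) ->
     (forall c, (c < size l)%N -> exists2 L, rounding (nth (0, 0%N) l c).1 L &
        score L <= score Lb) -> Q s) ->
  wp D select_best Q s0.
Proof.
move=> es0 st0 /andP[l0 lD] post; rewrite wpSeq wpR.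
set s0' := set_real _ _ _ _.
have f0 : frame select_best s0 s0' by apply: frame_set_real.
pose inv c s := (c = 0%N /\ reals s 14 0 = -1) \/
  exists Lb : 'I_n -> 'I_k, [/\ (forall u : 'I_n, ints s 3 u = Lb u), reals s 14 0 = score Lb &
    forall c', (c' < c)%N -> exists2 L, rounding (nth (0, 0%N) l c').1 L &
        score L <= score Lb].
apply: (@wp_For _ _ _ _ _ (size l) inv) => //.
- by case: st0.
- by left; split=> //; rewrite /= /update /= sub0r.
- move=> c s cl fs sc Ic.
  have es : env U epsilon gamma s by apply: env_frame fs _ => //; apply: env_frame f0 es0.
  have st : stores s l by apply: stores_frame fs _ => //; apply: stores_frame f0 st0.
  have [_ _ /(_ c cl) [so _ sr]] := st.
  rewrite wpSeq; apply: (wp_round_labels es sc so sr) => s1 L f1 rL s1L.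
  have es1 : env U epsilon gamma s1 by apply: env_frame f1 es.
  rewrite wpSeq; apply: (wp_evaluate es1 s1L) => s2 f2 s2x.
  have s2b : reals s2 14 0 = reals s 14 0 by rewrite f2.2 // f1.2.
  have s2L (u : 'I_n) : ints s2 31 u = L u by rewrite f2.1.
  have s2o (u : 'I_n) : ints s2 3 u = ints s 3 u by rewrite f2.1 // f1.1.
  have es2 : env U epsilon gamma s2 by apply: env_frame f2 es1.
  rewrite wpIf wpSeq wpR wpSkip [beval _ _]/= s2x s2b.
  case: ltP => cmp.
    apply: (@wp_For _ _ _ _ _ n (fun v s => forall u : 'I_n, (u < v)%N -> ints s 3 u = L u)) => //.
    + by rewrite /=; apply: env_n es2.
    + move=> v s3 vn f3 s3v h; rewrite wpI => u; rewrite ltnS leq_eqVlt /= /update /= s3v.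
      case/orP=> [/eqP uv|uv].
        have {uv}-> : u = Ordinal vn by apply: val_inj.
        by rewrite eqxx (f3.1 31 isT) -s2L.
      have -> : (nat_of_ord u == v) = false by lia.
      by apply: h.
    move=> s3 f3 h; right; exists L; split=> [u||c'].
    + exact: h.
    + by rewrite /= (f3.2 14 isT) /= /update /= s2x.
    rewrite ltnS leq_eqVlt => /orP[/eqP->|c'c]; first by exists L.
    case: Ic cmp c'c => [[-> _]//|[Lb [_ -> h']]] cmp /h' [L' r' le'].
    by exists L' => //; apply: le_trans le' (ltW cmp).
  case: Ic cmp => [[_ ->]|[Lb [h1 hb h2]]] cmp.
    by have := le_trans (score_ge0 L) cmp; rewrite oppr_ge0 ler10.
  right; exists Lb; split=> [u||c'].
  + by rewrite /= /update /= s2o.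
  + by rewrite /= s2b hb.
  rewrite ltnS leq_eqVlt => /orP[/eqP->|/h2//].
  by exists L; rewrite // -hb.
- move=> s fs; case=> [[l00]|[Lb [h1 _ h2]]]; first by rewrite l00 in l0.
  exact: (post s Lb).
Qed.

End Selection.

(** * Spectral theorem *)

Section Spectral.
Variable R : realType.
Local Notation C := (complex R).

Lemma Re_mulmx n (y : 'rV[C]_n) (A : 'M[R]_n) :
  map_mx (@complex.Re R) (y *m map_mx (real_complex R) A) =
  map_mx (@complex.Re R) y *m A.
Proof.
apply/rowP => j; rewrite !mxE (big_morph (@complex.Re R) (id1 := 0) (op1 := +%R)) //.
  by apply: eq_bigr => i _; rewrite !mxE; case: (y 0 i) => a b /=; rewrite mulr0 subr0.
by case=> a b [].
Qed.

Lemma Im_mulmx n (y : 'rV[C]_n) (A : 'M[R]_n) :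
  map_mx (@complex.Im R) (y *m map_mx (real_complex R) A) =
  map_mx (@complex.Im R) y *m A.
Proof.
apply/rowP => j; rewrite !mxE (big_morph (@complex.Im R) (id1 := 0) (op1 := +%R)) //.
  by apply: eq_bigr => i _; rewrite !mxE; case: (y 0 i) => a b /=; rewrite mulr0 add0r.
by case=> a b [].
Qed.

(* The real and imaginary parts of a complex eigenvector are eigenvectors once
   the eigenvalue is known to be real. *)
Lemma symmetric_eigenvector N (S E : 'M[R]_N) : S^T = S -> projection E ->
  E *m S = S *m E -> E != 0 ->
  exists (v : 'rV[R]_N) (a : R), [/\ v != 0, v *m E = v & v *m S = a *: v].
Proof.
move=> Ssym [Esym EE] comm E0.
have sub : (row_base E <= E)%MS by rewrite eq_row_base.
have sup m (X : 'M[R]_(m, N)) : (X *m E <= row_base E)%MS by rewrite eq_row_base submxMl.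
move: (row_base E) (row_base_free E) sub sup => Q free sub sup.
have QE : Q *m E = Q by case/submxP: sub => X ->; rewrite -mulmxA EE.
(* [S1] is the matrix of [S] on the range of [E] in the basis [Q]; this range is preserved because
   [S] commutes with [E]. *)
have /submxP[S1 QS] : (Q *m S <= Q)%MS by rewrite -{1}QE -mulmxA comm mulmxA; exact: sup.
have r0 : (0 < \rank E)%N by rewrite lt0n mxrank_eq0.
have [a /eigenvalueP[y yS y0]] := eigenvalue_closed (map_mx (real_complex R) S1) r0.
case: a yS => al be yS.
pose p := map_mx (@complex.Re R) y *m Q; pose q := map_mx (@complex.Im R) y *m Q.
have pS : p *m S = al *: p - be *: q.
  rewrite {1}/p -mulmxA QS mulmxA -Re_mulmx yS /p /q.
  rewrite !scalemxAl -mulmxBl; congr (_ *m _).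
  by apply/rowP => j; rewrite !mxE; case: (y 0 j) => u v.
have qS : q *m S = al *: q + be *: p.
  rewrite {1}/q -mulmxA QS mulmxA -Im_mulmx yS /p /q.
  rewrite !scalemxAl -mulmxDl; congr (_ *m _).
  by apply/rowP => j; rewrite !mxE; case: (y 0 j) => u v.
have pq0 : 0 < norm2 p + norm2 q.
  rewrite lt_def addr_ge0 ?norm2_ge0 // andbT.
  apply: contraNneq y0 => /eqP.
  rewrite paddr_eq0 ?norm2_ge0 // !norm2_eq0 => /andP[/eqP p0 /eqP q0].
  have /(row_free_inj free) yr : map_mx (@complex.Re R) y *m Q = 0 *m Q.
    by rewrite mul0mx.
  have /(row_free_inj free) yi : map_mx (@complex.Im R) y *m Q = 0 *m Q.
    by rewrite mul0mx.
  apply/eqP/rowP => j; rewrite mxE.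
  have := congr1 (fun M : 'rV_(\rank E) => M 0 j) yr.
  have := congr1 (fun M : 'rV_(\rank E) => M 0 j) yi.
  by rewrite !mxE; case: (y 0 j) => u v /= -> ->.
(* By symmetry [dot (p *m S) q = dot p (q *m S)]; the terms in [al] cancel and
   [be * (norm2 p + norm2 q) = 0] remains. *)
have be0 : be = 0.
  have := dot_mulmx p q S; rewrite Ssym pS qS dotBl dotDr !dotZl !dotZr => h.
  have /eqP : be * (norm2 p + norm2 q) = 0.
    by rewrite mulrDr /norm2; lra.
  by rewrite mulf_eq0 (gt_eqF pq0) orbF => /eqP.
rewrite be0 !scale0r subr0 addr0 in pS qS.
have [p0|p0] := eqVneq p 0; last by exists p, al; rewrite /p -mulmxA QE.
exists q, al; rewrite /q -mulmxA QE; split=> //.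
by move: pq0; rewrite p0 /norm2 dot0l add0r -/(norm2 q) norm2_gt0.
Qed.

(** Eigenvectors are collected one at a time: the orthogonal complement of those already found is
    preserved by [S] and, by rank, nonzero as long as fewer than [N] are present. *)
Lemma spectral_prefix N (S : 'M[R]_N) l : S^T = S -> (l <= N)%N ->
  exists (P : 'M[R]_(l, N)) (lam : 'rV[R]_l),
    P *m P^T = 1%:M /\ P *m S = diag_mx lam *m P.
Proof.
move=> Ssym; elim: l => [|l IH] lN.
  by exists 0, 0; split; apply/matrixP => -[].
have [P [lam [PP PS]]] := IH (ltnW lN).
pose E := 1%:M - P^T *m P.
have PTS : S *m P^T = P^T *m diag_mx lam.
  by apply: trmx_inj; rewrite !trmx_mul trmxK Ssym PS tr_diag_mx.
have projE : projection E.
  split; first by rewrite /E linearB /= trmx1 trmx_mul trmxK.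
  rewrite /E mulmxBr mulmx1 mulmxBl mul1mx mulmxA -(mulmxA P^T P) PP mulmx1.
  by rewrite subrr subr0.
have comm : E *m S = S *m E.
  by rewrite /E mulmxBl mulmxBr mul1mx mulmx1 -mulmxA PS mulmxA -PTS mulmxA.
have E0 : E != 0.
  apply: contraTneq lN => /eqP; rewrite subr_eq0 => /eqP e.
  have := mxrank1 R N; rewrite e => <-.
  by rewrite -leqNgt (leq_trans (mxrankM_maxr _ _)) // rank_leq_row.
have [v [a [v0 vE vS]]] := symmetric_eigenvector Ssym projE comm E0.
have vP : v *m P^T = 0.
  rewrite -vE -mulmxA /E mulmxBl mul1mx -[P^T *m P *m _]mulmxA PP mulmx1.
  by rewrite subrr mulmx0.
pose c := (Num.sqrt (norm2 v))^-1.
have cv : (c *: v) *m (c *: v)^T = 1%:M.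
  apply/matrixP => i j; rewrite !ord1 -dotE -/(norm2 _) norm2Z mxE /c exprVn.
  by rewrite sqr_sqrtr ?norm2_ge0 // mulVf // norm2_eq0.
pose P1 : 'M_(1 + l, N) := col_mx (c *: v) P.
pose lam1 : 'rV_(1 + l) := row_mx (a%:M : 'rV_1) lam.
have P1P1 : P1 *m P1^T = 1%:M.
  rewrite /P1 tr_col_mx mul_col_row cv PP -scalemxAl vP scaler0.
  have -> : P *m (c *: v)^T = 0.
    by apply: trmx_inj; rewrite trmx_mul trmxK -scalemxAl vP scaler0 trmx0.
  exact/esym/scalar_mx_block.
have P1S : P1 *m S = diag_mx lam1 *m P1.
  rewrite /P1 /lam1 diag_mx_row mul_col_mx mul_block_col !mul0mx addr0 add0r PS.
  congr col_mx; rewrite -scalemxAl vS.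
  have -> : diag_mx (a%:M : 'rV_1) = a%:M.
    by apply/matrixP => i j; rewrite !ord1 !mxE.
  by rewrite mul_scalar_mx !scalerA mulrC.
by exists P1, lam1.
Qed.

Lemma spectral_theorem N (S : 'M[R]_N) : S^T = S ->
  exists (P : 'M[R]_N) (lam : 'rV[R]_N),
    P *m P^T = 1%:M /\ P *m S = diag_mx lam *m P.
Proof. by move=> Ssym; apply: spectral_prefix. Qed.

End Spectral.

(** * Analysis of the pivots *)

Section PivotTheory.
Variables (R : realType) (N : nat).
Implicit Types (u v w : 'rV[R]_N) (E G : 'M[R]_N) (bs : seq 'rV[R]_N).

Definition line u : 'M[R]_N := (norm2 u)^-1 *: (u^T *m u).

Lemma mulmx_line v u : v *m line u = (dot v u / norm2 u) *: u.
Proof.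
rewrite /line -scalemxAr mulmxA [v *m u^T]mx11_scalar -dotE mul_scalar_mx scalerA.
by rewrite mulrC.
Qed.

Lemma mulmx_deflate v E u : v *m deflate E u = v *m E - (dot v u / norm2 u) *: u.
Proof. by rewrite /deflate mulmxBr -/(line u) mulmx_line. Qed.

Lemma mxtrace_line u : u != 0 -> \tr (line u) = 1.
Proof.
move=> u0; rewrite /line mxtraceZ mxtrace_mulC trace_mx11 -dotE -/(norm2 u).
by rewrite mulVf // norm2_eq0.
Qed.

Lemma norm2_projection v E : projection E -> norm2 (v *m E) = dot v (v *m E).
Proof. by move=> [Es EE]; rewrite /norm2 dot_mulmx Es -mulmxA EE. Qed.

Lemma norm2_pythagoras v E : projection E ->
  norm2 v = norm2 (v *m E) + norm2 (v - v *m E).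
Proof.
move=> pE; rewrite /norm2 dotBl !dotBr -!/(norm2 _) norm2_projection //.
rewrite (dotC (v *m E) v); ring.
Qed.

Lemma norm2_projection_le v E : projection E -> norm2 (v *m E) <= norm2 v.
Proof. by move=> pE; rewrite (norm2_pythagoras v pE) lerDl norm2_ge0. Qed.

Lemma projection_deflate E u : projection E -> u != 0 -> u *m E = u ->
  projection (deflate E u).
Proof.
move=> [Es EE] u0 uE; rewrite /deflate -/(line u).
have ls : (line u)^T = line u by rewrite /line linearZ /= trmx_mul trmxK.
have lE : line u *m E = line u by rewrite /line -scalemxAl -mulmxA uE.
have El : E *m line u = line u.
  by apply: trmx_inj; rewrite trmx_mul ls Es lE.
have ll : line u *m line u = line u.
  rewrite {1}/line -scalemxAl -mulmxA mulmx_line -/(norm2 u) divff ?norm2_eq0 //.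
  by rewrite scale1r.
split; first by rewrite linearB /= Es ls.
by rewrite mulmxBr !mulmxBl EE lE El ll subrr subr0.
Qed.

Variables (G : 'M[R]_N) (th : R) (E0 : 'M[R]_N).
Hypotheses (th0 : 0 <= th) (pE0 : projection E0).

Lemma pivot_row_facts E p q b : projection E ->
  th < norm2 (row p (G *m E)) -> b = 2 ^+ q *: row p (G *m E) ->
  b != 0 /\ b *m E = b.
Proof.
move=> [_ EE] lt ->; split.
  have y0 : 0 < norm2 (row p (G *m E)) by apply: le_lt_trans lt.
  by rewrite scaler_eq0 negb_or expf_eq0 pnatr_eq0 andbF -norm2_gt0.
by rewrite -scalemxAl -row_mul -mulmxA EE.
Qed.

Lemma pivots_projection bs E : pivots G th E0 bs E -> projection E.
Proof.
elim=> // {}bs {}E p q b _ pE lt _ bE _ _.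
have [b0 bEb] := pivot_row_facts pE lt bE; exact: projection_deflate.
Qed.

Lemma pivots_trace bs E : pivots G th E0 bs E -> \tr E = \tr E0 - (size bs)%:R.
Proof.
elim=> [|{}bs {}E p q b pv IH lt _ bE _ _]; first by rewrite subr0.
have [b0 bEb] := pivot_row_facts (pivots_projection pv) lt bE.
rewrite /deflate -/(line b) linearB /= mxtrace_line // IH size_rcons -natr1; ring.
Qed.

Lemma pivots_decomposition bs E : pivots G th E0 bs E ->
  E0 = E + \sum_(b <- bs) line b.
Proof.
elim=> [|{}bs {}E p q b pv IH lt _ bE _ _]; first by rewrite big_nil addr0.
by rewrite IH -cats1 big_cat big_seq1 /= /deflate -/(line b) (addrC _ (line b)) addrA addrNK.
Qed.

(** That the current [E] annihilates all earlier pivots is what makes the next one, lying in the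
    range of [E], orthogonal to them. *)
Lemma pivots_orthogonal bs E : pivots G th E0 bs E ->
  {in bs, forall b, b != 0 /\ b *m E = 0} /\
  pairwise (fun u v => dot u v == 0) bs.
Proof.
elim=> // {}bs {}E p q b pv [IH1 IH2] lt _ bE _ _.
have [b0 bEb] := pivot_row_facts (pivots_projection pv) lt bE.
have ortho c : c \in bs -> dot c b = 0.
  move=> /IH1 [_ cE]; have [Es _] := pivots_projection pv.
  by rewrite -bEb dotC dot_mulmx Es cE dotC dot0l.
split=> [c|]; last first.
  rewrite pairwise_rcons IH2 andbT; apply/allP => c /ortho ->; exact: eqxx.
rewrite mem_rcons inE => /orP[/eqP->|cbs].
  by split=> //; rewrite mulmx_deflate bEb -/(norm2 b) divff ?norm2_eq0 // scale1r subrr.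
have [c0 cE] := IH1 c cbs; split=> //.
by rewrite mulmx_deflate cE ortho // mul0r scale0r subrr.
Qed.



(* Because of the choice of the pivot, the coefficients of the row operations
   are at most 1, so the rows at most double. *)
Lemma pivots_growth bs E x kappa : 0 <= kappa ->
  pivots G th E0 bs E ->
  (forall i, `|dot x (row i (G *m E0))| <= kappa) ->
  (forall i, `|dot x (row i (G *m E))| <= 2 ^+ size bs * kappa) /\
  th * (\sum_(b <- bs) dot x b ^+ 2 / norm2 b) <= 4 ^+ size bs * kappa ^+ 2.
Proof.
move=> k0 pv x0; elim: pv => [|{}bs {}E p q b pv [IH1 IH2] lt pmax bE _ _].
  by rewrite big_nil mulr0 expr0 !mul1r sqr_ge0.
have [b0 bEb] := pivot_row_facts (pivots_projection pv) lt bE.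
set y := row p (G *m E) in lt pmax bE.
have y0 : 0 < norm2 y by apply: le_lt_trans lt.
have q0 : 2 ^+ q != 0 :> R by rewrite expf_eq0 pnatr_eq0 andbF.
(* Doubling does not change the line removed, so the argument can use the undoubled row [y]. *)
have lineE : line b = line y.
  rewrite bE /line norm2Z [(_ *: _)^T]linearZ /= -scalemxAl -scalemxAr !scalerA.
  congr (_ *: _); move: (2 ^+ q) q0 => c c0; field.
  by rewrite c0 gt_eqF.
have coef v : dot v b / norm2 b *: b = dot v y / norm2 y *: y.
  by rewrite -!mulmx_line lineE.
have rowE i : row i (G *m deflate E b) =
    row i (G *m E) - (dot (row i (G *m E)) y / norm2 y) *: y.
  have [_ EE] := pivots_projection pv.
  have dE : deflate E b = E *m deflate E b.
    rewrite /deflate mulmxBr EE -scalemxAr mulmxA; congr (_ - _ *: (_ *m _)).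
    have [Es _] := pivots_projection pv.
    by apply: trmx_inj; rewrite trmx_mul trmxK Es bEb.
  rewrite dE mulmxA row_mul mulmx_deflate coef -row_mul -mulmxA EE //.
rewrite size_rcons; split=> [i|].
  rewrite rowE dotBr dotZr; apply: le_trans (ler_normB _ _) _.
  (* Cauchy-Schwarz, together with the choice of [y] as a longest row. *)
  have c1 : `|dot (row i (G *m E)) y / norm2 y| <= 1.
    rewrite normrM normfV (gtr0_norm y0) ler_pdivrMr // mul1r.
    rewrite -(@ler_pXn2r _ 2) ?nnegrE ?normr_ge0 ?norm2_ge0 // real_normK ?num_real //.
    apply: le_trans (cauchy_schwarz _ _) _; rewrite [leRHS]expr2.
    by rewrite ler_pM2r // pmax.
  rewrite normrM exprS -mulrA mulr_natl mulr2n lerD ?IH1 //.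
  rewrite -[leRHS]mul1r ler_pM ?normr_ge0 //; exact: IH1.
rewrite -cats1 big_cat big_seq1 /= mulrDr.
have step : th * (dot x b ^+ 2 / norm2 b) <= 4 ^+ size bs * kappa ^+ 2.
  have -> : dot x b ^+ 2 / norm2 b = dot x y ^+ 2 / norm2 y.
    rewrite bE dotZr norm2Z; move: (2 ^+ q) q0 => c c0; field.
    by rewrite c0 gt_eqF.
  have sq : dot x y ^+ 2 <= 4 ^+ size bs * kappa ^+ 2.
    have -> : 4 ^+ size bs * kappa ^+ 2 = (2 ^+ size bs * kappa) ^+ 2 :> R.
      rewrite exprMn; congr (_ * _); rewrite -exprM mulnC exprM.
      by congr (_ ^+ _); ring.
    rewrite -[leLHS]real_normK ?num_real //.
    by rewrite ler_pXn2r ?nnegrE ?normr_ge0 ?mulr_ge0 ?exprn_ge0 //; apply: IH1.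
  apply: le_trans sq; rewrite mulrCA ler_piMr ?sqr_ge0 //.
  by rewrite ler_pdivrMr // mul1r ltW.
apply: le_trans (lerD IH2 step) _.
rewrite (exprS 4) -[leRHS]mulrA; have : 0 <= 4 ^+ size bs * kappa ^+ 2 :> R.
  by rewrite mulr_ge0 ?sqr_ge0 // exprn_ge0.
lra.
Qed.

End PivotTheory.

(** * Powers of a symmetric matrix in its eigenbasis *)

Section LowSpace.
Variables (R : realType) (N : nat) (B P : 'M[R]_N) (mu : 'rV[R]_N).
Hypotheses (PP : P *m P^T = 1%:M) (PB : P *m B = diag_mx mu *m P).
Implicit Types (v x : 'rV[R]_N) (E X : 'M[R]_N).

Lemma row_eigen i : row i P *m B = mu 0 i *: row i P.
Proof. by rewrite -row_mul PB row_mul row_diag_mx -scalemxAl -rowE. Qed.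

Lemma row_eigenX i m : row i P *m (B ^+ m) = mu 0 i ^+ m *: row i P.
Proof.
elim: m => [|m IH]; first by rewrite !expr0 scale1r mulmx1.
by rewrite exprSr -mulmxE mulmxA IH -scalemxAl row_eigen scalerA -exprSr.
Qed.

Lemma symmetricX m : B^T = B -> (B ^+ m)^T = B ^+ m.
Proof.
move=> Bs; elim: m => [|m IH]; first by rewrite !expr0 trmx1.
by rewrite {1}exprSr exprS -!mulmxE trmx_mul IH Bs.
Qed.

Lemma sum_row_norm2 X : \sum_i norm2 (row i X) = \tr (X *m X^T).
Proof.
by apply: eq_bigr => i _; rewrite mxE; apply: eq_bigr => j _; rewrite !mxE.
Qed.

Lemma norm2_coord v : norm2 v = \sum_i dot v (row i P) ^+ 2.
Proof.
have -> : norm2 v = norm2 (v *m P^T).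
  by rewrite /norm2 dot_mulmx trmxK -mulmxA (mulmx1C PP) mulmx1.
by apply: eq_bigr => i _; rewrite expr2 row_mulE.
Qed.

Lemma sum_row_norm2_basis X : \sum_i norm2 (row i P *m X) = \sum_i norm2 (row i X).
Proof.
transitivity (\sum_i norm2 (row i (P *m X))).
  by apply: eq_bigr => i _; rewrite row_mul.
rewrite !sum_row_norm2 trmx_mul mxtrace_mulC -!mulmxA (mulmxA P^T).
by rewrite (mulmx1C PP) mul1mx mxtrace_mulC.
Qed.

Lemma dot_basis i j : dot (row i P) (row j P) = (i == j)%:R.
Proof.
have := congr1 (fun X : 'M_N => X i j) PP; rewrite !mxE => <-.
by apply: eq_bigr => l _; rewrite !mxE.
Qed.

Lemma norm2_row_basis i : norm2 (row i P) = 1.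
Proof. by rewrite /norm2 dot_basis eqxx. Qed.

Lemma projection_trace E : projection E -> \tr E = \sum_i norm2 (row i E).
Proof. by move=> [Es EE]; rewrite sum_row_norm2 Es EE. Qed.

(* The rows of [B ^+ m *m E] are short, but [B ^+ m] stretches the
   eigenvectors of eigenvalue at least 2 by [2 ^+ m]. *)
Lemma trace_le_low_dim m E : projection E ->
  (forall i, norm2 (row i ((B ^+ m) *m E)) <= 1) ->
  \tr E <= #|[set i | mu 0 i < 2]|%:R + N%:R / 4 ^+ m.
Proof.
move=> pE short.
rewrite projection_trace // -sum_row_norm2_basis.
rewrite (bigID (fun i => mu 0 i < 2)) /=; apply: lerD.
  rewrite -sum1_card natr_sum; under [leRHS]eq_bigl do rewrite inE.
  apply: ler_sum => i _; rewrite -(norm2_row_basis i).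
  exact: norm2_projection_le.
rewrite ler_pdivlMr ?exprn_gt0 //.
have -> : N%:R = \sum_(i < N) 1 :> R by rewrite sumr_const card_ord.
apply: le_trans (ler_sum _ (fun i _ => short i)).
rewrite -sum_row_norm2_basis mulr_suml [leRHS](bigID (fun i => mu 0 i < 2)) /=.
apply: ler_wpDl; first by apply: sumr_ge0 => i _; apply: norm2_ge0.
apply: ler_sum => i; rewrite -leNgt => le2.
rewrite mulmxA row_eigenX -scalemxAl norm2Z mulrC ler_wpM2r ?norm2_ge0 //.
rewrite -exprM mulnC exprM; apply: lerXn2r; rewrite ?nnegrE ?sqr_ge0 //.
by rewrite expr2; nra.
Qed.

(** For [B = (2 / gamma) (I - M / d)] the bound 1/2 corresponds to [gamma / 4] for [I - M / d]. *)
Definition low_part x := \sum_(i | mu 0 i < 1 / 2) dot x (row i P) *: row i P.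

Lemma dot_low_part x j :
  dot (low_part x) (row j P) = if mu 0 j < 1 / 2 then dot x (row j P) else 0.
Proof.
rewrite dot_suml; case: ifP => low.
  rewrite (bigD1 j) //= dotZl dot_basis eqxx mulr1 big1 ?addr0 // => i /andP[_ ij].
  by rewrite dotZl dot_basis (negbTE ij) mulr0.
rewrite big1 // => i lowi; rewrite dotZl dot_basis.
by case: eqP lowi => [->|_ _]; rewrite ?low // mulr0.
Qed.

Lemma dot_mulmx_basis v i : B^T = B -> dot (v *m B) (row i P) = mu 0 i * dot v (row i P).
Proof. by move=> Bs; rewrite dot_mulmx Bs row_eigen dotZr. Qed.

Lemma dot_coord u v : dot u v = \sum_i dot u (row i P) * dot v (row i P).
Proof.
have -> : dot u v = dot (u *m P^T) (v *m P^T).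
  by rewrite dot_mulmx trmxK -mulmxA (mulmx1C PP) mulmx1.
by apply: eq_bigr => i _; rewrite -!row_mulE.
Qed.

(** Markov's inequality in the eigenbasis: a coordinate outside the low part has eigenvalue at least
    1/2, so its square is at most twice its share of the energy. *)
Lemma norm2_sub_low_part x : B^T = B -> (forall i, 0 <= mu 0 i) ->
  norm2 (x - low_part x) <= 2 * dot (x *m B) x.
Proof.
move=> Bs mu0; rewrite norm2_coord dot_coord mulr_sumr; apply: ler_sum => i _.
rewrite dotBl dot_low_part dot_mulmx_basis //.
have := mu0 i; have := sqr_ge0 (dot x (row i P)).
case: ltP => h; set c := dot _ _; set e := mu 0 i in h *.
  rewrite subrr expr0n /= => c2 e0.
  by rewrite -!mulrA mulr_ge0 // mulr_ge0 // -expr2.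
rewrite subr0 => c2 e0.
have : 0 <= (e - 1 / 2) * c ^+ 2 by rewrite mulr_ge0 // subr_ge0.
rewrite expr2; nra.
Qed.

(** The left side is the square of one entry of [low_part x *m B ^+ m], and every eigencoordinate of
    the low part shrinks at least by the factor [2 ^ m]. *)
Lemma low_part_power x m i : B^T = B -> (forall i, 0 <= mu 0 i) ->
  dot (low_part x) (row i (B ^+ m)) ^+ 2 <= norm2 x / 4 ^+ m.
Proof.
move=> Bs mu0; rewrite row_mulE symmetricX //.
set v := low_part x *m _.
apply: (@le_trans _ _ (norm2 v)).
  rewrite /norm2 /dot (bigD1 i) //= expr2 lerDl sumr_ge0 // => j _.
  by rewrite -expr2 sqr_ge0.
rewrite !norm2_coord mulr_suml; apply: ler_sum => j _.
rewrite /v dot_mulmx symmetricX // row_eigenX dotZr dot_low_part.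
case: ltP => h; last by rewrite mulr0 expr0n /= mulr_ge0 ?sqr_ge0 // invr_ge0 exprn_ge0.
rewrite exprMn mulrC ler_wpM2l ?sqr_ge0 // -exprM mulnC exprM -exprVn.
have := mu0 j; set e := mu 0 j in h * => e0.
apply: lerXn2r; rewrite ?nnegrE ?sqr_ge0 ?invr_ge0 //.
rewrite expr2; have : 4^-1 = 1 / 2 * (1 / 2) :> R by field.
nra.
Qed.

Lemma low_part_norm2 x : norm2 (low_part x) <= norm2 x.
Proof.
rewrite !norm2_coord; apply: ler_sum => j _; rewrite dot_low_part.
by case: ifP => // _; rewrite expr0n sqr_ge0.
Qed.

End LowSpace.

Section FinalPivots.
Variables (R : realType) (N : nat) (E1 : 'M[R]_N).
Hypothesis pE1 : projection E1.

Lemma projection_trace_le : \tr E1 <= N%:R.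
Proof.
rewrite projection_trace //.
have -> : N%:R = \sum_(i < N) 1 :> R by rewrite sumr_const card_ord.
apply: ler_sum => i _; rewrite rowE; apply: le_trans (norm2_projection_le _ pE1) _.
rewrite /norm2 /dot (bigD1 i) //= big1 => [|j ji]; last by rewrite mxE (negbTE ji) andbF mul0r.
by rewrite mxE !eqxx mulr1 addr0.
Qed.

(** Every pivot takes 1 from a trace of at most [N], so [N] pivots exhaust it; and a projection of
    trace 0 vanishes, its trace being the sum of its squared row lengths. *)
Lemma last_projection_eq0 G th bs E : 0 <= th ->
  pivots G th E1 bs E -> size bs = N \/ (forall i, norm2 (row i E) <= 0) -> E = 0.
Proof.
move=> th0 pv h; have pE := pivots_projection th0 pE1 pv.
have tr0 : \sum_i norm2 (row i E) <= 0.
  case: h => [szN|h]; last by apply: sumr_le0.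
  rewrite -projection_trace // (pivots_trace th0 pE1 pv) szN subr_le0.
  exact: projection_trace_le.
have /eqP : \sum_i norm2 (row i E) = 0.
  by apply/eqP; rewrite eq_le tr0 sumr_ge0 // => i _; apply: norm2_ge0.
rewrite psumr_eq0 => [/allP r0|i _]; last exact: norm2_ge0.
apply/row_matrixP => i; rewrite row0; apply/eqP; rewrite -norm2_eq0.
by have := r0 i (mem_index_enum i).
Qed.

(** An entry of the longest row [y] of a projection is the inner product of [y] with a row no longer
    than [y]. Summing the squares gives [norm2 y <= N * norm2 y ^ 2], so [norm2 y] is at least
    [1 / N], and [N] doublings suffice because [N <= 4 ^ N]. *)
Lemma pivots_normalized bs E : pivots 1%:M 0 E1 bs E ->
  {in bs, forall b, 1 <= norm2 b <= 4}.
Proof.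
elim=> // {}bs {}E p q b pv IH lt pmax bE q4 q1 c.
rewrite mem_rcons inE => /orP[/eqP-> {c}|]; last exact: IH.
have pE := pivots_projection (lexx 0) pE1 pv.
rewrite mul1mx in lt pmax bE; set y := row p E in lt pmax bE.
have pmaxE r : norm2 (row r E) <= norm2 y by exact: pmax.
apply/andP; split.
  case: q1 => // qN; rewrite bE norm2Z qN.
  have yE i : y 0 i ^+ 2 <= norm2 y * norm2 y.
    have -> : y 0 i = dot y (row i E).
      by rewrite row_mulE pE.1 /y -row_mul pE.2.
    apply: le_trans (cauchy_schwarz _ _) _.
    by rewrite ler_wpM2l ?norm2_ge0 // pmaxE.
  have yN : 1 <= N%:R * norm2 y.
    have : norm2 y <= N%:R * norm2 y * norm2 y.
      have -> : N%:R * norm2 y * norm2 y = \sum_(i < N) norm2 y * norm2 y.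
        by rewrite sumr_const card_ord -mulrA mulr_natl.
      by rewrite {1}/norm2 /dot; apply: ler_sum => i _; rewrite -expr2.
    by rewrite -{1}[norm2 y]mul1r ler_pM2r.
  apply: le_trans yN _; rewrite ler_wpM2r ?norm2_ge0 // -exprM -natrX ler_nat.
  by apply: ltnW; apply: leq_trans (ltn_expl N (ltnSn 1)) _; rewrite leq_exp2l // leq_pmulr.
(* Without doubling, [b] is a row of a projection, hence of length at most 1. *)
case: q4 => [q0|/ltW//]; rewrite bE q0 expr0 scale1r /y rowE.
apply: le_trans (norm2_projection_le _ pE) _.
rewrite /norm2 /dot (bigD1 p) //= big1 => [|j jp]; last by rewrite mxE (negbTE jp) andbF mul0r.
by rewrite mxE !eqxx mulr1 addr0 ler1n.
Qed.

End FinalPivots.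

(** * Approximation by the enumerated candidates *)

Section CandidateReach.
Variables (R : realType) (N : nat) (b : nat -> 'rV[R]_N).

Lemma mem_next_round L x : x \in L ->
  [/\ cand_next x \in next_round b L, cand_add b x \in next_round b L
    & cand_sub b x \in next_round b L].
Proof.
move=> xL; rewrite /next_round !mem_cat; split.
- by rewrite map_f.
- apply/orP; right; apply/flattenP; exists [:: cand_add b x; cand_sub b x].
    exact: map_f.
  by rewrite mem_head.
- apply/orP; right; apply/flattenP; exists [:: cand_add b x; cand_sub b x].
    exact: map_f.
  by rewrite !inE eqxx orbT.
Qed.

Lemma candidates_steps t v j (e : bool) a : (v, j) \in candidates b t ->
  (v + (a%:R * (-1) ^+ e) *: b j, j) \in candidates b (t + a).
Proof.
move=> vj; elim: a => [|a IH]; first by rewrite mul0r scale0r addr0 addn0.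
rewrite addnS /candidates iterS -/(candidates b _).
have [_ add sub] := mem_next_round IH.
rewrite -natr1 mulrDl mul1r scalerDl addrA.
case: e IH add sub => IH add sub; rewrite ?expr1 ?expr0 ?scale1r ?scaleN1r.
  exact: sub.
exact: add.
Qed.

(** For each basis vector in turn, [a j] signed additions are followed by one advance of the
    pointer; this explains [(a j).+1]. *)
Lemma candidates_sum (a : nat -> nat) (e : nat -> bool) r :
  (\sum_(j < r) ((a j)%:R * (-1) ^+ (e j)) *: b j, r)
    \in candidates b (\sum_(j < r) (a j).+1).
Proof.
elim: r => [|r IH]; first by rewrite !big_ord0 mem_head.
rewrite !big_ord_recr /= addnS /candidates iterS -/(candidates b _).
by have [] := mem_next_round (candidates_steps (e r) (a r) IH).
Qed.

(** Surplus rounds are spent on advancing the pointer, which leaves the vector alone. *)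
Lemma candidates_le t t' v j : (t <= t')%N -> (v, j) \in candidates b t ->
  exists j', (v, j') \in candidates b t'.
Proof.
move=> le vj; rewrite -(subnK le); elim: (t' - t)%N => [|i [j' IH]].
  by exists j.
exists j'.+1; rewrite addSn /candidates iterS -/(candidates b _).
by have [] := mem_next_round IH.
Qed.

End CandidateReach.

Section GoodCandidate.
Variables (R : realType) (N : nat) (bs : seq 'rV[R]_N) (b : nat -> 'rV[R]_N).
Hypotheses (bE : forall j, (j < size bs)%N -> b j = bs`_j)
  (ortho : pairwise (fun u v => dot u v == 0) bs)
  (norm : {in bs, forall u, 1 <= norm2 u <= 4}).

Local Notation r := (size bs).

Lemma dot_b (i j : 'I_r) : i != j -> dot (b i) (b j) = 0.
Proof.
rewrite !bE // => ij; have [lt|lt|/val_inj e] := ltngtP i j; last by rewrite e eqxx in ij.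
  by apply/eqP; apply: (pairwiseP 0 ortho); rewrite ?inE.
by rewrite dotC; apply/eqP; apply: (pairwiseP 0 ortho); rewrite ?inE.
Qed.

Lemma norm_b (j : 'I_r) : 1 <= norm2 (b j) <= 4.
Proof. by rewrite bE // norm // mem_nth. Qed.

Lemma norm2_sum_b (c : 'I_r -> R) :
  norm2 (\sum_j c j *: b j) = \sum_j c j ^+ 2 * norm2 (b j).
Proof.
rewrite {1}/norm2 dot_suml; apply: eq_bigr => i _.
rewrite dot_sumr (bigD1 i) //= dotZl dotZr big1 ?addr0.
  by rewrite mulrA expr2.
by move=> j ji; rewrite dotZl dotZr dot_b 1?eq_sym // !mulr0.
Qed.

(* The step [s] is chosen so that truncating the coordinates costs at most
   [K / g], while the number of steps is at most [4 g (r + 1)]. *)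
Lemma good_candidate (w : 'rV[R]_N) (K : R) (g : nat) :
  0 < K -> (0 < g)%N -> norm2 w <= K ->
  norm2 (w *m \sum_(u <- bs) line u) <= norm2 w ->
  exists v j s, [/\ (v, j) \in candidates b ((4 * g + 1) * r.+1), 0 < s &
    norm2 (w *m (\sum_(u <- bs) line u) - s *: v) <= K / g%:R].
Proof.
move=> K0 g0 wK; set W := w *m _ => Ww.
have g0R : 0 < g%:R :> R by rewrite ltr0n.
pose t (j : 'I_r) := dot w (b j) / norm2 (b j).
have WE : W = \sum_j t j *: b j.
  rewrite /W mulmx_sumr (big_nth 0) big_mkord; apply: eq_bigr => j _.
  by rewrite mulmx_line /t -bE.
(* This step balances two costs: the squared truncation error is at most [4 * s ^ 2 * r <= K / g],
   and the number of additions at most [K / s ^ 2 = 4 * g * r.+1]. Using [r.+1] avoids a division by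
   0 for an empty basis. *)
pose s := Num.sqrt (K / (4 * g%:R * r.+1%:R)).
have den0 : 0 < 4 * g%:R * r.+1%:R :> R by rewrite !mulr_gt0 // ltr0n.
have s0 : 0 < s by rewrite sqrtr_gt0 divr_gt0.
have s2 : s ^+ 2 = K / (4 * g%:R * r.+1%:R) by rewrite sqr_sqrtr // ltW // divr_gt0.
pose T j := if insub j is Some j' then t j' else 0.
have TE (j : 'I_r) : T j = t j by rewrite /T valK.
pose a j := Num.truncn (`|T j| / s); pose e j := T j < 0.
have aP j : (a j)%:R <= `|T j| / s < (a j).+1%:R.
  by apply: Num.Theory.truncn_itv; rewrite divr_ge0 // ltW.
have close (j : 'I_r) : `|t j - s * ((a j)%:R * (-1) ^+ (e j))| <= s.
  have -> : t j - s * ((a j)%:R * (-1) ^+ e j) = (-1) ^+ e j * (`|T j| - s * (a j)%:R).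
    rewrite mulrBr -TE -realEsign ?num_real //; ring.
  rewrite normrM normr_sign mul1r.
  have /andP[h1 h2] := aP j; rewrite ler_pdivlMr // in h1.
  rewrite ltr_pdivrMr // -natr1 in h2.
  by rewrite ger0_norm; lra.
(* A natural number is at most its square, which turns the number of additions into a squared norm;
   [1 <= norm2 (b j)] enters here. *)
have sum_a : (\sum_(j < r) a j <= 4 * g * r.+1)%N.
  rewrite -(ler_nat R) natr_sum.
  apply: (@le_trans _ _ (\sum_(j < r) t j ^+ 2 * norm2 (b j) / s ^+ 2)).
    apply: ler_sum => j _; have /andP[n1 _] := norm_b j.
    apply: (@le_trans _ _ ((a j)%:R ^+ 2)).
      by rewrite -natrX ler_nat; case: (a j) => // m; rewrite -mulnn leq_pmulr.
    apply: (@le_trans _ _ ((`|T j| / s) ^+ 2)).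
      by have /andP[h _] := aP j; rewrite lerXn2r ?nnegrE // divr_ge0 // ltW.
    rewrite expr_div_n real_normK ?num_real // TE ler_wpM2r ?invr_ge0 ?sqr_ge0 //.
    by rewrite ler_peMr // sqr_ge0.
  rewrite -mulr_suml -norm2_sum_b -WE ler_pdivrMr ?exprn_gt0 //.
  apply: le_trans Ww (le_trans wK _); rewrite s2 !natrM mulrCA divff ?mulr1 //.
  by rewrite gt_eqF.
have := candidates_sum b a e r; set v := \sum_(j < r) _ => vj.
have le : (\sum_(j < r) (a j).+1 <= (4 * g + 1) * r.+1)%N.
  under eq_bigr => j _ do rewrite -addn1.
  by rewrite big_split /= sum1_card card_ord mulnDl mul1n leq_add.
have [j' vj'] := candidates_le le vj.
exists v, j', s; split=> //.
have -> : W - s *: v = \sum_j (t j - s * ((a j)%:R * (-1) ^+ (e j))) *: b j.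
  rewrite WE /v scaler_sumr -sumrB; apply: eq_bigr => j _.
  by rewrite scalerA scalerBl.
rewrite norm2_sum_b.
apply: (@le_trans _ _ (\sum_(j < r) s ^+ 2 * 4)).
  apply: ler_sum => j _; have /andP[n0 n4] := norm_b j.
  apply: ler_pM; rewrite ?sqr_ge0 ?norm2_ge0 //.
  rewrite -[leLHS]real_normK ?num_real // lerXn2r ?nnegrE ?normr_ge0 // ltW //.
rewrite sumr_const card_ord s2 -[_ *+ r]mulr_natr.
have r1 : r%:R <= r.+1%:R :> R by rewrite ler_nat.
have r10 : 0 < r.+1%:R :> R by rewrite ltr0n.
move: (r.+1%:R) r1 r10 => p r1 r10.
have -> : K / (4 * g%:R * p) * 4 * r%:R = K / g%:R * (r%:R / p).
  by field; rewrite (gt_eqF r10) (gt_eqF g0R).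
by rewrite ler_piMr ?(divr_ge0 (ltW K0) (ltW g0R)) // ler_pdivrMr // mul1r.
Qed.

End GoodCandidate.

(** * Quadratic forms of a Unique Games instance *)

Section UniqueGameMath.
Variables (R : realType) (n k : nat) (U : unique_game R n k) (d : R).
Hypothesis reg : regular U d.

Local Notation N := (\sum_(u < n) k)%N.
Local Notation wt := (weight0 U).
Local Notation M := (label_extended U).
Implicit Types (L : 'I_n -> 'I_k) (x : 'rV[R]_N).

Definition rank_of (u : 'I_n) (a : 'I_k) : 'I_N := @tagnat.Rank n (fun=> k) u a.
Definition vertex_of (i : 'I_N) : 'I_n := tagnat.sig1 i.
Definition label_of (i : 'I_N) : 'I_k := tagnat.sig2 i.

Lemma vertex_rank u a : vertex_of (rank_of u a) = u.
Proof. exact: tagnat.Rank1K. Qed.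

Lemma label_rank u a : label_of (rank_of u a) = a.
Proof. by apply: val_inj; rewrite /label_of /rank_of tagnat.Rank2K. Qed.

Lemma sum_rank (F : 'I_N -> R) : \sum_i F i = \sum_u \sum_a F (rank_of u a).
Proof.
rewrite pair_big /= (reindex (fun p : 'I_n * 'I_k => rank_of p.1 p.2)) //.
exists (fun i => (vertex_of i, label_of i)) => [[u a] _|i _] /=.
  by rewrite vertex_rank label_rank.
exact: tagnat.sig2K.
Qed.

Lemma weight0C u v : wt u v = wt v u.
Proof.
rewrite /weight0 [ug_edge U v u]ug_edge_sym; case: ifP => // e; exact: ug_weight_sym.
Qed.

Lemma weight0_ge0 u v : 0 <= wt u v.
Proof. by rewrite /weight0; case: ifP => // /ug_weight_01 /andP[]. Qed.

Lemma weight0_diag u : wt u u = 0.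
Proof. by rewrite /weight0 ug_edge_irr. Qed.

Lemma sum_weight0 u : \sum_v wt u v = d.
Proof. by rewrite -(reg u) [RHS]big_mkcond. Qed.

Lemma label_extendedE i j :
  M i j = wt (vertex_of i) (vertex_of j) *
    (ug_perm U (vertex_of i) (vertex_of j) (label_of i) == label_of j)%:R.
Proof.
rewrite mxE /weight0 -/(vertex_of i) -/(vertex_of j); case: ifP => _; rewrite !mxE //.
by rewrite mul0r.
Qed.

Lemma label_extended_sym : M^T = M.
Proof.
apply/matrixP => i j; rewrite mxE !label_extendedE weight0C.
rewrite /weight0; case: ifP => [e|]; last by rewrite !mul0r.
congr (_ * _%:R); rewrite (ug_perm_inv e); congr nat_of_bool.
by apply/eqP/eqP => [<-|<-]; rewrite ?permK ?permKV.
Qed.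

Lemma dot_label_extended x y : dot (x *m M) y =
  \sum_u \sum_v wt u v *
    \sum_a x 0 (rank_of u a) * y 0 (rank_of v (ug_perm U u v a)).
Proof.
have -> : dot (x *m M) y = \sum_i \sum_j x 0 i * M i j * y 0 j.
  by rewrite exchange_big; apply: eq_bigr => j _; rewrite mxE mulr_suml.
rewrite sum_rank; apply: eq_bigr => u _.
under eq_bigr => a _ do rewrite sum_rank.
rewrite exchange_big; apply: eq_bigr => v _; rewrite mulr_sumr.
apply: eq_bigr => a _; rewrite (bigD1 (ug_perm U u v a)) //= [X in _ + X]big1 => [|b ne].
  by rewrite addr0 label_extendedE !vertex_rank !label_rank eqxx mulr1; ring.
rewrite label_extendedE !vertex_rank !label_rank eq_sym (negbTE ne).
by rewrite mulr0 mulr0 mul0r.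
Qed.

Lemma norm2_rank x : norm2 x = \sum_u \sum_a x 0 (rank_of u a) ^+ 2.
Proof. by rewrite /norm2 /dot sum_rank; do 2!(apply: eq_bigr => ? _). Qed.

(** Every product of two coordinates is at most half the sum of their squares, and by regularity
    each vertex collects the weight [d]. Hence [B] has no negative eigenvalue. *)
Lemma label_extended_le x : dot (x *m M) x <= d * norm2 x.
Proof.
rewrite dot_label_extended norm2_rank.
pose m u := \sum_a x 0 (rank_of u a) ^+ 2.
have dE : d * \sum_u m u = \sum_u \sum_v wt u v * ((m u + m v) / 2).
  transitivity (\sum_u (d * m u) / 2 + \sum_u (d * m u) / 2).
    by rewrite mulr_sumr -big_split /=; apply: eq_bigr => u _; field.
  under [RHS]eq_bigr => u _ do under eq_bigr => v _ do rewrite mulrDl mulrDr.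
  under [RHS]eq_bigr => u _ do rewrite big_split /=.
  rewrite big_split /=; congr (_ + _); last rewrite exchange_big /=;
    apply: eq_bigr => u _; rewrite -mulr_suml.
    by rewrite sum_weight0 mulrA.
  by under eq_bigr => v _ do rewrite weight0C; rewrite sum_weight0 mulrA.
rewrite dE; apply: ler_sum => u _; apply: ler_sum => v _.
apply: ler_wpM2l; first exact: weight0_ge0.
have -> : m v = \sum_a x 0 (rank_of v (ug_perm U u v a)) ^+ 2.
  by rewrite /m (reindex_inj (@perm_inj _ (ug_perm U u v))).
rewrite /m -big_split /= mulr_suml; apply: ler_sum => a _.
set p := x 0 _; set q := x 0 _; have := sqr_ge0 (p - q); rewrite !expr2; nra.
Qed.

Definition indicator L : 'rV[R]_N := \row_i (L (vertex_of i) == label_of i)%:R.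

Lemma indicator_rank L u a : indicator L 0 (rank_of u a) = (L u == a)%:R.
Proof. by rewrite mxE vertex_rank label_rank. Qed.

Lemma norm2_indicator L : norm2 (indicator L) = n%:R.
Proof.
rewrite norm2_rank -[n in RHS]card_ord -sumr_const; apply: eq_bigr => u _.
rewrite (bigD1 (L u)) //= indicator_rank eqxx expr1n [X in _ + X]big1 ?addr0 // => a ne.
by rewrite indicator_rank eq_sym (negbTE ne) expr0n.
Qed.

Lemma score_indicator L : dot (indicator L *m M) (indicator L) = score U L.
Proof.
rewrite dot_label_extended; apply: eq_bigr => u _; apply: eq_bigr => v _.
rewrite (bigD1 (L u)) //= [X in _ + X]big1 => [|a ne]; last first.
  by rewrite indicator_rank eq_sym (negbTE ne) mul0r.
rewrite addr0 !indicator_rank eqxx mul1r /weight0 /perm0.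
case: ifP => _; last by rewrite mul0r; case: ifP.
by rewrite val_eqE [L v == _]eq_sym; case: ifP => _; rewrite ?mulr1 ?mulr0.
Qed.

Lemma symmetric_sum (f : 'I_n -> 'I_n -> R) :
  (forall u v, f u v = f v u) -> (forall u, f u u = 0) ->
  \sum_u \sum_v f u v = 2 * \sum_(u < n) \sum_(v < n | (u < v)%N) f u v.
Proof.
move=> fC f0; rewrite mulr_natl mulr2n.
have {2}-> : \sum_(u < n) \sum_(v < n | (u < v)%N) f u v = \sum_(u < n) \sum_(v < n | (v < u)%N) f u v.
  rewrite (exchange_big_dep xpredT) //=; apply: eq_bigr => u _.
  by apply: eq_bigr => v _.
rewrite -big_split; apply: eq_bigr => u _ /=.
rewrite (bigID (fun v : 'I_n => (u < v)%N)) /=; congr (_ + _).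
rewrite (bigID (fun v : 'I_n => v == u)) /= big1 ?add0r => [|v /andP[_ /eqP->]] //.
by apply: eq_bigl => v; rewrite -leqNgt ltn_neqAle andbC.
Qed.

Lemma total_weightE : n%:R * d = 2 * total_weight U.
Proof.
have -> : n%:R * d = \sum_u \sum_v wt u v.
  under [RHS]eq_bigr => u _ do rewrite sum_weight0.
  by rewrite sumr_const card_ord mulr_natl.
rewrite symmetric_sum; [|exact: weight0C|exact: weight0_diag].
by congr (_ * _); apply: eq_bigr => u _; rewrite [RHS]big_mkcondr.
Qed.

Lemma satisfies_sym L u v : ug_edge U u v -> satisfies U L v u = satisfies U L u v.
Proof.
move=> e; rewrite /satisfies (ug_perm_inv e).
by apply/eqP/eqP => [<-|<-]; rewrite ?permK ?permKV.
Qed.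

Lemma scoreE L : score U L = 2 * satisfied_weight U L.
Proof.
pose f u v := if satisfies U L u v then wt u v else 0.
have -> : score U L = \sum_u \sum_v f u v.
  apply: eq_bigr => u _; apply: eq_bigr => v _; rewrite /f /satisfies /weight0 /perm0.
  by case: (ug_edge U u v); [rewrite val_eqE | rewrite !if_same].
rewrite symmetric_sum; first last.
- by move=> u; rewrite /f weight0_diag; case: ifP.
- move=> u v; rewrite /f [wt v u]weight0C /weight0.
  case e: (ug_edge U u v); last by rewrite !if_same.
  by rewrite (satisfies_sym L e).
congr (_ * _); apply: eq_bigr => u _; rewrite /f /weight0.
rewrite [LHS]big_mkcond [RHS]big_mkcond; apply: eq_bigr => v _.
by case: (u < v)%N => //=; case: (ug_edge U u v); case: (satisfies U L u v).
Qed.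

(* A vertex whose block is closer than 1/2 to the basis vector of its label is
   rounded to that label. *)
Lemma rounding_correct L L' x s u : 0 < s -> rounding x L' ->
  \sum_a ((indicator L - s *: x) 0 (rank_of u a)) ^+ 2 < 1 / 2 -> L' u = L u.
Proof.
move=> s0 rnd close; apply/eqP; apply: contraTT close => ne; rewrite -leNgt.
rewrite (bigD1 (L u)) //= (bigD1 (L' u)) //= addrA.
have entry a : (indicator L - s *: x) 0 (rank_of u a) =
    (L u == a)%:R - s * x 0 (rank_of u a).
  by rewrite -(indicator_rank L) !mxE.
rewrite !entry eqxx eq_sym (negbTE ne).
set p := x 0 (rank_of u (L u)); set q := x 0 (rank_of u (L' u)).
have pq : p <= q by apply: rnd.
apply: ler_wpDr; first by apply: sumr_ge0 => a _; apply: sqr_ge0.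
have sq : s * p <= s * q by rewrite ler_wpM2l // ltW.
rewrite /= sub0r sqrrN; move: (s * p) (s * q) sq => y z sq.
(* Twice [(1 - y) ^ 2 + z ^ 2] equals [(1 - y - z) ^ 2 + (1 - y + z) ^ 2], and the second square is
   at least 1 because [y <= z]. *)
have := sqr_ge0 (1 - y - z).
have : 0 <= (z - y) * (z - y + 2).
  by apply: mulr_ge0; lra.
rewrite !expr2; nra.
Qed.

(** A wrongly labeled vertex accounts for at least 1/2 of the squared distance, so there are at most
    [2 * K] of them; each spoils edges of weight at most [d], counted in both directions. *)
Lemma score_rounding L L' x s K : 0 < s -> rounding x L' -> 0 <= d ->
  norm2 (indicator L - s *: x) <= K -> score U L - 4 * d * K <= score U L'.
Proof.
move=> s0 rnd d0 nK.
pose bad u : R := (L' u != L u)%:R.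
have bad_le u : bad u <= 2 * \sum_a ((indicator L - s *: x) 0 (rank_of u a)) ^+ 2.
  rewrite /bad; case: eqP => [_|ne] /=.
    by rewrite mulr_ge0 // sumr_ge0 // => a _; apply: sqr_ge0.
  have [lt|le] := ltP (\sum_a ((indicator L - s *: x) 0 (rank_of u a)) ^+ 2) (1 / 2).
    by case: ne; apply: rounding_correct lt.
  by lra.
have sum_bad : \sum_u bad u <= 2 * K.
  apply: le_trans (_ : 2 * norm2 (indicator L - s *: x) <= _); last by rewrite ler_wpM2l.
  by rewrite norm2_rank mulr_sumr; apply: ler_sum.
have : score U L - score U L' <= \sum_u \sum_v wt u v * (bad u + bad v).
  rewrite -sumrB; apply: ler_sum => u _; rewrite -sumrB; apply: ler_sum => v _.
  rewrite /bad; have w0 := weight0_ge0 u v.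
  case: (eqVneq (L' u) (L u)) => [->|_] /=; case: (eqVneq (L' v) (L v)) => [->|_] /=;
    rewrite ?subrr ?addr0 ?add0r ?mulr0 ?mulr1 //; do 2!case: ifP => _; lra.
have -> : \sum_u \sum_v wt u v * (bad u + bad v) = 2 * (d * \sum_u bad u).
  under eq_bigr => u _ do under eq_bigr => v _ do rewrite mulrDr.
  under eq_bigr => u _ do rewrite big_split /=.
  rewrite big_split /= mulr_natl mulr2n; congr (_ + _); last rewrite exchange_big /=;
    rewrite mulr_sumr; apply: eq_bigr => u _; rewrite -mulr_suml.
    by rewrite sum_weight0.
  by under eq_bigr => v _ do rewrite weight0C; rewrite sum_weight0.
have : d * \sum_u bad u <= d * (2 * K) by rewrite ler_wpM2l.
lra.
Qed.

End UniqueGameMath.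

(** The rows of [P] with eigenvalue above [theta] lie in [W] and are independent, being
    orthonormal. *)
Lemma low_dim_le (R : realType) N (M P : 'M[R]_N) (lam : 'rV[R]_N) (theta : R)
    (W : {vspace 'rV[R]_N}) :
  P *m P^T = 1%:M -> P *m M = diag_mx lam *m P ->
  is_span (eigenvector_above M theta) W ->
  (#|[set i | (theta < lam 0 i)%R]| <= \dim W)%N.
Proof.
move=> PP PM spanW; set A := [set i | _].
have PW : forall v, eigenvector_above M theta v -> v \in W.
  by apply/(spanW W); apply: subvv.
pose X := [tuple row (enum_val j) P | j < #|A|].
have XW : (<<X>> <= W)%VS.
  apply/span_subvP => v /mapP[j _ ->]; apply: PW; split.
    by rewrite -norm2_gt0 (norm2_row_basis PP).
  exists (lam 0 (enum_val j)); first by have := enum_valP j; rewrite inE.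
  by apply/eigenspaceP; apply: row_eigen.
have free : free X.
  apply/freeP => c c0 i.
  have := congr1 (fun v => dot v (row (enum_val i) P)) c0.
  rewrite dot0l dot_suml (bigD1 i) //= big1 => [|j ji].
    rewrite addr0 (nth_map i) ?size_enum_ord // nth_ord_enum dotZl.
    by rewrite (dot_basis PP) eqxx mulr1.
  rewrite (nth_map i) ?size_enum_ord // nth_ord_enum dotZl (dot_basis PP).
  by rewrite (inj_eq enum_val_inj) (negbTE ji) mulr0.
have := dimvS XW; rewrite (eqnP free) size_tuple //.
Qed.

(** * The algorithm *)

Definition main_part :=
  Seq mk_labels
  (Seq mk_ratio
  (Seq (ISet 22 (INum 0) (IAdd (IAdd (scalar 6) (scalar 6)) (scalar 21)))
  (Seq mk_laplacian
  (Seq power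
  (Seq (set_identity 8)
  (Seq (RSet 10 (INum 0) ROne)
  (Seq phase
  (Seq (set_identity 7)
  (Seq (RSet 10 (INum 0) RZero)
  (Seq phase
  (Seq mk_rounds
  (Seq enumerate
       select_best)))))))))))).

Definition algorithm :=
  Seq mk_env (Seq mk_degree (If (BRLt RZero (rscalar 4)) main_part Skip)).

Section Algorithm.
Variables (R : realType) (n k : nat) (U : unique_game R n k).
Variables (epsilon gamma d : R).
Hypothesis reg : regular U d.

Local Notation N := (\sum_(u < n) k)%N.

Definition laplacian : 'M[R]_N := (2 / gamma) *: (1%:M - d^-1 *: label_extended U).

Record pivot_run (m : nat) bs1 (E1 : 'M[R]_N) bs2 E2 : Prop := PivotRun {
  run1 : pivots (laplacian ^+ m) 1 1%:M bs1 E1;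
  run1_size : (size bs1 <= N)%N;
  run1_end : size bs1 = N \/ forall i, norm2 (row i ((laplacian ^+ m) *m E1)) <= 1;
  run2 : pivots 1%:M 0 E1 bs2 E2;
  run2_size : (size bs2 <= N)%N;
  run2_end : size bs2 = N \/ forall i, norm2 (row i (1%:M *m E2)) <= 0 }.

(** Pointers may run past the basis, where [b j] is whatever the memory holds. This only adds
    candidates, which cannot lower the best score. *)
Definition best_candidate g (bs : seq 'rV[R]_N) (L : 'I_n -> 'I_k) : Prop :=
  exists b : nat -> 'rV[R]_N, (forall j, (j < size bs)%N -> b j = bs`_j) /\
    forall x, x \in candidates b ((4 * g + 1) * (size bs).+1) ->
      exists2 L', rounding x.1 L' & score U L' <= score U L.

(** Without vertices every [d] is a degree, but the degree computed by the program is then an empty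
    sum, so its test fails in both cases. *)
Lemma wp_algorithm_degenerate D : (n <= D)%N -> (N <= D)%N -> n = 0%N \/ d <= 0 ->
  wp D algorithm (fun s => forall u : 'I_n, ints s 3 u = 0%N)
     (input_memory U epsilon gamma).
Proof.
move=> nD ND nd; rewrite wpSeq; apply: (wp_mk_env nD ND) => s1 f1 e1.
rewrite wpSeq; apply: (wp_mk_degree nD (env_n e1)) => s2 f2 s2d.
rewrite wpIf wpSkip [beval _ _]/= s2d ifF.
  by move=> u; rewrite f2.1 // f1.1 //= nth_nil.
apply/negbTE; rewrite -leNgt.
have [n0|n0] := posnP n; first by rewrite big1 // => v; have := ltn_ord v; rewrite {2}n0.
case: nd => [n0'|d0]; first by rewrite n0' in n0.
rewrite (eq_bigr (fun v => weight0 U (Ordinal n0) v)) ?(sum_weight0 reg) // => v _.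
by rewrite -(env_weight e1).
Qed.

Lemma wp_algorithm D g :
  (0 < n)%N -> (0 < k)%N -> 0 < d -> (2 * N + g <= D)%N ->
  (forall i, (i < g)%N -> i%:R * epsilon < gamma) -> gamma <= g%:R * epsilon ->
  (forall bs1 E1 bs2 E2, pivot_run (2 * N + g) bs1 E1 bs2 E2 ->
     3 ^ ((4 * g + 1) * (size bs2).+1) <= D)%N ->
  wp D algorithm (fun s => exists (L : 'I_n -> 'I_k) bs1 E1 bs2 E2,
     [/\ forall u : 'I_n, ints s 3 u = L u, pivot_run (2 * N + g) bs1 E1 bs2 E2
       & best_candidate g bs2 L])
     (input_memory U epsilon gamma).
Proof.
move=> n0 k0 d0 mD lt_g ge_g expD.
have ND : (N <= D)%N by lia.
have nD : (n <= D)%N by apply: leq_trans ND; rewrite sum_constE leq_pmulr.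
have kD : (k <= D)%N by apply: leq_trans ND; rewrite sum_constE leq_pmull.
have gD : (g <= D)%N by lia.
rewrite wpSeq; apply: (wp_mk_env nD ND) => s1 f1 e1.
rewrite wpSeq; apply: (wp_mk_degree nD (env_n e1)) => s2 f2 s2d.
have {}s2d : reals s2 4 0 = d.
  rewrite s2d -(sum_weight0 reg (Ordinal n0)); apply: eq_bigr => v _.
  by rewrite -(env_weight e1).
have e2 : env U epsilon gamma s2 by apply: env_frame f2 e1.
rewrite wpIf [beval _ _]/= s2d d0.
rewrite wpSeq; apply: (wp_mk_labels nD _ (env_n e2) (env_k e2) (env_k_table e2)) => //.
move=> s3 f3 lab; have e3 : env U epsilon gamma s3 by apply: env_frame f3 e2.
rewrite wpSeq; apply: (wp_mk_ratio gD (env_epsilon e3) (env_gamma e3) lt_g ge_g).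
move=> s4 f4 s4g; have e4 : env U epsilon gamma s4 by apply: env_frame f4 e3.
rewrite wpSeq wpI; set s5 := set_int _ _ _ _.
have f5 : frame (ISet 22 (INum 0) (INum 0)) s4 s5 by exact: frame_set_int.
have e5 : env U epsilon gamma s5 by apply: env_frame f5 e4.
have s5m : ints s5 22 0 = (2 * N + g)%N.
  by rewrite /s5 /= /update /= (env_tables e4).1 s4g mul2n addnn.
rewrite wpSeq; apply: (wp_mk_laplacian (d := d) ND e5).
- by rewrite f5.2 // f4.2 // f3.2.
- by move=> u i un ik; rewrite !f5.1 // !f4.1 //; apply: lab.
move=> s6 f6 e6 s6B.
rewrite wpSeq; apply: (wp_power ND mD (env_tables e6) _ s6B); first by rewrite f6.1.
move=> s7 f7 s7A; have e7 : env U epsilon gamma s7 by apply: env_frame f7 e6.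
rewrite wpSeq; apply: (wp_set_identity ND (env_tables e7)) => // s8 f8 s8E.
have e8 : env U epsilon gamma s8 by apply: env_frame f8 e7.
rewrite wpSeq wpR; set s9 := set_real _ _ _ _.
have f9 : frame (RSet 10 (INum 0) RZero) s8 s9 by exact: frame_set_real.
have e9 : env U epsilon gamma s9 by apply: env_frame f9 e8.
rewrite wpSeq; apply: (wp_phase (G := laplacian ^+ (2 * N + g)) (th := 1) (E0 := 1%:M)
   ND (env_tables e9)) => //.
  by rewrite f9.2 // f8.2.
move=> s10 f10 [bs1 [E1 [[pv1 s10E _] [_ sz1 end1]]]].
have e10 : env U epsilon gamma s10 by apply: env_frame f10 e9.
rewrite wpSeq; apply: (wp_set_identity ND (env_tables e10)) => // s11 f11 s11G.
have e11 : env U epsilon gamma s11 by apply: env_frame f11 e10.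
rewrite wpSeq wpR; set s12 := set_real _ _ _ _.
have f12 : frame (RSet 10 (INum 0) RZero) s11 s12 by exact: frame_set_real.
have e12 : env U epsilon gamma s12 by apply: env_frame f12 e11.
rewrite wpSeq; apply: (wp_phase (G := 1%:M) (th := 0) (E0 := E1) ND (env_tables e12)) => //.
  by rewrite f12.2 // f11.2.
move=> s13 f13 [bs2 [E2 [[pv2 _ s13c] [s13b sz2 end2]]]].
have run : pivot_run (2 * N + g) bs1 E1 bs2 E2 by split.
have e13 : env U epsilon gamma s13 by apply: env_frame f13 e12.
have s13g : ints s13 21 0 = g.
  by rewrite f13.1 // f12.1 // f11.1 // f10.1 // f9.1 // f8.1 // f7.1 // f6.1 // f5.1.
rewrite wpSeq; apply: (wp_mk_rounds ND (leq_trans sz2 ND) s13g s13c).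
move=> s14 f14 s14T; have e14 : env U epsilon gamma s14 by apply: env_frame f14 e13.
set T := ((4 * g + 1) * (size bs2).+1)%N in s14T.
have T3D : (3 ^ T <= D)%N by apply: expD run.
have TD : (T <= D)%N by apply: leq_trans T3D; apply/ltnW/ltn_expl.
rewrite wpSeq; apply: (wp_enumerate ND TD T3D (env_tables e14) s14T) => s15 f15 st.
have e15 : env U epsilon gamma s15 by apply: env_frame f15 e14.
apply: (wp_select_best nD kD k0 e15 st); first by rewrite size_candidates T3D expn_gt0.
move=> s L out best; exists L, bs1, E1, bs2, E2; split=> //.
exists (bvec N s14); split=> [j jb|x xc].
  rewrite /bvec (env_tables e14).2; last exact: leq_trans jb sz2.
  by rewrite f14.2 // s13b.
have [i ic <-] : exists2 i, (i < size (candidates (bvec N s14) T))%N &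
    nth (0, 0%N) (candidates (bvec N s14) T) i = x.
  by exists (index x (candidates (bvec N s14) T)); rewrite ?index_mem ?nth_index.
exact: best.
Qed.

End Algorithm.

(** * Quality of the assignment found *)

Lemma norm2_add3 (R : realType) N (u v w : 'rV[R]_N) :
  norm2 (u + v + w) <= 3 * (norm2 u + norm2 v + norm2 w).
Proof.
rewrite /norm2 /dot -!big_split mulr_sumr /=; apply: ler_sum => i _; rewrite !mxE.
move: (u 0 i) (v 0 i) (w 0 i) => x y z.
have := sqr_ge0 (x - y); have := sqr_ge0 (y - z); have := sqr_ge0 (x - z).
rewrite !expr2; nra.
Qed.

Section Quality.
Variables (R : realType) (n k : nat) (U : unique_game R n k).
Variables (epsilon gamma d : R).
Hypotheses (reg : regular U d) (d_gt0 : 0 < d) (n_gt0 : (0 < n)%N).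
Hypotheses (e_gt0 : 0 < epsilon) (eg : 8 * epsilon < gamma).

Local Notation N := (\sum_(u < n) k)%N.
Local Notation M := (label_extended U).

Variables (P : 'M[R]_N) (lam : 'rV[R]_N).
Hypotheses (PP : P *m P^T = 1%:M) (PM : P *m M = diag_mx lam *m P).

Local Notation B := (laplacian U gamma d).
Let mu : 'rV[R]_N := \row_i (2 / gamma * (1 - lam 0 i / d)).
Let r := #|[set i | (1 - gamma) * d < lam 0 i]|.

Let g_gt0 : 0 < gamma. Proof. by move: eg e_gt0; lra. Qed.

Let PB : P *m B = diag_mx mu *m P.
Proof.
rewrite /laplacian -scalemxAr mulmxBr mulmx1 -scalemxAr PM.
apply/matrixP => i j.
rewrite !mul_diag_mx !mxE; ring.
Qed.

Let B_sym : B^T = B.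
Proof. by rewrite /laplacian linearZ linearB /= trmx1 linearZ /= label_extended_sym. Qed.

Let mu_ge0 i : 0 <= mu 0 i.
Proof.
have : dot (row i P *m M) (row i P) <= d.
  by apply: le_trans (label_extended_le reg _) _; rewrite (norm2_row_basis PP) mulr1.
rewrite (row_eigen PM) dotZl -/(norm2 _) (norm2_row_basis PP) mulr1 => ld.
by rewrite mxE mulr_ge0 ?divr_ge0 ?(ltW g_gt0) // subr_ge0 ler_pdivrMr // mul1r.
Qed.

(** The factor [2 / gamma] in [laplacian] is chosen so that the threshold of [W] becomes the
    eigenvalue 2. *)
Let low_set : [set i | mu 0 i < 2] = [set i | (1 - gamma) * d < lam 0 i].
Proof.
apply/setP => i; rewrite !inE mxE -ltr_pdivlMl ?divr_gt0 //.
have -> : (2 / gamma)^-1 * 2 = gamma by field; rewrite gt_eqF.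
by rewrite ltrBlDr -ltrBlDl ltr_pdivlMr.
Qed.

Variable L0 : 'I_n -> 'I_k.
Hypothesis sat0 : satisfies_fraction U L0 (1 - epsilon).
Let x := indicator R L0.

Lemma score_satisfiable : (1 - epsilon) * (n%:R * d) <= score U L0.
Proof.
rewrite (total_weightE reg) scoreE; have := sat0; rewrite /satisfies_fraction; lra.
Qed.

Lemma indicator_energy : dot (x *m B) x <= 2 / gamma * epsilon * n%:R.
Proof.
rewrite /laplacian -scalemxAr mulmxBr mulmx1 dotZl dotBl -scalemxAr dotZl.
rewrite -/(norm2 x) norm2_indicator score_indicator -mulrA.
apply: ler_wpM2l; first by rewrite divr_ge0 // ltW.
rewrite lerBlDl -lerBlDr ler_pdivlMl //; have := score_satisfiable; lra.
Qed.

(** If all eigenvalues of [B] were at least 2, the energy of [x] would be at least [2 * n], but it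
    is at most [2 * (epsilon / gamma) * n]. The time bound uses this to replace [r.+1] by
    [2 * r]. *)
Lemma low_dim_gt0 : (0 < r)%N.
Proof.
rewrite lt0n; apply/eqP => r0.
have le2 i : 2 <= mu 0 i.
  rewrite leNgt; apply/negP => lt.
  have : i \in [set i | mu 0 i < 2] by rewrite inE.
  by rewrite low_set (cards0_eq r0) inE.
have : 2 * norm2 x <= dot (x *m B) x.
  rewrite (norm2_coord PP) (dot_coord PP) mulr_sumr; apply: ler_sum => i _.
  rewrite (dot_mulmx_basis PB) // -mulrA -expr2.
  by rewrite ler_wpM2r ?sqr_ge0.
have := indicator_energy; rewrite norm2_indicator.
have n0R : 0 < n%:R :> R by rewrite ltr0n.
have : 2 / gamma * epsilon < 2.
  by rewrite mulrAC ltr_pdivrMr //; move: eg e_gt0; lra.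
move: (2 / gamma * epsilon) => q; nra.
Qed.

(** The second run ends with the projection 0, so the number of its pivots is the trace of [E1].
    Being an integer below [r + 1], it is at most [r]. *)
Lemma run_size m bs1 E1 bs2 E2 : (N < 4 ^ m)%N ->
  pivot_run U gamma d m bs1 E1 bs2 E2 ->
  [/\ projection E1, E1 = \sum_(b <- bs2) line b,
    forall i, norm2 (row i ((B ^+ m) *m E1)) <= 1 & (size bs2 <= r)%N].
Proof.
move=> Nm [pv1 sz1 end1 pv2 sz2 end2].
have p1 : projection (1%:M : 'M[R]_N) by split; rewrite ?trmx1 ?mulmx1.
have pE1 := pivots_projection ler01 p1 pv1.
have E20 : E2 = 0.
  apply: (last_projection_eq0 pE1 (lexx 0) pv2).
  by case: end2 => [->|h]; [left | right=> i; have := h i; rewrite mul1mx].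
have short i : norm2 (row i ((B ^+ m) *m E1)) <= 1.
  case: end1 => [szN|//]; have E10 : E1 = 0.
    by apply: (last_projection_eq0 p1 ler01 pv1); left.
  by rewrite E10 mulmx0 row0 /norm2 dot0l.
have := pivots_decomposition pv2; rewrite E20 add0r => dec.
split=> //.
have := pivots_trace (lexx 0) pE1 pv2; rewrite E20 mxtrace0 => /esym/eqP.
rewrite subr_eq0 => /eqP tr1.
have := trace_le_low_dim PP PB pE1 short; rewrite low_set -/r tr1.
have lt1 : N%:R / 4 ^+ m < 1 :> R.
  by rewrite ltr_pdivrMr ?exprn_gt0 // mul1r -natrX ltr_nat.
rewrite -ltnS -(ltr_nat R) -[r.+1%:R]natr1; move: (N%:R / _) lt1 => q; lra.
Qed.

(** The distance from [x] to the scaled candidate has three parts: leaving the low part, the vectors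
    removed by the first run, and truncation. They cost [4], [1] and [1] times
    [(epsilon / gamma) * n]; [norm2_add3] contributes a factor 3, giving 18, and [score_rounding] a
    factor 4, giving 72. *)
Lemma quality g bs1 E1 bs2 E2 L : (0 < g)%N -> gamma <= g%:R * epsilon ->
  pivot_run U gamma d (2 * N + g) bs1 E1 bs2 E2 ->
  best_candidate U g bs2 L ->
  satisfies_fraction U L
    (1 - 72%:R * (epsilon / (gamma - 8 * epsilon) + epsilon)).
Proof.
move=> g0 ge_g run [b [bE best]].
set m := (2 * N + g)%N in run.
have n0R : 0 < n%:R :> R by rewrite ltr0n.
have g0R : 0 < g%:R :> R by rewrite ltr0n.
have Nm : (N < 4 ^ m)%N.
  apply: leq_trans (ltn_expl N (isT : 1 < 4)%N) _; rewrite leq_exp2l // /m; lia.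
have [pE1 dec short szr] := run_size Nm run.
have p1 : projection (1%:M : 'M[R]_N) by split; rewrite ?trmx1 ?mulmx1.
have [pv1 sz1 _ pv2 sz2 _] := run.
have [_ ortho] := pivots_orthogonal (lexx 0) pE1 pv2.
have norm := pivots_normalized pE1 pv2.
pose w := low_part P mu x.
have xw : norm2 (x - w) <= 4 * (epsilon / gamma) * n%:R.
  have h1 := norm2_sub_low_part PP PB x B_sym mu_ge0. apply: le_trans h1 _.
  have := indicator_energy; rewrite (_ : 2 / gamma * epsilon = 2 * (epsilon / gamma)); lra.
have wn : norm2 w <= n%:R.
  by rewrite -(norm2_indicator R L0); apply: low_part_norm2.
pose kappa := Num.sqrt (n%:R / 4 ^+ m : R).
have p4 j : 0 < 4 ^+ j :> R by rewrite exprn_gt0.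
have kappa2 : kappa ^+ 2 = n%:R / 4 ^+ m.
  by rewrite sqr_sqrtr // divr_ge0 // ltW.
have w_small i : `|dot w (row i ((B ^+ m) *m 1%:M))| <= kappa.
  rewrite mulmx1 -(@ler_pXn2r _ 2) ?nnegrE ?normr_ge0 ?sqrtr_ge0 //.
  rewrite real_normK ?num_real // kappa2.
  have h1 := low_part_power PP PB x m i B_sym mu_ge0. apply: le_trans h1 _.
  by rewrite norm2_indicator.
have [_ drop] := pivots_growth ler01 p1 (sqrtr_ge0 _) pv1 w_small.
have wE1 : norm2 (w - w *m E1) <= n%:R / g%:R.
  have -> : norm2 (w - w *m E1) = \sum_(u <- bs1) dot w u ^+ 2 / norm2 u.
    have := norm2_pythagoras w pE1; rewrite (norm2_projection w pE1).
    have e : norm2 w = dot w (w *m E1) + \sum_(u <- bs1) dot w u ^+ 2 / norm2 u.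
      rewrite /norm2 -{2}[w]mulmx1 (pivots_decomposition pv1) mulmxDr dotDr.
      congr (_ + _); rewrite mulmx_sumr dot_sumr; apply: eq_bigr => u _.
      by rewrite mulmx_line dotZr expr2 mulrAC.
    by rewrite e => /addrI ->.
  rewrite mul1r in drop; apply: le_trans drop _; rewrite kappa2.
  rewrite mulrCA ler_pM2l // ler_pdivrMr // mulrC ler_pdivlMr //.
  rewrite -!natrX -natrM ler_nat.
  (* [4 ^ N] pays for the growth over at most [N] pivots, [4 ^ g] for the factor [g]. *)
  apply: (@leq_trans (4 ^ (N + g))).
    rewrite expnD leq_mul // ?leq_exp2l //.
    exact: ltnW (ltn_expl g (isT : 1 < 4)%N).
  by rewrite leq_exp2l // /m; lia.
have wle : norm2 (w *m \sum_(u <- bs2) line u) <= norm2 w.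
  by rewrite -dec; apply: norm2_projection_le.
have [v [j [s [vj s0 close]]]] := good_candidate bE ortho norm n0R g0 wn wle.
have [L' rnd le] := best _ vj.
have inv_g : g%:R^-1 <= epsilon / gamma.
  rewrite -[leLHS]mul1r ler_pdivrMr // mulrAC ler_pdivlMr // mul1r mulrC //.
rewrite -dec in close.
have far : norm2 (x - s *: v) <= 18 * (epsilon / gamma) * n%:R.
  have -> : x - s *: v = (x - w) + (w - w *m E1) + (w *m E1 - s *: v).
    by rewrite !addrA !subrK.
  apply: le_trans (norm2_add3 _ _ _) _.
  have ng : n%:R / g%:R <= epsilon / gamma * n%:R by rewrite mulrC ler_wpM2r // ltW.
  move: xw wE1 close ng; move: (norm2 _) (norm2 _) (norm2 _) (n%:R / _) => a1 a2 a3 a4.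
  by move: (epsilon / gamma) => a5; lra.
have sc := score_rounding reg s0 rnd (ltW d_gt0) far.
have tot := total_weightE reg.
have tw0 : 0 <= total_weight U by have := mulr_ge0 (ltW n0R) (ltW d_gt0); rewrite tot; lra.
have s1 := score_satisfiable.
have sL : 2 * satisfied_weight U L = score U L by rewrite scoreE.
rewrite /satisfies_fraction.
(* The loss obtained is in terms of [epsilon / gamma], which is at most
   [epsilon / (gamma - 8 * epsilon)]. *)
apply: (@le_trans _ _ ((1 - epsilon - 72 * (epsilon / gamma)) * total_weight U)).
  apply: ler_wpM2r => //.
  have : epsilon / gamma <= epsilon / (gamma - 8 * epsilon).
    by rewrite ler_pM2l // lef_pV2 ?posrE; move: eg e_gt0; lra.
  move: (epsilon / gamma) (epsilon / _) => a1 a2 h; move: e_gt0; lra.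
have : score U L0 - 4 * d * (18 * (epsilon / gamma) * n%:R) =
  score U L0 - 72 * (epsilon / gamma) * (n%:R * d) by ring.
move: sc le s1 sL; rewrite tot; move: (epsilon / gamma) (score _ _) (score _ _) (score _ _).
move=> q z1 z2 z3 h1 h2 h3 h4 h5; nra.
Qed.

End Quality.

(** * Arithmetic of the running time *)

Lemma leq_pow m n e : (m <= n -> m ^ e <= n ^ e)%N.
Proof. by move=> le; elim: e => // e IH; rewrite !expnS leq_mul. Qed.

(** Separates the polynomial part of the time from the exponential one, so that no mixed products
    remain. *)
Lemma pow_add_le m n e : ((m + n) ^ e <= 2 ^ e * (m ^ e + n ^ e))%N.
Proof.
have [le|/ltnW le] := leqP m n.
  apply: (@leq_trans ((2 * n) ^ e)); first by apply: leq_pow; lia.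
  by rewrite expnMn leq_mul2l leq_addl orbT.
apply: (@leq_trans ((2 * m) ^ e)); first by apply: leq_pow; lia.
by rewrite expnMn leq_mul2l leq_addr orbT.
Qed.

(** For positive [K], [3 * K + 5 <= 8 * K]; for [K = 0] the summand [b] covers the constant. *)
Lemma poly_bound C e K (b := (C * 16 ^ e + e)%N) :
  (C * (2 ^ e * (3 * K + 5) ^ e) <= b * K ^ b + b)%N.
Proof.
have e16 : (2 ^ e * 8 ^ e = 16 ^ e)%N by rewrite -expnMn.
case: K => [|K].
  apply: leq_trans (leq_addl _ _); apply: leq_trans (leq_addr _ _).
  by rewrite leq_mul2l -e16 leq_mul2l leq_pow ?orbT.
apply: leq_trans (leq_addr _ _).
apply: (@leq_trans ((C * 16 ^ e) * K.+1 ^ e)).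
  rewrite -mulnA leq_mul2l -e16 -mulnA leq_mul2l -expnMn leq_pow ?orbT //; lia.
by rewrite leq_mul ?leq_addr // leq_pexp2l // leq_addl.
Qed.

(** Replacing 3 by 4 leaves only powers of 2, and [0 < E] lets constant factors be absorbed into a
    multiple of [E]. *)
Lemma exponential_bound C e E : (0 < E)%N ->
  (C * (2 ^ e * (2 * 3 ^ E) ^ e) <= 2 ^ ((C + 4 * e) * E))%N.
Proof.
move=> E0; apply: (@leq_trans (2 ^ C * (2 ^ e * (2 * 4 ^ E) ^ e))).
  apply: leq_mul; first exact: ltnW (ltn_expl C (ltnSn 1)).
  by rewrite leq_mul2l leq_pow ?orbT // leq_mul2l leq_pow.
rewrite (_ : 4 = 2 ^ 2)%N // -expnM -expnS -expnM -!expnD leq_exp2l //; nia.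
Qed.

(** The 20 comes from [(4 * g + 1) * r.+1 <= 10 * g * r] and [g <= 2 * (gamma / epsilon)]. *)
Lemma time_arithmetic C e : exists a b : nat,
  (forall K, C * (3 * K + 5) ^ e <= b * K ^ b + b)%N /\
  (forall (R : realType) K E (y : R), (0 < E)%N -> E%:R <= 20 * y ->
    (C * (3 * K + 5 + 2 * 3 ^ E) ^ e)%:R <=
      2 `^ (a%:R * y) + (b * K ^ b + b)%:R :> R).
Proof.
exists (20 * (C + 4 * e))%N, (C * 16 ^ e + e)%N; split=> [K|R K E y E0 Ey].
  apply: leq_trans (poly_bound C e K); rewrite leq_mul2l leq_pmull ?orbT //.
  by rewrite expn_gt0.
apply: (@le_trans _ _ ((2 ^ ((C + 4 * e) * E))%:R +
    (C * (2 ^ e * (3 * K + 5) ^ e))%:R)).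
  rewrite -natrD ler_nat [leqRHS]addnC.
  apply: (leq_trans _ (leq_add (leqnn _) (exponential_bound C e E0))).
  by rewrite -!mulnDr leq_mul2l pow_add_le orbT.
apply: lerD; last by rewrite ler_nat poly_bound.
rewrite natrX -powR_mulrn //; apply: ler_powR; first by rewrite ler1n.
rewrite !natrM [20 * _]mulrC -[leRHS]mulrA; exact: ler_wpM2l.
Qed.

(** The factor 2 absorbs the rounding up, as [gamma / epsilon] is at least 1. *)
Lemma least_ratio (R : realType) (epsilon gamma : R) : 0 < epsilon -> epsilon <= gamma ->
  exists g : nat, [/\ (0 < g)%N, forall i, (i < g)%N -> i%:R * epsilon < gamma,
    gamma <= g%:R * epsilon & g%:R <= 2 * (gamma / epsilon)].
Proof.
move=> e0 eg; have g0 : 0 < gamma by apply: lt_le_trans eg.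
have ex : exists i : nat, gamma <= i%:R * epsilon.
  exists (Num.bound (gamma / epsilon)); rewrite -ler_pdivrMr //.
  by apply/ltW/archi_boundP/divr_ge0; apply: ltW.
case: (ex_minnP ex) => g ge min; exists g.
have lt i : (i < g)%N -> i%:R * epsilon < gamma.
  by move=> ig; rewrite ltNge; apply/negP => /min; rewrite leqNgt ig.
have gp : (0 < g)%N by rewrite lt0n; apply: contraTneq ge => ->; rewrite mul0r -ltNge.
split=> //.
have := lt g.-1; rewrite prednK // leqnn => /(_ isT); rewrite -ltr_pdivlMr //.
have : 1 <= gamma / epsilon by rewrite ler_pdivlMr // mul1r.
rewrite -[in g%:R](prednK gp) -natr1; lra.
Qed.

Section Correctness.
Variables (R : realType) (C e a b : nat).
Hypothesis bound : forall D, (time_bound D algorithm <= C * D.+1 ^ e)%N.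
Hypothesis poly : forall K, (C * (3 * K + 5) ^ e <= b * K ^ b + b)%N.
Hypothesis expo : forall K E (y : R), (0 < E)%N -> E%:R <= 20 * y ->
  (C * (3 * K + 5 + 2 * 3 ^ E) ^ e)%:R <= 2 `^ (a%:R * y) + (b * K ^ b + b)%:R.
Variables (epsilon gamma d : R) (n k : nat) (U : unique_game R n k).
Local Notation N := (\sum_(u < n) k)%N.

Lemma algorithm_correct (W : {vspace 'rV[R]_N}) :
  0 < epsilon -> 8 * epsilon < gamma -> regular U d ->
  satisfiable U (1 - epsilon) ->
  is_span (eigenvector_above (label_extended U) ((1 - gamma) * d)) W ->
  exists (s : memory R) (t : nat) (L : 'I_n -> 'I_k),
    [/\ exec algorithm (input_memory U epsilon gamma) s t,
        t%:R <= 2 `^ (a%:R * (gamma / epsilon * (\dim W)%:R))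
                + (b * (n * k) ^ b + b)%:R,
        outputs s L
      & satisfies_fraction U L
          (1 - 72%:R * (epsilon / (gamma - 8 * epsilon) + epsilon))].
Proof.
move=> e0 eg reg [L0 sat0] spanW.
have g0 : 0 < gamma by lra.
have NE := sum_constE n k.
have nN : (n <= N)%N.
  case: (posnP n) => [->//|n0]; rewrite NE leq_pmulr //.
  exact: leq_ltn_trans (leq0n _) (ltn_ord (L0 (Ordinal n0))).
case: (boolP ((0 < n)%N && (0 < d))) => [/andP[n0 d0]|]; last first.
  rewrite negb_and -leqNgt leqn0 -leNgt => deg.
  have nd : n = 0%N \/ d <= 0 by case/orP: deg => [/eqP|]; [left | right].
  have nD : (n <= 3 * N + 4)%N by lia.
  have ND : (N <= 3 * N + 4)%N by lia.
  have [s [t [ex le out]]] :=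
    wp_sound (wp_algorithm_degenerate epsilon gamma reg nD ND nd).
  (* Array 3 still holds its initial zeros, so every label is 0; [L0] only shows that 0 is a label.
     The total weight turns out to be 0, so any labeling will do. *)
  pose L u := Ordinal (leq_ltn_trans (leq0n _) (ltn_ord (L0 u))).
  exists s, t, L; split=> //.
    apply: ler_wpDl; first exact: powR_ge0.
    rewrite ler_nat -NE; apply: leq_trans le (leq_trans (bound _) _).
    by have := poly N; rewrite addnS.
  have sat_ge0 : 0 <= satisfied_weight U L.
    by have := score_ge0 U L; rewrite scoreE pmulr_rge0.
  have tot_le0 : total_weight U <= 0.
    have : n%:R * d <= 0 by case: nd => [->|]; [rewrite mul0r | apply: mulr_ge0_le0].
    by rewrite (total_weightE reg) pmulr_rle0.
  have tot_ge0 : 0 <= total_weight U.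
    by apply: sumr_ge0 => u _; apply: sumr_ge0 => v /andP[_ /ug_weight_01 /andP[]].
  have tot0 : total_weight U = 0 by apply/le_anti/andP.
  by rewrite /satisfies_fraction tot0 mulr0.
have k0 : (0 < k)%N by exact: leq_ltn_trans (leq0n _) (ltn_ord (L0 (Ordinal n0))).
have [P [lam [PP PM]]] := spectral_theorem (label_extended_sym U).
have e_le_g : epsilon <= gamma by lra.
have [g [gp lt_g ge_g g_le]] := least_ratio e0 e_le_g.
have r0 := low_dim_gt0 reg d0 n0 e0 eg PP PM sat0.
have rW := low_dim_le PP PM spanW.
set r := #|_| in r0 rW.
pose E := ((4 * g + 1) * r.+1)%N.
have E0 : (0 < E)%N by rewrite /E muln_gt0 addn1.
have gE : (g <= 3 ^ E)%N.
  apply: leq_trans (ltnW (ltn_expl E (isT : 1 < 3)%N)); rewrite /E; nia.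
(* This [D] bounds every loop: the exponent [2 * N + g], where [g <= 3 ^ E], and the enumeration of
   at most [3 ^ E] candidates. *)
have mD : (2 * N + g <= 3 * N + 4 + 2 * 3 ^ E)%N by lia.
have Nm : (N < 4 ^ (2 * N + g))%N.
  by apply: leq_trans (ltn_expl N (isT : 1 < 4)%N) _; rewrite leq_exp2l //; lia.
have expD bs1 E1 bs2 E2 : pivot_run U gamma d (2 * N + g) bs1 E1 bs2 E2 ->
    (3 ^ ((4 * g + 1) * (size bs2).+1) <= 3 * N + 4 + 2 * 3 ^ E)%N.
  case/(run_size d0 e0 eg PP PM Nm) => _ _ _ szr.
  apply: (@leq_trans (3 ^ E)); last by lia.
  by rewrite leq_exp2l // leq_mul2l ltnS szr orbT.
have [s [t [ex le [L [bs1 [E1 [bs2 [E2 [out run best]]]]]]]]] :=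
  wp_sound (wp_algorithm reg n0 k0 d0 mD lt_g ge_g expD).
exists s, t, L; split=> //; last first.
  exact: (quality reg d0 n0 e0 eg PP PM sat0 gp ge_g run best).
apply: (@le_trans _ _ (C * (3 * N + 5 + 2 * 3 ^ E) ^ e)%:R).
  rewrite ler_nat; apply: leq_trans le (leq_trans (bound _) _).
  by rewrite leq_mul2l leq_pow ?orbT //; lia.
rewrite -NE; apply: expo => //.
apply: (@le_trans _ _ (10 * (g%:R * r%:R))).
  by rewrite -!natrM ler_nat /E; nia.
have h1 : g%:R * r%:R <= 2 * (gamma / epsilon) * r%:R :> R by rewrite ler_wpM2r.
have h2 : gamma / epsilon * r%:R <= gamma / epsilon * (\dim W)%:R.
  by rewrite ler_wpM2l ?ler_nat // divr_ge0 // ltW.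
lra.
Qed.

End Correctness.

Unset Implicit Arguments.

Theorem mainTheorem1 (R : realType) :
  exists (p : prog) (a b c : nat),
  forall (epsilon gamma : R), 0 < epsilon -> 8 * epsilon < gamma ->
  forall (n k : nat) (U : unique_game R n k) (d : R),
  regular U d ->
  satisfiable U (1 - epsilon) ->
  forall W : {vspace 'rV[R]_(\sum_(u < n) k)},
  is_span (eigenvector_above (label_extended U) ((1 - gamma) * d)) W ->
  exists (s : memory R) (t : nat) (L : 'I_n -> 'I_k),
    [/\ exec p (input_memory U epsilon gamma) s t,
        t%:R <= 2 `^ (a%:R * (gamma / epsilon * (\dim W)%:R))
                + (b * (n * k) ^ b + b)%:R,
        outputs s L
      & satisfies_fraction U L
          (1 - c%:R * (epsilon / (gamma - 8 * epsilon) + epsilon))].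
Proof.
have [C [e bound]] := time_bound_poly algorithm.
have [a [b [poly expo]]] := time_arithmetic C e.
exists algorithm, a, b, 72%N => epsilon gamma e0 eg n k U d reg sat W spanW.
exact: (algorithm_correct bound poly (expo R) e0 eg reg sat spanW).
Qed.
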